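(* Let $N\geq 2$ be an integer and let $\alpha>-2$. Define $$\gamma(N,\alpha):=2-\frac N2+\frac{\alpha}{2}+\frac{\sqrt{(\alpha+2)(\alpha+2N-2)}}{2}.$$ Then there exists a constant $C_{\alpha,N}$ depending only on $\alpha$ and $N$ such that, for every $f\in C^1(\mathbb{R})$ and every semi-stable radial solution $u\in H^1(B_1)$ of $$-\Delta u=|x|^\alpha f(u)\quad\text{in } B_1\setminus\{0\},$$ the following hold: (i) If $N<10+4\alpha$, then $\|u\|_{L^\infty(B_1)}\leq C_{\alpha,N}\,\|u\|_{H^1(B_1\setminus\overline{B_{1/2}})}$. (ii) If $N=10+4\alpha$, then $|u(r)|\leq C_{\alpha,N}\,\|u\|_{H^1(B_1\setminus\overline{B_{1/2}})}\,(|\log r|+1)$ for all $r\in(0,1]$. (iii) If $N>10+4\alpha$, then $|u(r)|\leq C_{\alpha,N}\,\|u\|_{H^1(B_1\setminus\overline{B_{1/2}})}\,r^{\gamma(N,\alpha)}$ for all $r\in(0,1]$.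
   Context: $B_1$ is the open unit ball of $\mathbb{R}^N$ centered at the origin, and $B_{1/2}$ is the ball of radius $1/2$ centered at the origin. A radial function is written $u(x)=u(|x|)=u(r)$ with $r=|x|$. Radial solutions $u\in H^1(B_1)$ of the equation are continuous in $r\in(0,1]$ and are viewed as classical solutions. A solution $u\in H^1(B_1)$ of $-\Delta u=|x|^\alpha f(u)$ in $B_1\setminus\{0\}$ is called semi-stable if $$\int_{B_1}\left(|\nabla\varphi|^2-|x|^\alpha f'(u)\varphi^2\right)dx\geq 0$$ for all $\varphi\in C^1(B_1)$ with compact support in $B_1\setminus\{0\}$. *)

(* Defs.v *)
From HB Require Import structures.
From mathcomp Require Import all_boot all_order all_algebra.
From mathcomp Require Import all_classical all_reals all_analysis.

Set Implicit Arguments.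
Unset Strict Implicit.
Unset Printing Implicit Defensive.
Import Order.TTheory GRing.Theory Num.Theory.
Import numFieldNormedType.Exports.
Local Open Scope classical_set_scope.
Local Open Scope ring_scope.

Definition rV_display : measure_display.
Proof. exact: default_measure_display. Qed.

Section measurable_rV.
Variables (R : realType) (n : nat).

(* The sigma-algebra generated by the coordinates, i.e. the Borel one. *)
Definition rV_measurable : set (set 'rV[R]_n) :=
  g_sigma_preimage (fun (i : 'I_n) (x : 'rV[R]_n) => x ord0 i : measurableTypeR R).

Let rV_measurable0 : rV_measurable set0.
Proof. exact: sigma_algebra0. Qed.

Let rV_measurableC A : rV_measurable A -> rV_measurable (~` A).
Proof. exact: sigma_algebraC. Qed.

Let rV_measurable_bigcup (F : (set 'rV[R]_n)^nat) :
  (forall i, rV_measurable (F i)) -> rV_measurable (\bigcup_i (F i)).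
Proof. exact: sigma_algebra_bigcup. Qed.

HB.instance Definition _ := @isMeasurable.Build rV_display 'rV[R]_n
  rV_measurable rV_measurable0 rV_measurableC rV_measurable_bigcup.

End measurable_rV.

Lemma measurable_coord (R : realType) n (i : 'I_n) :
  measurable_fun setT ((fun x : 'rV[R]_n => x ord0 i) : _ -> measurableTypeR R).
Proof.
move=> _ Y mY; rewrite setTI; apply: sub_sigma_algebra => /=.
rewrite -bigcup_seq/=; exists i => /=; first by rewrite mem_index_enum.
by exists Y => //; rewrite setTI.
Qed.

Lemma measurable_fun_rV d (T : measurableType d) (R : realType) n
    (f : T -> 'rV[R]_n) :
  (forall i, measurable_fun setT ((fun t => f t ord0 i) : T -> measurableTypeR R)) ->
  measurable_fun setT f.
Proof.
move=> mf _ A; rewrite setTI; move: A.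
apply: smallest_sub.
  split => [|A|F] /=.
  - by rewrite preimage_set0.
  - by move=> mA; rewrite setTD -preimage_setC; exact: measurableC.
  - by move=> mF; rewrite preimage_bigcup; exact: bigcup_measurable.
move=> A; rewrite -bigcup_seq => -[i _ [B mB <-]].
rewrite setTI -comp_preimage -[X in measurable X]setTI; exact: mf.
Qed.

Definition rV_cons (R : realType) n (p : measurableTypeR R * 'rV[R]_n) :
    'rV[R]_n.+1 :=
  \row_i (if unlift ord0 i is Some j then p.2 ord0 j else p.1).

Definition rV_uncons (R : realType) n (x : 'rV[R]_n.+1) :
    measurableTypeR R * 'rV[R]_n :=
  (x ord0 ord0, \row_j x ord0 (lift ord0 j)).

Lemma rV_consK (R : realType) n : cancel (@rV_cons R n) (@rV_uncons R n).
Proof.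
move=> [a v]; rewrite /rV_cons /rV_uncons; congr pair; first by rewrite mxE unlift_none.
by apply/rowP => j; rewrite !mxE liftK.
Qed.

Lemma measurable_rV_cons (R : realType) n :
  measurable_fun setT (@rV_cons R n).
Proof.
apply: measurable_fun_rV => i; rewrite /rV_cons.
have [j ->|->] := unliftP ord0 i.
  rewrite (_ : (fun _ => _) = (fun x : 'rV[R]_n => x ord0 j) \o snd); last first.
    by apply/funext => p; rewrite !mxE liftK.
  exact: measurableT_comp (measurable_coord j) measurable_snd.
rewrite (_ : (fun _ => _) = fst)//.
by apply/funext => p; rewrite !mxE unlift_none.
Qed.

Lemma measurable_rV_uncons (R : realType) n :
  measurable_fun setT (@rV_uncons R n).
Proof.
apply: measurable_fun_pair; first exact: measurable_coord.
apply: measurable_fun_rV => i.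
rewrite (_ : (fun _ => _) = (fun x : 'rV[R]_n.+1 => x ord0 (lift ord0 i))).
  exact: measurable_coord.
by apply/funext => x; rewrite mxE.
Qed.

Definition lebesgue_rVS (R : realType) n
    (m : {sigma_finite_measure set 'rV[R]_n -> \bar R}) :
    set 'rV[R]_n.+1 -> \bar R :=
  pushforward (@lebesgue_measure R \x m)%E (@rV_cons R n).

Section lebesgue_rVS.
Variables (R : realType) (n : nat)
  (m : {sigma_finite_measure set 'rV[R]_n -> \bar R}).

HB.instance Definition _ := Measure.copy (lebesgue_rVS m)
  (measure_function_pushforward__canonical__measure_function_Measure
    (@lebesgue_measure R \x m)%E (@measurable_rV_cons R n)).

Let sigma_finite_lebesgue_rVS : sigma_finite setT (lebesgue_rVS m).
Proof.
have /sigma_finiteP[F [TF ndF Foo]] := sigma_finiteT (@lebesgue_measure R).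
have /sigma_finiteP[G [TG ndG Goo]] := sigma_finiteT m.
exists (fun k => @rV_uncons R n @^-1` (F k `*` G k)).
  rewrite -preimage_bigcup; apply/esym; rewrite -subTset => x _.
  have [k _ Fk] : (\bigcup_k F k) (rV_uncons x).1 by rewrite -TF.
  have [l _ Gl] : (\bigcup_k G k) (rV_uncons x).2 by rewrite -TG.
  exists (maxn k l) => //; split.
  - by move: Fk; exact/subsetPset/ndF/leq_maxl.
  - by move: Gl; exact/subsetPset/ndG/leq_maxr.
move=> k; have [mF Fk] := Foo k; have [mG Gk] := Goo k; split.
  rewrite -[X in measurable X]setTI.
  by apply: measurable_rV_uncons => //; exact: measurableX.
rewrite /lebesgue_rVS /pushforward -comp_preimage.
rewrite (_ : _ \o _ = id) ?preimage_id; last by apply/funext => x; exact: rV_consK.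
by rewrite product_measure1E// lte_mul_pinfty// ge0_fin_numE.
Qed.

HB.instance Definition _ := Measure_isSigmaFinite.Build _ _ _
  (lebesgue_rVS m) sigma_finite_lebesgue_rVS.

End lebesgue_rVS.

Section lebesgue_rV0.
Variable R : realType.

Definition lebesgue_rV0 : set 'rV[R]_0 -> \bar R := \d_(0 : 'rV[R]_0).

HB.instance Definition _ := Measure.on lebesgue_rV0.

Let sigma_finite_lebesgue_rV0 : sigma_finite setT lebesgue_rV0.
Proof.
exists (fun=> setT); first by rewrite bigcup_const.
by move=> _; split => //; rewrite /lebesgue_rV0 diracT ltry.
Qed.

HB.instance Definition _ := Measure_isSigmaFinite.Build _ _ _
  lebesgue_rV0 sigma_finite_lebesgue_rV0.

End lebesgue_rV0.

Fixpoint lebesgue_rV (R : realType) (n : nat) :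
    {sigma_finite_measure set 'rV[R]_n -> \bar R} :=
  match n with
  | 0 => @lebesgue_rV0 R
  | n'.+1 => lebesgue_rVS (lebesgue_rV R n')
  end.

Lemma lebesgue_rV_box (R : realType) n (a b : 'rV[R]_n) :
  (forall i, a ord0 i <= b ord0 i) ->
  lebesgue_rV R n [set x : 'rV[R]_n | forall i, x ord0 i \in `[a ord0 i, b ord0 i]%R] =
    (\prod_(i < n) (b ord0 i - a ord0 i))%:E.
Proof.
elim: n a b => [|n IH] a b ab.
  by rewrite big_ord0 /= /lebesgue_rV0 diracE mem_set//= => -[].
rewrite big_ord_recl /=.
pose B := [set x : 'rV[R]_n | forall i,
  x ord0 i \in `[(rV_uncons a).2 ord0 i, (rV_uncons b).2 ord0 i]%R].
transitivity ((@lebesgue_measure R \x lebesgue_rV R n)%E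
    (`[a ord0 ord0, b ord0 ord0]%classic `*` B)).
  congr product_measure1; apply/seteqP; split => -[x v] /=.
    move=> h; split; first by have := h ord0; rewrite mxE unlift_none.
    by move=> i; have := h (lift ord0 i); rewrite !mxE liftK.
  move=> [h0 h] i; rewrite !mxE; case: unliftP => [j ->|->//].
  by have := h j; rewrite !mxE.
rewrite product_measure1E//=; last first.
  rewrite (_ : B = \bigcap_(i in [set: 'I_n]) ((fun x : 'rV[R]_n => x ord0 i)
    @^-1` `[(rV_uncons a).2 ord0 i, (rV_uncons b).2 ord0 i]%classic)).
    apply: fin_bigcap_measurable => // i _.
    by rewrite -[X in measurable X]setTI; apply: measurable_coord.
  by apply/seteqP; split => x /= h; [move=> i _; exact: h|move=> i; exact: (h i)].
rewrite IH; last by move=> i; rewrite /= !mxE.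
rewrite lebesgue_measure_itv /= lte_fin.
under eq_bigr do rewrite !mxE.
case: ifPn => [_|]; first by rewrite -EFinB -EFinM.
rewrite -leNgt => h; rewrite (_ : b ord0 ord0 = a ord0 ord0) ?subrr ?mul0r ?mul0e//.
by apply/eqP; rewrite eq_le h ab.
Qed.

(* Euclidean norm; the norm `|x| of 'rV[R]_n is the maximum norm. *)
Definition enorm (R : realType) n (x : 'rV[R]_n) : R :=
  Num.sqrt (\sum_(i < n) x ord0 i ^+ 2).

Definition oball (R : realType) n (r : R) : set 'rV[R]_n :=
  [set x | enorm x < r].
Arguments oball {R} n r.

Definition cball (R : realType) n (r : R) : set 'rV[R]_n :=
  [set x | enorm x <= r].
Arguments cball {R} n r.

Definition partial (R : realType) n (i : 'I_n) (u : 'rV[R]_n -> R)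
    (x : 'rV[R]_n) : R :=
  'D_(delta_mx ord0 i) u x.

Definition gradient (R : realType) n (u : 'rV[R]_n -> R)
    (x : 'rV[R]_n) : 'rV[R]_n :=
  \row_i partial i u x.

Definition laplacian (R : realType) n (u : 'rV[R]_n -> R) (x : 'rV[R]_n) : R :=
  \sum_(i < n) partial i (partial i u) x.

(* Meant for Omega open; nothing is asked of u outside Omega. *)
Definition C1_on (R : realType) n (Omega : set 'rV[R]_n)
    (u : 'rV[R]_n -> R) : Prop :=
  forall (i : 'I_n) x, Omega x ->
    derivable u x (delta_mx ord0 i) /\ {for x, continuous (partial i u)}.

Definition C2_on (R : realType) n (Omega : set 'rV[R]_n)
    (u : 'rV[R]_n -> R) : Prop :=
  C1_on Omega u /\ forall i : 'I_n, C1_on Omega (partial i u).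

(* C^1 functions with compact support in Omega, extended by 0 to R^n. *)
Definition test_function (R : realType) n (Omega : set 'rV[R]_n)
    (phi : 'rV[R]_n -> R) : Prop :=
  let supp := closure [set x | phi x != 0] in
  [/\ C1_on [set: 'rV[R]_n] phi, compact supp & supp `<=` Omega].

Definition Linfty_norm (R : realType) n (Omega : set 'rV[R]_n)
    (u : 'rV[R]_n -> R) : \bar R :=
  Lnorm (lebesgue_rV R n) +oo%E (EFin \o (u \_ Omega)).

Definition L2 (R : realType) n (Omega : set 'rV[R]_n)
    (u : 'rV[R]_n -> R) : Prop :=
  measurable_fun Omega u /\
  (\int[lebesgue_rV R n]_(x in Omega) (u x ^+ 2)%:E < +oo)%E.

(* The weak gradients of u that lie in L^2(Omega).  They are unique up to a
   null set.  Testing against C^1_c instead of C^oo_c functions gives the same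
   weak gradients, by mollification. *)
Definition weak_gradients (R : realType) n (Omega : set 'rV[R]_n)
    (u : 'rV[R]_n -> R) : set ('rV[R]_n -> 'rV[R]_n) :=
  [set g : 'rV[R]_n -> 'rV[R]_n | forall i : 'I_n,
    L2 Omega (fun x => g x ord0 i) /\
    forall phi, test_function Omega phi ->
      (\int[lebesgue_rV R n]_(x in Omega) (u x * partial i phi x)%:E =
       - \int[lebesgue_rV R n]_(x in Omega) (g x ord0 i * phi x)%:E)%E].

Definition H1 (R : realType) n (Omega : set 'rV[R]_n)
    (u : 'rV[R]_n -> R) : Prop :=
  L2 Omega u /\ weak_gradients Omega u !=set0.

(* An arbitrary choice; irrelevant in integrals, by uniqueness a.e. *)
Definition weak_gradient (R : realType) n (Omega : set 'rV[R]_n)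
    (u : 'rV[R]_n -> R) : 'rV[R]_n -> 'rV[R]_n :=
  xget (fun=> 0) (weak_gradients Omega u).

Definition H1_norm (R : realType) n (Omega : set 'rV[R]_n)
    (u : 'rV[R]_n -> R) : \bar R :=
  ((\int[lebesgue_rV R n]_(x in Omega)
      (u x ^+ 2 + enorm (weak_gradient Omega u x) ^+ 2)%:E) `^ 2^-1)%E.

Definition C1_real (R : realType) (f : R -> R) : Prop :=
  (forall t, derivable f t 1) /\ continuous (derive1 f).

Definition radial (R : realType) n (u : R -> R) : 'rV[R]_n -> R :=
  fun x => u (enorm x).
Arguments radial {R} n u.

Definition punctured_ball (R : realType) n : set 'rV[R]_n :=
  oball n 1 `\ 0.
Arguments punctured_ball R n : clear implicits.

Definition outer_annulus (R : realType) n : set 'rV[R]_n :=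
  oball n 1 `\` cball n 2^-1.
Arguments outer_annulus R n : clear implicits.

Definition classical_solution (R : realType) n (alpha : R) (f : R -> R)
    (Omega : set 'rV[R]_n) (u : 'rV[R]_n -> R) : Prop :=
  C2_on Omega u /\
  forall x, Omega x -> - laplacian u x = enorm x `^ alpha * f (u x).

Definition semi_stable (R : realType) n (alpha : R) (f : R -> R)
    (u : 'rV[R]_n -> R) : Prop :=
  forall phi, test_function (punctured_ball R n) phi ->
    (0 <= \int[lebesgue_rV R n]_(x in oball n 1)
       (enorm (gradient phi x) ^+ 2
        - enorm x `^ alpha * derive1 f (u x) * phi x ^+ 2)%:E)%E.

Definition gamma_exponent (R : realType) (N : nat) (alpha : R) : R :=
  2 - N%:R / 2 + alpha / 2
  + Num.sqrt ((alpha + 2) * (alpha + 2 * N%:R - 2)) / 2.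

(* Main.v *)
Require Import Defs.
From HB Require Import structures.
From mathcomp Require Import all_boot all_order all_algebra.
From mathcomp Require Import all_classical all_reals all_analysis.
From mathcomp Require Import measurable_realfun ess_sup_inf ring lra.

Set Implicit Arguments.
Unset Strict Implicit.
Unset Printing Implicit Defensive.
Import Order.TTheory GRing.Theory Num.Theory.
Import numFieldNormedType.Exports.
Local Open Scope classical_set_scope.
Local Open Scope ring_scope.

(** Write N = n + 1, a = alpha / 2 + 1 and b = sqrt (a (alpha / 2 + n)), so that
    0 < a <= b because N >= 2; the exponent of the statement is
    gamma = (alpha + 3 - n) / 2 + b ([gamma_exponentE]).

    Everything is reduced to functions of r = |x|. Lebesgue measure of the ball
    of radius r is a multiple of r^N, hence integrals of radial functions are
    integrals against r^n dr ([polar_integral]). A radial classical solution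
    satisfies u'' + n u' / r = - r^alpha f(u) ([radial_equation_of_solution]),
    and semi-stability with radial test functions becomes an inequality on
    ]0, 1[ ([radially_stable_of_semi_stable]). The function r^(-alpha/2) u'
    solves the linearized equation up to the term b^2 r^(-2), so that testing
    with r^(-alpha/2) u' z eliminates f and leaves
      int r^(n - alpha) u'^2 (z'^2 - b^2 z^2 / r^2) dr >= 0
    for every compactly supported C^1 function z ([stability_hardy]).

    The decay of u' follows by taking for z, up to cutoffs near 0 and near 1,
    the function r^a / (D + r^(a + b)) with D = r0^(a + b). It interpolates
    between r^a and r^(-b), its logarithmic derivative stays between - b / r
    and b / r, so the integrand is nonpositive away from the cutoffs, and it
    is strictly negative around r0. The cost of the cutoff near 0 vanishes
    along a sequence because the Dirichlet energy is finite; the cost of the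
    cutoff near 1 is the energy on the outer annulus. This gives
      int_r0^(2 r0) u'^2 dr <= C r0^(2 gamma - 1) E
    ([energy_concentration], [energy_decay]), hence |u(x) - u(y)| is at most
    C r0^gamma sqrt E on [r0, 2 r0] ([dyadic_oscillation]). Summing over dyadic
    intervals ([dyadic_iteration]) gives the three regimes according to the
    sign of gamma, which is the sign of 10 + 4 alpha - N ([radial_bound],
    [sgr_decay_exponent]).

    It remains to compare with the weak gradient g of the H^1 norms. No
    regularization is needed: testing the definition of g with the C^1 field
    chi(|x|) u'(|x|) x / |x|, whose divergence is radial, shows that the
    integral of chi u'^2 is at most the integral of |g|^2
    ([weak_gradient_energy]). It yields both the finiteness of the energy and
    its control by the norm on the outer annulus ([H1_norm_outer_control]). *)

(** * One-variable calculus *)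

(** Pointwise calculus rules for functions written as abstractions. *)

Section pointwise_calculus.
Variable R : realType.
Implicit Types (f g : R -> R) (x a b : R).

Lemma der_cst x c : is_derive x 1 (fun=> c : R) 0.
Proof. exact: is_derive_cst. Qed.

Lemma der_id x : is_derive x 1 (fun t : R => t) 1.
Proof. exact: is_derive_id. Qed.

Lemma derD f g x a b : is_derive x 1 f a -> is_derive x 1 g b ->
  is_derive x 1 (fun t => f t + g t) (a + b).
Proof. exact: is_deriveD. Qed.

Lemma derB f g x a b : is_derive x 1 f a -> is_derive x 1 g b ->
  is_derive x 1 (fun t => f t - g t) (a - b).
Proof. exact: is_deriveB. Qed.

Lemma derM f g x a b : is_derive x 1 f a -> is_derive x 1 g b ->
  is_derive x 1 (fun t => f t * g t) (a * g x + f x * b).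
Proof.
move=> df dg; apply: is_derive_eq (is_deriveM df dg) _.
by rewrite /GRing.scale/= addrC (mulrC (g x)).
Qed.

Lemma derZ f x c a : is_derive x 1 f a -> is_derive x 1 (fun t => c * f t) (c * a).
Proof.
move=> df; apply: is_derive_eq (derM (der_cst x c) df) _.
by rewrite mul0r add0r.
Qed.

Lemma derX f x n a : is_derive x 1 f a ->
  is_derive x 1 (fun t => f t ^+ n) (n%:R * f x ^+ n.-1 * a).
Proof.
move=> df; apply: (@is_derive_eq _ _ _ (fun t => f t ^+ n) _ _
  ((n%:R * f x ^+ n.-1) *: a)) => //.
rewrite (_ : (fun t => _) = f ^+ n); first exact: is_deriveX.
by rewrite fctE.
Qed.

Lemma der_comp f g x a b : is_derive (g x) 1 f a -> is_derive x 1 g b ->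
  is_derive x 1 (fun t => f (g t)) (a * b).
Proof. move=> df dg; exact: is_derive1_comp. Qed.

Lemma derV f x a : f x != 0 -> is_derive x 1 f a ->
  is_derive x 1 (fun t => (f t)^-1) (- a / f x ^+ 2).
Proof.
move=> fx0 df; have := is_deriveV fx0 df.
rewrite (_ : _ *: _ = - a / f x ^+ 2)//.
by rewrite /GRing.scale/= mulNr mulrC mulNr.
Qed.

Lemma der_powR x a : 0 < x -> is_derive x 1 (fun t => t `^ a) (a * x `^ (a - 1)).
Proof. by move=> x0; exact: is_derive1_powR. Qed.

Lemma der_continuous f x a : is_derive x 1 f a -> {for x, continuous f}.
Proof.
by move=> df; apply/differentiable_continuous/derivable1_diffP; exact: ex_derive.
Qed.

Lemma der_near f g x a : (\near x, f x = g x) -> is_derive x 1 f a ->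
  is_derive x 1 g a.
Proof.
exact: near_eq_is_derive.
Qed.

Lemma cont_cst x c : {for x, continuous (fun=> c : R)}.
Proof. exact: cvg_cst. Qed.

Lemma contD f g x : {for x, continuous f} -> {for x, continuous g} ->
  {for x, continuous (fun t => f t + g t)}.
Proof. exact: cvgD. Qed.

Lemma contB f g x : {for x, continuous f} -> {for x, continuous g} ->
  {for x, continuous (fun t => f t - g t)}.
Proof. exact: cvgB. Qed.

Lemma contM f g x : {for x, continuous f} -> {for x, continuous g} ->
  {for x, continuous (fun t => f t * g t)}.
Proof. exact: cvgM. Qed.

Lemma contX f x n : {for x, continuous f} ->
  {for x, continuous (fun t => f t ^+ n)}.
Proof.
move=> cf; exact: (continuous_comp cf (@exprn_continuous R n _)).
Qed.

Lemma contV f x : f x != 0 -> {for x, continuous f} ->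
  {for x, continuous (fun t => (f t)^-1)}.
Proof. by move=> fx0 cf; exact: cvgV. Qed.

Lemma cont_powR x a : 0 < x -> {for x, continuous (fun t : R => t `^ a)}.
Proof. by move=> x0; apply: der_continuous (der_powR a x0). Qed.

Lemma cont_exprn x n : {for x, continuous (fun t : R => t ^+ n)}.
Proof. exact: exprn_continuous. Qed.

End pointwise_calculus.

Section segment_integral.
Variable R : realType.
Implicit Types (f g : R -> R) (a b c : R).

(** Integral over a segment; only used for functions continuous at each point
    of the segment. *)
Definition seg_int a b f : R := \int[@lebesgue_measure R]_(x in `[a, b]) f x.

(** Two-sided continuity at each point of [a, b], end points included. *)
Definition cont_on a b f := forall x, a <= x <= b -> {for x, continuous f}.

Lemma cont_onW a b a' b' f : a <= a' -> b' <= b -> cont_on a b f -> cont_on a' b' f.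
Proof.
move=> aa bb h x /andP[ax xb]; apply: h.
by rewrite (le_trans aa)//= (le_trans _ bb).
Qed.

Lemma cont_on_within a b f : cont_on a b f -> {within `[a, b], continuous f}.
Proof.
by move=> h; apply: continuous_in_subspaceT => t /set_mem; rewrite /= in_itv/=; exact: h.
Qed.

Lemma seg_integrable a b f : cont_on a b f ->
  (@lebesgue_measure R).-integrable `[a, b] (EFin \o f).
Proof.
move=> h; apply: continuous_compact_integrable; first exact: segment_compact.
exact: cont_on_within.
Qed.

Lemma eq_seg_int a b f g : (forall x, a <= x <= b -> f x = g x) ->
  seg_int a b f = seg_int a b g.
Proof.
by move=> h; apply: eq_Rintegral => x; rewrite inE/= in_itv/=; exact: h.
Qed.

Lemma le_seg_int a b f g : cont_on a b f -> cont_on a b g ->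
  (forall x, a <= x <= b -> f x <= g x) -> seg_int a b f <= seg_int a b g.
Proof.
move=> cf cg h; apply: le_Rintegral => //; try exact: seg_integrable.
Qed.

Lemma seg_int_ge0 a b f : (forall x, a <= x <= b -> 0 <= f x) -> 0 <= seg_int a b f.
Proof.
by move=> h; apply: Rintegral_ge0 => x; rewrite /= in_itv/=; exact: h.
Qed.

Lemma seg_intD a b f g : cont_on a b f -> cont_on a b g ->
  seg_int a b (fun x => f x + g x) = seg_int a b f + seg_int a b g.
Proof. by move=> cf cg; apply: RintegralD => //; exact: seg_integrable. Qed.

Lemma seg_intZ a b k f : cont_on a b f ->
  seg_int a b (fun x => k * f x) = k * seg_int a b f.
Proof. by move=> cf; apply: RintegralZl => //; exact: seg_integrable. Qed.

Lemma seg_int_cst a b k : a <= b -> seg_int a b (fun=> k) = k * (b - a).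
Proof.
move=> ab; rewrite /seg_int Rintegral_cst//; congr (_ * _).
transitivity (fine (@lebesgue_measure R `[a, b]%classic)); first by [].
rewrite lebesgue_measure_itv/= lte_fin.
by move: ab; rewrite le_eqVlt => /predU1P[->|->] //=; rewrite ltxx subrr.
Qed.

Lemma seg_int_split c a b f : a <= c <= b -> cont_on a b f ->
  seg_int a b f = seg_int a c f + seg_int c b f.
Proof.
move=> /andP[ac cb] cf; rewrite /seg_int.
have := @Rintegral_itvB R f (BLeft a) (BRight b) c (seg_integrable cf).
rewrite !bnd_simp => /(_ ac cb) /eqP; rewrite subr_eq => /eqP ->.
rewrite addrC; congr (_ + _); rewrite Rintegral_itv_obnd_cbnd//.
apply: (integrableS _ _ _ (seg_integrable cf)) => //.
by apply: subset_itvr; rewrite bnd_simp.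
Qed.

(** The fundamental theorem of calculus. *)
Lemma seg_int_derive a b f F : a <= b -> cont_on a b f ->
  (forall x, a <= x <= b -> is_derive x 1 F (f x)) ->
  seg_int a b f = F b - F a.
Proof.
rewrite le_eqVlt => /predU1P[<- _ _|ab cf dF].
  by rewrite /seg_int set_itv1 Rintegral_set1 subrr.
have cF x : a <= x <= b -> {for x, continuous F}.
  by move=> xab; apply: der_continuous (dF _ xab).
rewrite /seg_int /Rintegral (@continuous_FTC2 _ f F)//.
- exact: cont_on_within.
- split.
  + move=> x; rewrite in_itv/= => /andP[ax xb].
    by have [] : is_derive x 1 F (f x) by apply: dF; rewrite !ltW.
  + by apply: cvg_at_right_filter; apply: cF; rewrite lexx ltW.
  + by apply: cvg_at_left_filter; apply: cF; rewrite lexx ltW.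
- move=> x; rewrite in_itv/= => /andP[ax xb]; rewrite derive1E.
  by have [] : is_derive x 1 F (f x) by apply: dF; rewrite !ltW.
Qed.

End segment_integral.

(** * Lebesgue measure of balls *)

Lemma lebesgue_measure_dilation (R : realType) (s : R) (A : set (measurableTypeR R)) :
  0 < s -> measurable A ->
  lebesgue_measure (( *%R s : measurableTypeR R -> measurableTypeR R) @^-1` A) = (s^-1%:E * lebesgue_measure A)%E.
Proof.
move=> s0 mA.
have ms : measurable_fun setT ( *%R s : measurableTypeR R -> measurableTypeR R).
  exact: mulrl_measurable.
pose m : {measure set measurableTypeR R -> \bar R} :=
  measure_function_pushforward__canonical__measure_function_Measure
    (@lebesgue_measure R) ms.
pose nu : {measure set measurableTypeR R -> \bar R} := mscale (NngNum (ltW s0)) m.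
have : lebesgue_measure A = nu A.
  apply: (@lebesgue_measure_unique _ nu) => // _ [[a b]] _ <-.
  have -> : nu `]a, b]%classic = (s%:E * lebesgue_measure (`](a / s)%R, (b / s)%R]%classic : set R))%E.
    congr (_ * lebesgue_measure _)%E; apply/seteqP; split => x /=;
      by rewrite !in_itv/= ltr_pdivrMr// ler_pdivlMr// mulrC.
  rewrite !lebesgue_measure_itv /= !lte_fin ltr_pM2r ?invr_gt0//.
  case: ifP => _; last by rewrite mule0.
  by rewrite -!EFinB -EFinM -mulrBl mulrCA mulfV ?gt_eqF// mulr1.
move=> ->; rewrite /nu /mscale /= muleA -EFinM mulVf ?gt_eqF// mul1e.
by [].
Qed.

Lemma ge0_integral_dilation (R : realType) (s : R) (f : measurableTypeR R -> \bar R) :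
  0 < s -> measurable_fun setT f -> (forall x, 0 <= f x)%E ->
  (\int[lebesgue_measure]_x f (s * x)%R = s^-1%:E * \int[lebesgue_measure]_x f x)%E.
Proof.
move=> s0 mf f0.
have ms : measurable_fun setT ( *%R s : measurableTypeR R -> measurableTypeR R).
  exact: mulrl_measurable.
have sV0 : 0 <= s^-1 by rewrite invr_ge0 ltW.
transitivity (\int[pushforward (@lebesgue_measure R) ( *%R s : measurableTypeR R -> measurableTypeR R)]_x f x)%E.
  by rewrite ge0_integral_pushforward.
transitivity (\int[mscale (NngNum sV0) (@lebesgue_measure R)]_x f x)%E.
  apply: eq_measure_integral => A mA _.
  exact: lebesgue_measure_dilation.
by rewrite ge0_integral_mscale.
Qed.

(** The N-dimensional Lebesgue measure is homogeneous of degree N. *)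
Lemma lebesgue_rV_dilation (R : realType) n (s : R) (A : set 'rV[R]_n) :
  0 < s -> measurable A ->
  lebesgue_rV R n ((fun x => s *: x) @^-1` A) = ((s ^- n)%:E * lebesgue_rV R n A)%E.
Proof.
move=> s0; elim: n A => [|n IH] A mA.
  rewrite expr0 invr1 mul1e; congr (lebesgue_rV R 0 _).
  apply/seteqP; split => x /=; rewrite (_ : s *: x = x)//;
    by apply/rowP => -[].
rewrite /= /lebesgue_rVS /pushforward /product_measure1.
have mB : measurable (@rV_cons R n @^-1` A).
  by rewrite -[X in measurable X]setTI; apply: measurable_rV_cons.
pose F := fun a : measurableTypeR R => lebesgue_rV R n (xsection (@rV_cons R n @^-1` A) a).
have mF : measurable_fun setT F by exact: measurable_fun_xsection.
transitivity (\int[lebesgue_measure]_a ((s ^- n)%:E * F (s * a)%R))%E.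
  apply: eq_integral => a _ /=; rewrite -IH; last exact: measurable_xsection.
  congr (lebesgue_rV R n _); apply/seteqP.
  have E (v : 'rV[R]_n) : s *: rV_cons (a, v) = rV_cons (s * a, s *: v) :> 'rV[R]_n.+1.
    apply/rowP => i; rewrite !mxE /=.
    by case: unliftP => [j _|_] //; rewrite mxE.
  by split => v /=; rewrite /xsection /= !in_setE /= E.
rewrite ge0_integralZl//; last 2 first.
- by apply: (measurableT_comp mF); exact: mulrl_measurable.
- by rewrite lee_fin invr_ge0 exprn_ge0// ltW.
rewrite ge0_integral_dilation//.
by rewrite muleA -EFinM -invfM -exprSr.
Qed.

Lemma enorm_ge0 (R : realType) n (x : 'rV[R]_n) : 0 <= enorm x.
Proof. exact: sqrtr_ge0. Qed.

Lemma enorm_sqr (R : realType) n (x : 'rV[R]_n) :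
  enorm x ^+ 2 = \sum_(i < n) x ord0 i ^+ 2.
Proof. by rewrite sqr_sqrtr// sumr_ge0// => i _; exact: sqr_ge0. Qed.

Lemma enormZ (R : realType) n (s : R) (x : 'rV[R]_n) :
  enorm (s *: x) = `|s| * enorm x.
Proof.
rewrite /enorm -sqrtr_sqr -sqrtrM ?sqr_ge0//; congr Num.sqrt.
by rewrite mulr_sumr; apply: eq_bigr => i _; rewrite mxE exprMn.
Qed.

Lemma normr_coord_le_enorm (R : realType) n (x : 'rV[R]_n) i :
  `|x ord0 i| <= enorm x.
Proof.
rewrite -sqrtr_sqr ler_wsqrtr// (bigD1 i)//= lerDl sumr_ge0// => j _.
exact: sqr_ge0.
Qed.

Lemma enorm_eq0 (R : realType) n (x : 'rV[R]_n) : (enorm x == 0) = (x == 0).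
Proof.
apply/eqP/eqP => [x0|->].
  apply/rowP => i; rewrite mxE; apply/eqP; rewrite -normr_le0 -x0.
  exact: normr_coord_le_enorm.
by rewrite /enorm big1 ?sqrtr0// => i _; rewrite mxE expr0n.
Qed.

Lemma measurable_enorm (R : realType) n :
  measurable_fun setT (@enorm R n : _ -> measurableTypeR R).
Proof.
have ms : measurable_fun setT (fun x : 'rV[R]_n => \sum_(i < n) x ord0 i ^+ 2).
  apply: measurable_sum => i; apply: (measurable_funX 2).
  exact: measurable_coord.
apply: (measurableT_comp (f := @Num.sqrt R)) ms.
exact: (continuous_measurable_fun (@sqrt_continuous R)).
Qed.

(** Volume of the closed unit ball. *)
Definition ball_volume (R : realType) n : R := fine (lebesgue_rV R n (cball n 1)).

Lemma measurable_cball (R : realType) n (r : R) : measurable (@cball R n r).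
Proof.
rewrite /cball -[X in measurable X]setTI.
exact: (measurable_enorm measurableT (measurable_itv `]-oo, r]%R)).
Qed.

Lemma measurable_box (R : realType) n (a b : 'rV[R]_n) :
  measurable [set x : 'rV[R]_n | forall i, x ord0 i \in `[a ord0 i, b ord0 i]%R].
Proof.
rewrite (_ : [set x | _] = \bigcap_(i in [set: 'I_n])
    ((fun x : 'rV[R]_n => x ord0 i) @^-1` `[a ord0 i, b ord0 i]%classic)).
  apply: fin_bigcap_measurable => // i _.
  by rewrite -[X in measurable X]setTI; apply: measurable_coord.
by apply/seteqP; split => x /= H; [move=> i _; exact: H|move=> i; exact: (H i)].
Qed.

Lemma lebesgue_cball1_fin (R : realType) n :
  lebesgue_rV R n (@cball R n 1) = (ball_volume R n)%:E.
Proof.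
rewrite fineK// ge0_fin_numE//.
have := @lebesgue_rV_box R n (const_mx (-1)) (const_mx 1).
set B := [set x | _] => h.
have sub : @cball R n 1 `<=` B.
  move=> x /= x1 i; rewrite in_itv/= !mxE -ler_norml.
  exact: le_trans (normr_coord_le_enorm _ _) x1.
have mB : measurable B by exact: measurable_box.
apply: (@le_lt_trans _ _ (lebesgue_rV R n B)).
  by apply: le_measure => //; rewrite inE//; exact: measurable_cball.
by rewrite h ?ltry// => i; rewrite !mxE; lra.
Qed.

Lemma ball_volume_gt0 (R : realType) n : 0 < ball_volume R n.
Proof.
rewrite -lte_fin -lebesgue_cball1_fin.
pose e : R := (n.+1%:R)^-1.
have e0 : 0 < e by rewrite invr_gt0 ltr0n.
have := @lebesgue_rV_box R n (const_mx (-e)) (const_mx e).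
set B := [set x | _] => h.
have sub : B `<=` @cball R n 1.
  move=> x /= Bx; rewrite /cball /enorm /= -[leRHS]sqrtr1 ler_wsqrtr//.
  apply: (@le_trans _ _ (\sum_(i < n) e)).
    apply: ler_sum => i _; have := Bx i; rewrite in_itv/= !mxE -ler_norml => Hi.
    rewrite -real_normK ?num_real//; apply: (@le_trans _ _ (e ^+ 2)).
      by rewrite ler_pXn2r// ?nnegrE// ltW.
    rewrite expr2 ler_piMr ?(ltW e0)// invf_le1 ?ltr0n//.
    by rewrite ler1n.
  rewrite sumr_const card_ord -mulr_natl ler_pdivrMr ?ltr0n// mul1r ler_nat.
  exact: leqnSn.
have mB : measurable B by exact: measurable_box.
apply: (@lt_le_trans _ _ (lebesgue_rV R n B)); last first.
  by apply: le_measure => //; rewrite inE//; exact: measurable_cball.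
rewrite h; last by move=> i; rewrite !mxE; lra.
by rewrite lte_fin prodr_gt0// => i _; rewrite !mxE; lra.
Qed.

Lemma lebesgue_cball (R : realType) n (r : R) : 0 < r ->
  lebesgue_rV R n (@cball R n r) = (ball_volume R n * r ^+ n)%:E.
Proof.
move=> r0.
have <- : (fun x : 'rV[R]_n => r^-1 *: x) @^-1` cball n 1 = cball n r.
  apply/seteqP; split => x /=;
  by rewrite /cball /= enormZ gtr0_norm ?invr_gt0// mulrC ler_pdivrMr// mul1r.
rewrite lebesgue_rV_dilation ?invr_gt0//; last exact: measurable_cball.
by rewrite lebesgue_cball1_fin -EFinM exprVn invrK mulrC.
Qed.

Lemma lebesgue_rV_set0 (R : realType) n : (0 < n)%N ->
  lebesgue_rV R n [set 0] = 0%E.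
Proof.
case: n => // n _.
have := @lebesgue_rV_box R n.+1 0 0 (fun i => lexx _).
rewrite big_ord_recl !mxE subrr mul0r.
rewrite (_ : [set x | _] = [set 0])//.
apply/seteqP; split => x /=; last first.
  by move=> -> i; rewrite in_itv/= lexx.
move=> h; apply/rowP => i; have := h i; rewrite in_itv/= !mxE => /andP[? ?].
by apply/eqP; rewrite eq_le; apply/andP.
Qed.

(** * Polar coordinates *)

Lemma lebesgue_rV_setD (R : realType) n (A B : set 'rV[R]_n) :
  measurable A -> measurable B -> B `<=` A -> (lebesgue_rV R n A < +oo)%E ->
  lebesgue_rV R n (A `\` B) = (lebesgue_rV R n A - lebesgue_rV R n B)%E.
Proof.
move=> mA mB BA Aoo; rewrite -[in RHS](setIidr BA).
exact: (measureD (mu := lebesgue_rV R n)).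
Qed.

Lemma measurable_enorm_pow (R : realType) n k :
  measurable_fun setT ((fun x : 'rV[R]_n => enorm x ^+ k) : _ -> measurableTypeR R).
Proof. by apply: (measurable_funX k); exact: measurable_enorm. Qed.

Lemma lebesgue_enorm_pow_le (R : realType) n (b : R) :
  lebesgue_rV R n.+1 [set x | enorm x ^+ n.+1 <= b] =
  (ball_volume R n.+1 * Num.max b 0)%:E.
Proof.
have [b0|b0] := leP b 0.
  rewrite mulr0; apply/eqP; rewrite -measure_le0.
  rewrite -(@lebesgue_rV_set0 R n.+1)//; apply: le_measure.
  - rewrite inE -[X in measurable X]setTI.
    exact: (measurable_enorm_pow _ measurableT (measurable_itv `]-oo, b]%R)).
  - rewrite inE -[X in measurable X]setTI.
    rewrite (_ : [set 0] = (@enorm R n.+1) @^-1` `]-oo, 0]%classic); last first.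
      apply/seteqP; split => x /=; rewrite in_itv/=.
        by move=> ->; rewrite le_eqVlt enorm_eq0 eqxx.
      by rewrite le_eqVlt ltNge enorm_ge0 orbF enorm_eq0 => /eqP.
    exact: (measurable_enorm measurableT (measurable_itv `]-oo, 0]%R)).
  move=> x /= xb; apply/eqP; rewrite -enorm_eq0 -[_ == 0](expf_eq0 _ n.+1).
  by rewrite eq_le (le_trans xb b0) exprn_ge0// enorm_ge0.
pose r := b `^ (n.+1%:R^-1).
have r0 : 0 < r by exact: powR_gt0.
have rb : r ^+ n.+1 = b.
  by rewrite -powR_mulrn ?ltW// -powRrM mulVf ?powRr1 ?(ltW b0)// pnatr_eq0.
rewrite -[in RHS]rb -(lebesgue_cball _ r0).
rewrite (_ : [set x | _] = cball n.+1 r)//.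
rewrite -[in LHS]rb; apply/seteqP; split => x /=;
  by rewrite /cball /= ler_pXn2r// ?nnegrE ?enorm_ge0 ?ltW.
Qed.

(** The image of Lebesgue measure of R^N under x |-> |x|^N is a multiple of the
    one-dimensional Lebesgue measure of the half-line. *)
Lemma lebesgue_enorm_pow (R : realType) n (A : set (measurableTypeR R)) :
  measurable A -> A `<=` `[0, +oo[%classic ->
  lebesgue_rV R n.+1 ((fun x => enorm x ^+ n.+1) @^-1` A) =
  ((ball_volume R n.+1)%:E * (@lebesgue_measure R) A)%E.
Proof.
move=> mA A0.
pose T := (fun x : 'rV[R]_n.+1 => enorm x ^+ n.+1) : _ -> measurableTypeR R.
have mT : measurable_fun setT T by exact: measurable_enorm_pow.
pose m1 : {measure set measurableTypeR R -> \bar R} :=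
  measure_function_pushforward__canonical__measure_function_Measure
    (lebesgue_rV R n.+1) mT.
have c0 := ball_volume_gt0 R n.+1.
have mD : measurable (`[0, +oo[%classic : set (measurableTypeR R)).
  exact: measurable_itv.
pose m2 : {measure set measurableTypeR R -> \bar R} :=
  mscale (NngNum (ltW c0)) (mrestr (@lebesgue_measure R) mD).
have H (a b : R) : m1 `]a, b]%classic =
    (ball_volume R n.+1 * (Num.max b (Num.max a 0) - Num.max a 0))%:E.
  have [ab|ba] := leP a b; last first.
    rewrite set_itv_ge ?bnd_simp -?leNgt ?ltW// measure0.
    have -> : Num.max b (Num.max a 0) = Num.max a 0.
      by apply/max_idPr; rewrite le_max (ltW ba).
    by rewrite subrr mulr0.
  have mS c : measurable [set x : 'rV[R]_n.+1 | enorm x ^+ n.+1 <= c].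
    rewrite -[X in measurable X]setTI.
    exact: (mT measurableT _ (measurable_itv `]-oo, c]%R)).
  transitivity (lebesgue_rV R n.+1
    ([set x | enorm x ^+ n.+1 <= b] `\` [set x | enorm x ^+ n.+1 <= a])).
    rewrite -[LHS]/(lebesgue_rV R n.+1 (T @^-1` `]a, b]%classic)).
    rewrite (_ : T @^-1` _ = [set x | enorm x ^+ n.+1 <= b] `\`
      [set x | enorm x ^+ n.+1 <= a])//.
    apply/seteqP; split => x /=; rewrite in_itv/=.
      by move=> /andP[ax xb]; split => //; apply/negP; rewrite -ltNge.
    by move=> [xb /negP]; rewrite -ltNge => ->.
  rewrite lebesgue_rV_setD ?lebesgue_enorm_pow_le//.
  - by rewrite -EFinB -mulrBr maxA (max_idPl ab).
  - by move=> x /= /le_trans; apply.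
  - exact: ltry.
have -> : ((ball_volume R n.+1)%:E * (@lebesgue_measure R) A)%E = m2 A.
  by rewrite /m2 /= /mscale /= /mrestr (setIidl A0).
rewrite -[LHS]/(m1 A).
apply: (@measure_unique _ R (measurableTypeR R) (@ocitv R)
  (fun k => `](- k%:R), k%:R]%classic) _ _ _ _ m1 m2) => //.
- exact: ocitvI.
- by move=> k; exact: is_ocitv.
- by rewrite bigcup_itvT.
- move=> _ [[a b] _ <-]; rewrite H.
  rewrite /m2 /= /mscale /= /mrestr EFinM; congr (_ * _)%E.
  have [a0|a0] := leP 0 a.
    rewrite setIidl; last first.
      by move=> x /=; rewrite !in_itv/= andbT => /andP[/ltW/(le_trans a0)].
    rewrite lebesgue_measure_itv/= lte_fin; case: ltP => // ab.
    by rewrite subrr.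
  rewrite subr0; have [b0|b0] := leP 0 b.
    rewrite (_ : _ `&` _ = `[0, b]%classic); last first.
      apply/seteqP; split => x /=; rewrite !in_itv/= ?andbT.
        by move=> [/andP[_ ->] ->].
      by move=> /andP[x0 ->]; rewrite (lt_le_trans a0).
    rewrite lebesgue_measure_itv/= lte_fin sube0; case: ltP => // b0'.
    by congr EFin; apply: le_anti; rewrite b0 b0'.
  rewrite (_ : _ `&` _ = set0) ?measure0//.
  apply/seteqP; split => x //=; rewrite !in_itv/= andbT => -[/andP[_ xb] x0].
  by have := le_lt_trans (le_trans x0 xb) b0; rewrite ltxx.
- by move=> k; rewrite H ltry.
Qed.

Lemma integral_mscale d (T : measurableType d) (R : realType)
    (m : {measure set T -> \bar R}) (k : {nonneg R}) (D : set T) (f : T -> \bar R) :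
  measurable D -> m.-integrable D f ->
  (\int[mscale k m]_(x in D) f x = k%:num%:E * \int[m]_(x in D) f x)%E.
Proof.
move=> mD fi; have mf := measurable_int _ fi.
have mp := measurable_funepos mf; have mn := measurable_funeneg mf.
have nfin := integrable_neg_fin_num mD fi.
rewrite [LHS]integralE !ge0_integral_mscale// [in RHS](integralE m D f).
rewrite [RHS]muleBr//.
by apply: fin_num_adde_defl; rewrite fin_numN.
Qed.

(** Integration in polar coordinates, for radial functions. *)
Lemma polar_integral (R : realType) n (a b : R) (g : R -> R) :
  0 < a <= b -> cont_on a b g ->
  (lebesgue_rV R n.+1).-integrable [set x | a <= enorm x <= b]
    (fun x => (g (enorm x))%:E) /\
  (\int[lebesgue_rV R n.+1]_(x in [set x | (a <= enorm x <= b)%R]) (g (enorm x))%:E)%E =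
   (n.+1%:R * ball_volume R n.+1 * seg_int a b (fun r => g r * r ^+ n))%:E.
Proof.
move=> /andP[a0 ab] cg.
have b0 := lt_le_trans a0 ab.
have c0 := ball_volume_gt0 R n.+1.
(* The integral is transported to the variable t = |x|^N, where the image
   measure is a multiple of Lebesgue measure, and then back to r = t^(1/N). *)
pose F r : R := r ^+ n.+1.
pose h t : R := g (t `^ (n.+1%:R^-1)).
have hF r : 0 <= r -> h (F r) = g r.
  move=> r0; rewrite /h /F -powR_mulrn// -powRrM mulfV ?pnatr_eq0//.
  by rewrite powRr1.
have incF : {in `[a, b] &, {homo F : x y / x < y}}.
  move=> x y; rewrite !in_itv/= => /andP[ax _] /andP[ay _] xy.
  by rewrite /F ltr_pXn2r// nnegrE ltW// ?(lt_le_trans a0).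
have Fab : F a <= F b by rewrite /F ler_pXn2r// nnegrE ltW.
have Fa0 : 0 < F a by rewrite exprn_gt0.
have dF (r : R) : is_derive r 1 F (n.+1%:R * r ^+ n).
  by have := derX n.+1 (der_id r); rewrite /= mulr1.
have F'E : derive1 F = (fun r : R => n.+1%:R * r ^+ n).
  by apply/funext => r; rewrite derive1E; exact: derive_val.
have cFr (r : R) : {for r, continuous (fun r : R => n.+1%:R * r ^+ n)}.
  by apply: contM; [exact: cont_cst|exact: cont_exprn].
have cF' : continuous (derive1 F : R -> R) by rewrite F'E; exact: cFr.
have ch : cont_on (F a) (F b) h.
  move=> t /andP[at_ tb].
  have t0 : 0 < t by exact: lt_le_trans at_.
  apply: continuous_comp; first exact: cont_powR.
  apply: cg.
  have tE : (t `^ (n.+1%:R^-1)) ^+ n.+1 = t.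
    by rewrite -powR_mulrn ?powR_ge0// -powRrM mulVf ?powRr1 ?(ltW t0)// pnatr_eq0.
  have : F a <= (t `^ (n.+1%:R^-1)) ^+ n.+1 <= F b by rewrite tE at_ tb.
  by rewrite /F !ler_pXn2r// ?nnegrE ?powR_ge0 ?ltW.
pose hh := (EFin \o h) \_ `[F a, F b]%classic : measurableTypeR R -> \bar R.
have ih := seg_integrable ch.
have mhh : measurable_fun setT hh.
  by apply/(measurable_restrictT _ _).1 => //; exact: measurable_int ih.
pose T := (fun x : 'rV[R]_n.+1 => enorm x ^+ n.+1) : _ -> measurableTypeR R.
have mT : measurable_fun setT T by exact: measurable_enorm_pow.
set D := [set x | _].
have DT : D = T @^-1` `[F a, F b]%classic.
  apply/seteqP; split => x; rewrite /D /T /F /= in_itv/=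
    !ler_pXn2r// ?nnegrE ?enorm_ge0 ?ltW//.
have mD : measurable D.
  by rewrite DT -[X in measurable X]setTI; exact: (mT measurableT _ (measurable_itv _)).
have gE x : D x -> hh (T x) = (g (enorm x))%:E.
  rewrite DT => Dx; rewrite /hh patchE mem_set//= /T.
  by rewrite -/(F (enorm x)) hF// enorm_ge0.
pose I := `[F a, F b]%classic : set (measurableTypeR R).
have mI : measurable I by exact: measurable_itv.
have nuE A : measurable A -> A `<=` I -> pushforward (lebesgue_rV R n.+1) T A =
    mscale (NngNum (ltW c0)) (@lebesgue_measure R) A.
  move=> mA AI; rewrite /pushforward lebesgue_enorm_pow//.
  move=> x /AI; rewrite /I /= !in_itv/= andbT => /andP[+ _].
  by apply: le_trans; exact: ltW.
have absE : (\int[lebesgue_rV R n.+1]_(x in D) `|(g (enorm x))%:E| < +oo)%E.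
  under eq_integral => x /set_mem Dx do rewrite -gE//.
  rewrite DT -(ge0_integral_pushforward mT (lebesgue_rV R n.+1) mI
    (f := fun y => `|hh y|%E))//; last first.
    by apply: measurable_funTS; exact: measurableT_comp.
  rewrite (eq_measure_integral (mscale (NngNum (ltW c0)) (@lebesgue_measure R)))//.
  rewrite ge0_integral_mscale//; last first.
    by apply: measurable_funTS; exact: measurableT_comp.
  apply: lte_mul_pinfty; rewrite ?lee_fin ?(ltW c0)//.
  have /integrableP[_] := ih; apply: le_lt_trans.
  rewrite le_eqVlt; apply/orP; left; apply/eqP.
  by apply: eq_integral => x xI; rewrite /hh patchE xI.
have intg : (lebesgue_rV R n.+1).-integrable D (fun x => (g (enorm x))%:E).
  apply/integrableP; split => //.
  apply: (eq_measurable_fun (hh \o T)).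
    by move=> x /set_mem Dx; rewrite /= gE.
  by apply: measurable_funTS; exact: measurableT_comp.
split => //.
transitivity (\int[pushforward (lebesgue_rV R n.+1) T]_(y in I) hh y)%E.
  rewrite (integral_pushforward mT)//.
    by rewrite DT; apply: eq_integral => x; rewrite -DT => /set_mem Dx; rewrite /= gE.
  rewrite -DT; apply: eq_integrable intg => // x /set_mem Dx.
  by rewrite /= gE.
rewrite (eq_measure_integral (mscale (NngNum (ltW c0)) (@lebesgue_measure R)))//.
rewrite integral_mscale//; last first.
  by apply: eq_integrable ih => // x xI; rewrite /hh patchE xI.
rewrite [X in (_ * X)%E](_ : _ = \int[lebesgue_measure]_(x in I) (h x)%:E)%E; last first.
  by apply: eq_integral => x xI; rewrite /hh patchE xI.
rewrite (@integration_by_substitution_increasing R F h a b)//; first last.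
- exact: cont_on_within.
- split => [x _||].
  + by have [] := dF x.
  + by apply: cvg_at_right_filter; exact: der_continuous (dF a).
  + by apply: cvg_at_left_filter; exact: der_continuous (dF b).
- by apply: cvgP; apply: cvg_at_left_filter; exact: cF'.
- by apply: cvgP; apply: cvg_at_right_filter; exact: cF'.
pose k r : R := n.+1%:R * (g r * r ^+ n).
have ck : cont_on a b (fun r => g r * r ^+ n).
  by move=> x xab; apply: contM; [exact: cg|exact: cont_exprn].
have ck' : cont_on a b k.
  by move=> x xab; apply: contM; [exact: cont_cst|exact: ck].
rewrite [X in (_ * X)%E](_ : _ = (seg_int a b k)%:E).
  by rewrite -EFinM /k seg_intZ// mulrA (mulrC n.+1%:R).
rewrite /seg_int /Rintegral fineK; last first.
  exact: integrable_fin_num (seg_integrable ck').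
apply: eq_integral => x /set_mem; rewrite /= in_itv/= => /andP[ax _].
have x0 : 0 <= x by rewrite (le_trans _ ax)// ltW.
transitivity (h (F x) * derive1 F x)%:E; first by [].
rewrite F'E (hF x x0) /k.
by congr EFin; ring.
Qed.

(** * A C^1 cutoff *)

Section smoothstep.
Variable R : realType.
Implicit Types t x : R.

(** The square of the positive part. *)
Definition sqr_pos t : R := Num.max t 0 ^+ 2.

Lemma cont_max0 t : {for t, continuous (fun x : R => Num.max x 0)}.
Proof. by apply: continuous_max; [exact: cvg_id|exact: cvg_cst]. Qed.

Lemma der_sqr_pos t : is_derive t 1 sqr_pos (2 * Num.max t 0).
Proof.
have [t0|t0|->] := ltgtP t 0.
- apply: (@der_near _ (fun=> 0)).
    near=> x; rewrite /sqr_pos (max_idPr _) ?expr0n//.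
    by apply/ltW; near: x; exact: lt_nbhsl.
  by rewrite mulr0; exact: der_cst.
- apply: (@der_near _ (fun x => x ^+ 2)).
    near=> x; rewrite /sqr_pos (max_idPl _)//.
    by apply/ltW; near: x; exact: lt_nbhsr.
  by have := derX 2 (der_id t); rewrite /= mulr1 expr1.
- rewrite mulr0; apply/is_derive1_caratheodory.
  exists (fun x => Num.max x 0); split.
  + move=> z; rewrite /sqr_pos maxxx expr0n/= !subr0 expr2.
    by case: leP => //; rewrite ?mulr0 ?mul0r.
  + exact: cont_max0.
  + by rewrite maxxx.
Unshelve. all: by end_near. Qed.

(** A C^1 function equal to 0 on ]-oo, 0] and to 1 on [1, +oo[. *)
Definition smoothstep t : R := 1 - sqr_pos (1 - sqr_pos t).
(** The derivative of [smoothstep]. *)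
Definition smoothstep' t : R :=
  2 * Num.max (1 - sqr_pos t) 0 * (2 * Num.max t 0).

Lemma der_smoothstep t : is_derive t 1 smoothstep (smoothstep' t).
Proof.
have h : is_derive t 1 (fun x : R => 1 - sqr_pos x) (0 - 2 * Num.max t 0).
  by apply: derB (der_cst _ _) (der_sqr_pos t).
have := derB (der_cst t 1) 
  (der_comp (f := sqr_pos) (g := fun x => 1 - sqr_pos x)
    (der_sqr_pos (1 - sqr_pos t)) h).
by rewrite !sub0r mulrN opprK.
Qed.

Lemma cont_smoothstep' t : {for t, continuous smoothstep'}.
Proof.
have c2 : {for t, continuous (fun x : R => 1 - sqr_pos x)}.
  by apply: contB; [exact: cont_cst|exact: der_continuous (der_sqr_pos t)].
apply: contM; apply: contM; try exact: cont_cst.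
  by apply: continuous_max => //; exact: cvg_cst.
exact: cont_max0.
Qed.

Lemma smoothstep_le0 t : t <= 0 -> smoothstep t = 0.
Proof.
move=> t0; rewrite /smoothstep /sqr_pos (max_idPr t0) expr0n/= subr0.
by rewrite (max_idPl ler01) expr1n subrr.
Qed.

Lemma smoothstep_ge1 t : 1 <= t -> smoothstep t = 1 /\ smoothstep' t = 0.
Proof.
move=> t1; have t0 : 0 <= t by exact: le_trans ler01 t1.
have h : 1 - sqr_pos t <= 0.
  by rewrite /sqr_pos (max_idPl t0) subr_le0 exprn_ege1.
rewrite /smoothstep /smoothstep' (max_idPr h) mulr0 mul0r; split => //.
by rewrite /sqr_pos (max_idPr h) expr0n/= subr0.
Qed.

Lemma smoothstep_bounds t :
  [/\ 0 <= smoothstep t, smoothstep t <= 1, 0 <= smoothstep' t & smoothstep' t <= 4].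
Proof.
have [t0|t0] := leP t 0.
  rewrite smoothstep_le0// /smoothstep' (max_idPr t0) !mulr0.
  by split=> //; rewrite ?ler01 ?ler0n.
have [t1|t1] := leP 1 t.
  by have [-> ->] := smoothstep_ge1 t1; split=> //; rewrite ?ler01 ?ler0n.
have pE : sqr_pos t = t ^+ 2 by rewrite /sqr_pos (max_idPl (ltW t0)).
have s1 : t ^+ 2 <= 1 by rewrite exprn_ile1 ?ltW.
have s0 : 0 <= t ^+ 2 by exact: sqr_ge0.
have h : 0 <= 1 - t ^+ 2 by rewrite subr_ge0.
rewrite /smoothstep /smoothstep' pE [sqr_pos (1 - _)]/sqr_pos (max_idPl h).
rewrite (max_idPl (ltW t0)).
have h2 : 0 <= (1 - t ^+ 2) * t by rewrite mulr_ge0// ltW.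
have h3 : (1 - t ^+ 2) * t <= 1 by apply: mulr_ile1 => //; lra.
split.
- by rewrite subr_ge0 exprn_ile1//; lra.
- by rewrite lerBlDr lerDl sqr_ge0.
- by rewrite mulrACA mulr_ge0//; lra.
- by rewrite mulrACA; lra.
Qed.

End smoothstep.

Lemma near_cont (R : realType) (f g : R -> R) (x : R) :
  (\near x, f x = g x) -> {for x, continuous f} -> {for x, continuous g}.
Proof.
move=> fg cf; have fgx : f x = g x := nbhs_singleton fg.
suff : g y @[y --> x] --> f x by rewrite fgx.
apply: cvg_trans cf; apply: near_eq_cvg.
by near=> y; near: y; exact: fg.
Unshelve. all: by end_near. Qed.

Section products_with_compact_support.
Variable R : realType.
Implicit Types (q z : R -> R).

(** If z vanishes outside ]a, b[ and q is differentiable on ]0, 1[, which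
    contains [a, b], then q * z is differentiable on the whole line. *)
Lemma der_supported q q' z z' (a b x : R) : 0 < a -> b < 1 ->
  (forall x : R, 0 < x < 1 -> is_derive x 1 q (q' x)) ->
  (forall x : R, is_derive x 1 z (z' x)) ->
  (forall x : R, ~~ (a < x < b) -> z x = 0) ->
  is_derive x 1 (fun t => q t * z t) (q' x * z x + q x * z' x).
Proof.
move=> a0 b1 dq dz z0.
have [xab|xab] := boolP (a <= x <= b).
  apply: derM; apply: dq.
  by move: xab => /andP[ax xb]; rewrite (lt_le_trans a0)//= (le_lt_trans xb).
have zx : \near x, z x = 0.
  move: xab; rewrite negb_and -!ltNge => /orP[xa|bx].
    near=> y; apply: z0; rewrite negb_and -!leNgt; apply/orP; left.
    by apply/ltW; near: y; exact: lt_nbhsl.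
  near=> y; apply: z0; rewrite negb_and -!leNgt; apply/orP; right.
  by apply/ltW; near: y; exact: lt_nbhsr.
have z'x : z' x = 0.
  have [_ <-] := dz x.
  have [_] : is_derive x 1 z 0.
    by apply: (@der_near _ (fun=> 0)) (der_cst _ _); near=> w; rewrite (near zx w).
  by [].
rewrite z'x (nbhs_singleton zx) !mulr0 addr0.
apply: (@der_near _ (fun=> 0)) (der_cst _ _).
by near=> y; rewrite (near zx y)// mulr0.
Unshelve. all: by end_near. Qed.

(** Continuity of the derivative given by [der_supported]. *)
Lemma cont_der_supported q q' z z' (a b x : R) : 0 < a -> b < 1 ->
  (forall x : R, 0 < x < 1 -> is_derive x 1 q (q' x)) ->
  (forall x : R, 0 < x < 1 -> {for x, continuous q'}) ->
  (forall x : R, is_derive x 1 z (z' x)) ->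
  (forall x : R, {for x, continuous z'}) ->
  (forall x : R, ~~ (a < x < b) -> z x = 0) ->
  {for x, continuous (fun t => q' t * z t + q t * z' t)}.
Proof.
move=> a0 b1 dq cq dz cz z0.
have [xab|xab] := boolP (a <= x <= b).
  have x01 : 0 < x < 1.
    by move: xab => /andP[ax xb]; rewrite (lt_le_trans a0)//= (le_lt_trans xb).
  apply: contD; apply: contM => //.
  - exact: cq.
  - exact: der_continuous (dz x).
  - exact: der_continuous (dq _ x01).
(* near a point outside [a, b], both z and its derivative vanish *)
have zx : \near x, z x = 0 /\ z' x = 0.
  have H : \near x, \near x, z x = 0.
    move: xab; rewrite negb_and -!ltNge => /orP[xa|bx].
      near=> y; have ya : y < a by near: y; exact: lt_nbhsl.
      near=> w; apply: z0; rewrite negb_and -!leNgt; apply/orP; left.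
      by apply/ltW; near: w; exact: lt_nbhsl.
    near=> y; have by_ : b < y by near: y; exact: lt_nbhsr.
    near=> w; apply: z0; rewrite negb_and -!leNgt; apply/orP; right.
    by apply/ltW; near: w; exact: lt_nbhsr.
  near=> y; have Hy : \near y, z y = 0 by near: y.
  split; first exact: nbhs_singleton Hy.
  have [_ <-] := dz y.
  have [_] : is_derive y 1 z 0.
    by apply: (@der_near _ (fun=> 0)) (der_cst _ _); near=> w; rewrite (near Hy w).
  by [].
apply: (@near_cont _ (fun=> 0)); last exact: cont_cst.
near=> y.
have [-> ->] : z y = 0 /\ z' y = 0 by near: y; exact: zx.
by rewrite !mulr0 addr0.
Unshelve. all: by end_near. Qed.

End products_with_compact_support.

(** * The radial stability inequality *)

(** The stability inequality for radial test functions, as an inequality on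
    the half-line; N = n + 1 is the dimension and f1 the derivative of f. *)
Definition radially_stable (R : realType) (n : nat) (al : R) (f1 u : R -> R) :=
  forall (psi psi1 : R -> R) (a b : R), 0 < a -> a <= b -> b < 1 ->
  (forall x : R, is_derive x 1 psi (psi1 x)) ->
  (forall x : R, {for x, continuous psi1}) ->
  (forall x : R, ~~ (a < x < b) -> psi x = 0) ->
  0 <= seg_int a b (fun r => (psi1 r ^+ 2 - r `^ al * f1 (u r) * psi r ^+ 2) * r ^+ n).

(** u solves the radial equation in ]0, 1[, with p = u' and p1 = u''. *)
Definition radial_equation (R : realType) (n : nat) (al : R) (f u p p1 : R -> R) :=
  forall r : R, 0 < r < 1 ->
  [/\ is_derive r 1 u (p r), is_derive r 1 p (p1 r), {for r, continuous p1} &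
      - (p1 r + n%:R * p r / r) = r `^ al * f (u r)].

(** The stability inequality tested with functions r^(-al/2) u' z, where
    p = u'; it is a Hardy-type inequality with weight r^(n - al) u'^2. *)
Definition hardy_stable (R : realType) n (al : R) (p : R -> R) :=
  forall (z z1 : R -> R) (a b : R), 0 < a -> a <= b -> b < 1 ->
  (forall x : R, is_derive x 1 z (z1 x)) ->
  (forall x : R, {for x, continuous z1}) ->
  (forall x : R, ~~ (a < x < b) -> z x = 0) ->
  0 <= seg_int a b (fun r => r ^+ n * r `^ (- al) * p r ^+ 2 *
    (z1 r ^+ 2 - (al / 2 + 1) * (al / 2 + n%:R) * (z r / r) ^+ 2)).

Section hardy.
Variables (R : realType) (n : nat) (al : R) (f f1 u p p1 : R -> R).
Hypothesis df : forall t : R, is_derive t 1 f (f1 t).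
Hypothesis cf1 : forall t : R, {for t, continuous f1}.
Hypothesis eq_u : radial_equation n al f u p p1.
Hypothesis st_u : radially_stable n al f1 u.

Let m (r : R) := r `^ (- (al / 2)).
Let w (r : R) := r ^+ n.
Let A := al / 2 + n%:R.

Lemma der_powR_half (r : R) : 0 < r -> is_derive r 1 m (- (al / 2) * m r / r).
Proof.
move=> r0; have := der_powR (- (al / 2)) r0.
have -> : r `^ (- (al / 2) - 1) = m r / r.
  by rewrite powRB ?(gt_eqF r0) ?implybT// powRr1 ?ltW.
by rewrite mulrA.
Qed.

Lemma der_exprn (r : R) : 0 < r -> is_derive r 1 w (n%:R * w r / r).
Proof.
move=> r0; have := derX n (der_id r); rewrite mulr1.
rewrite (_ : n%:R * r ^+ n.-1 = n%:R * w r / r)// /w.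
case: (n) => [|k]; first by rewrite !mul0r.
by rewrite /= exprSr mulrA mulfK ?gt_eqF.
Qed.

Lemma powR_half_gt0 (r : R) : 0 < r -> 0 < m r. Proof. exact: powR_gt0. Qed.

Lemma powR_half_sqr (r : R) : 0 < r -> r `^ al = (m r ^+ 2)^-1.
Proof.
move=> r0; rewrite /m -powR_mulrn ?powR_ge0// -powRrM -powRN.
by congr (_ `^ _); field.
Qed.

(** Testing the stability inequality with the solution-dependent function
    r^(-al/2) u' z: the potential cancels, since r^(-al/2) u' solves the
    linearized equation up to an explicit multiple of r^(-2). *)
Lemma stability_hardy : hardy_stable n al p.
Proof.
move=> z z1 a b a0 ab b1 dz cz z0.
have in01 r : a <= r <= b -> 0 < r < 1.
  by move=> /andP[ar rb]; rewrite (lt_le_trans a0)//= (le_lt_trans rb).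
pose q r := m r * p r.
pose q1 r := - (al / 2) * m r / r * p r + m r * p1 r.
have dq (r : R) : 0 < r < 1 -> is_derive r 1 q (q1 r).
  move=> r01; have [_ dp _ _] := eq_u r01; apply: derM dp.
  by apply: der_powR_half; case/andP: r01.
have cq (r : R) : 0 < r < 1 -> {for r, continuous q1}.
  move=> r01; have [_ dp cp _] := eq_u r01; have /andP[r0 _] := r01.
  apply: contD; apply: contM => //.
  - apply: contM; first apply: contM; first exact: cont_cst.
      exact: der_continuous (der_powR_half r0).
    by apply: contV; [rewrite gt_eqF|exact: cvg_id].
  - exact: der_continuous dp.
  - exact: der_continuous (der_powR_half r0).
pose ps r := q r * z r.
pose ps1 r := q1 r * z r + q r * z1 r.
have dps (r : R) : is_derive r 1 ps (ps1 r).
  exact: (@der_supported R q q1 z z1 a b r a0 b1 dq dz z0).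
have cps (r : R) : {for r, continuous ps1}.
  exact: (@cont_der_supported R q q1 z z1 a b r a0 b1 dq cq dz cz z0).
have ps0 (r : R) : ~~ (a < r < b) -> ps r = 0 by move=> /z0; rewrite /ps => ->; rewrite mulr0.
have := st_u a0 ab b1 dps cps ps0.
pose K r := r ^+ n * r `^ (- al) * p r ^+ 2 *
    (z1 r ^+ 2 - (al / 2 + 1) * (al / 2 + n%:R) * (z r / r) ^+ 2).
pose L r := (ps1 r ^+ 2 - r `^ al * f1 (u r) * ps r ^+ 2) * r ^+ n.
have cp r : 0 < r < 1 -> {for r, continuous p}.
  by move=> /eq_u[_ dp _ _]; exact: der_continuous dp.
have czr r : {for r, continuous z} by exact: der_continuous (dz r).
have cK : cont_on a b K.
  move=> r /in01 r01; have /andP[r0 _] := r01.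
  apply: contM; first apply: contM; first apply: contM.
  - exact: cont_exprn.
  - exact: cont_powR.
  - by apply: contX; exact: cp.
  - apply: contB; first exact: contX.
    apply: contM; first exact: cont_cst.
    apply: contX; apply: contM => //.
    by apply: contV; [rewrite gt_eqF|exact: cvg_id].
have cL : cont_on a b L.
  move=> r /in01 r01; have /andP[r0 _] := r01.
  apply: contM; last exact: cont_exprn.
  apply: contB.
    by apply: contX; exact: cps.
  apply: contM; last first.
    by apply: contX; exact: der_continuous (dps r).
  apply: contM; first exact: cont_powR.
  apply: continuous_comp; last exact: cf1.
  by have [du _ _ _] := eq_u r01; exact: der_continuous du.
(* By the equation, r^n q' equals G in ]0, 1[; G involves no second derivative
   of u, hence is differentiable. *)
pose G r := - A * (w r * q r / r) - w r / m r * f (u r).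
have GE r : 0 < r < 1 -> w r * q1 r = G r.
  move=> r01; have [_ _ _ E] := eq_u r01; have /andP[r0 _] := r01.
  have m0 := powR_half_gt0 r0.
  rewrite powR_half_sqr// in E.
  have Ep1 : p1 r = - (n%:R * p r / r) - (m r ^+ 2)^-1 * f (u r).
    by rewrite -E; ring.
  have r0' : r != 0 by rewrite gt_eqF.
  have m0' : m r != 0 by rewrite gt_eqF.
  rewrite /G /q1 /q /A Ep1.
  by field; rewrite r0' m0'.
(* The two quadratic forms differ by an exact derivative. *)
have dP (r : R) : a <= r <= b -> is_derive r 1 (fun r => w r * q1 r * q r * z r ^+ 2) (L r - K r).
  move=> /in01 r01; have [du dp _ E] := eq_u r01; have /andP[r0 r1] := r01.
  have m0 := powR_half_gt0 r0.
  have r0' : r != 0 by rewrite gt_eqF.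
  have m0' : m r != 0 by rewrite gt_eqF.
  apply: (@der_near _ (fun r => G r * q r * z r ^+ 2)).
    near=> x; rewrite GE//; apply/andP; split; near: x.
      exact: lt_nbhsr.
    exact: lt_nbhsl.
  have dG : is_derive r 1 G (- A * ((n%:R * w r / r * q r + w r * q1 r) / r
     + w r * q r * (- 1 / r ^+ 2)) -
     ((n%:R * w r / r / m r + w r * (- (- (al / 2) * m r / r) / m r ^+ 2)) * f (u r)
      + w r / m r * (f1 (u r) * p r))).
    apply: derB.
      apply: derZ; apply: derM; last by apply: derV => //; exact: der_id.
      by apply: derM; [exact: der_exprn|exact: dq].
    apply: derM.
    apply: derM; first exact: der_exprn.
    by apply: derV => //; exact: der_powR_half.
  have := derM (derM dG (dq r r01)) (derX 2 (dz r)).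
  rewrite -(GE r r01) /= expr1.
  rewrite [X in is_derive _ _ _ X](_ : _ = L r - K r)//.
  rewrite /L /K /ps1 /ps powR_half_sqr// powRN powR_half_sqr// invrK -/(w r).
  rewrite powR_half_sqr// in E.
  have Ep1 : p1 r = - (n%:R * p r / r) - (m r ^+ 2)^-1 * f (u r).
    by rewrite -E; ring.
  rewrite /q1 /q /A Ep1.
  by field; rewrite r0' m0'.
have : seg_int a b (fun r => L r - K r) = 0.
  rewrite (seg_int_derive ab _ dP).
    by rewrite !z0 ?ltxx ?andbF// expr0n/= !mulr0 subrr.
  by move=> r rab; apply: contB; [exact: cL|exact: cK].
rewrite -/L (_ : seg_int a b L = seg_int a b K + seg_int a b (fun r => L r - K r)).
  by move=> ->; rewrite addr0.
rewrite -seg_intD//.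
  by apply: eq_seg_int => r _; rewrite addrC subrK.
by move=> r rab; apply: contB; [exact: cL|exact: cK].
Unshelve. all: by end_near. Qed.

End hardy.

(** * The family of test functions *)

Lemma ler_sqr_bounds (R : realType) (x y : R) : - y <= x -> x <= y ->
  x ^+ 2 <= y ^+ 2.
Proof.
move=> yx xy; rewrite -real_normK ?num_real// ler_pXn2r// ?nnegrE ?normr_ge0//.
  by rewrite ler_norml yx.
by lra.
Qed.

Section test_functions.
Variables (R : realType) (n : nat) (al : R).
Hypotheses (n1 : (1 <= n)%N) (al2 : -2 < al).

(** Since r^(2 a - 2) = r^al, the weighted density r^(n - al) u'^2 z'^2 is
    comparable to the energy density r^n u'^2 when z = r^a. *)
Definition hardy_a : R := al / 2 + 1.
(** The square root of the constant in the Hardy-type stability inequality. *)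
Definition hardy_b : R := Num.sqrt ((al / 2 + 1) * (al / 2 + n%:R)).
Notation a := hardy_a.
Notation b := hardy_b.
Let s := a + b.

Lemma hardy_a_gt0 : 0 < a. Proof. rewrite /hardy_a. have := al2. lra. Qed.

Lemma hardy_factor_ge : a <= al / 2 + n%:R.
Proof. by rewrite lerD2l ler1n. Qed.

Lemma hardy_b_sqr : b ^+ 2 = (al / 2 + 1) * (al / 2 + n%:R).
Proof.
rewrite sqr_sqrtr// mulr_ge0 ?(ltW hardy_a_gt0)//.
exact: le_trans (ltW hardy_a_gt0) hardy_factor_ge.
Qed.

Lemma hardy_ab : a <= b.
Proof.
rewrite -[leLHS](@ger0_norm _ a) ?(ltW hardy_a_gt0)// -sqrtr_sqr.
by rewrite ler_wsqrtr// expr2 ler_wpM2l ?(ltW hardy_a_gt0) ?hardy_factor_ge.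
Qed.

Lemma hardy_b_gt0 : 0 < b.
Proof. exact: lt_le_trans hardy_a_gt0 hardy_ab. Qed.

Lemma hardy_s_gt0 : 0 < s.
Proof. by rewrite /s addr_gt0 ?hardy_a_gt0 ?hardy_b_gt0. Qed.

Section profile.
Variable D : R.
Hypothesis D0 : 0 < D.

(** Behaves like r^a near 0 and like r^(-b) at infinity, the transition taking
    place around r = D^(1 / (a + b)). *)
Definition profile (r : R) : R := r `^ a / (D + r `^ s).
(** The logarithmic derivative of [profile], multiplied by r. *)
Definition profile_slope (r : R) : R := a - s * (r `^ s / (D + r `^ s)).

Lemma profile_den_gt0 (r : R) : 0 < D + r `^ s.
Proof. by rewrite ltr_wpDr ?powR_ge0. Qed.

Lemma der_profile (r : R) : 0 < r ->
  is_derive r 1 profile (profile r * profile_slope r / r).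
Proof.
move=> r0; have r0' : r != 0 by rewrite gt_eqF.
have den0 := profile_den_gt0 r.
have den0' : D + r `^ s != 0 by rewrite gt_eqF.
have dpw (c : R) : is_derive r 1 (fun t : R => t `^ c) (c * r `^ c / r).
  have := der_powR c r0.
  by rewrite powRB ?r0' ?implybT// powRr1 ?mulrA ?ltW.
have := derM (dpw a) (derV (f := fun t => D + t `^ s) den0' (derD (der_cst r D) (dpw s))).
rewrite [X in is_derive _ _ _ X](_ : _ = profile r * profile_slope r / r)//.
by rewrite /profile /profile_slope; field; rewrite r0' den0'.
Qed.

Lemma profile_slope_bounds (r : R) : - b <= profile_slope r <= b.
Proof.
have den0 := profile_den_gt0 r; have X0 := powR_ge0 r s.
have s0 := ltW hardy_s_gt0; have ab := hardy_ab.
pose t := r `^ s / (D + r `^ s).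
have t0 : 0 <= t by rewrite divr_ge0// ltW.
have t1 : t <= 1 by rewrite ler_pdivrMr// mul1r lerDr ltW.
have u0 := mulr_ge0 s0 t0; have := ler_wpM2l s0 t1.
have sE : s = a + b by [].
by rewrite /profile_slope -/t mulr1 => u1; apply/andP; split; lra.
Qed.

(** The gap b^2 - slope^2 is bounded below in the transition region. *)
Lemma profile_slope_gap (r : R) :
  s ^+ 2 * (r `^ s * D) / (D + r `^ s) ^+ 2 <= b ^+ 2 - profile_slope r ^+ 2.
Proof.
have den0 := profile_den_gt0 r; have X0 := powR_ge0 r s.
have s0 := ltW hardy_s_gt0; have ab := hardy_ab.
have den0' : D + r `^ s != 0 by rewrite gt_eqF.
pose t := r `^ s / (D + r `^ s).
have t0 : 0 <= t by rewrite divr_ge0// ltW.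
have t1 : t <= 1 by rewrite ler_pdivrMr// mul1r lerDr ltW.
have -> : s ^+ 2 * (r `^ s * D) / (D + r `^ s) ^+ 2 = s * t * (s * (1 - t)).
  by rewrite /t; field.
have -> : b ^+ 2 - profile_slope r ^+ 2 = (b - a + s * t) * (s * (1 - t)).
  by rewrite /profile_slope -/t /s; ring.
by rewrite ler_wpM2r ?lerDr ?subr_ge0// mulr_ge0// subr_ge0.
Qed.

Lemma powR_al_a (r : R) : 0 < r -> r `^ (- al) * (r `^ a) ^+ 2 = r ^+ 2.
Proof.
move=> r0.
have -> : (r `^ a) ^+ 2 = r `^ (a * 2) by rewrite powRrM powR_mulrn ?powR_ge0.
rewrite -(powR_mulrn 2) ?ltW// -powRD; last by rewrite (gt_eqF r0) implybT.
by congr (_ `^ _); rewrite /hardy_a; field.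
Qed.

Variable d : R.
Hypotheses (d0 : 0 < d) (d1 : d + d <= 5 / 8).

(** Equal to 1 on [2 d, 5/8] and to 0 outside ]d, 3/4[. *)
Definition cutoff (r : R) : R :=
  smoothstep ((r - d) / d) * smoothstep (8 * (3 / 4 - r)).
(** The derivative of [cutoff]. *)
Definition cutoff' (r : R) : R :=
  smoothstep' ((r - d) / d) / d * smoothstep (8 * (3 / 4 - r)) -
  8 * smoothstep ((r - d) / d) * smoothstep' (8 * (3 / 4 - r)).

Lemma der_cutoff (r : R) : is_derive r 1 cutoff (cutoff' r).
Proof.
have h1 : is_derive r 1 (fun t : R => (t - d) / d) ((1 - 0) * d^-1 + (r - d) * 0).
  exact: derM (derB (der_id r) (der_cst r d)) (der_cst r _).
have h2 : is_derive r 1 (fun t : R => 8 * (3 / 4 - t)) (8 * (0 - 1)).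
  exact: derZ (derB (der_cst r _) (der_id r)).
have k1 := der_comp (f := smoothstep (R := R)) (der_smoothstep _) h1.
have k2 := der_comp (f := smoothstep (R := R)) (der_smoothstep _) h2.
have := derM k1 k2.
rewrite [X in is_derive _ _ _ X](_ : _ = cutoff' r)//.
by rewrite /cutoff'; ring.
Qed.

Lemma cont_cutoff' (r : R) : {for r, continuous cutoff'}.
Proof.
have c1 : {for r, continuous (fun t : R => (t - d) / d)}.
  by apply: contM; [apply: contB; [exact: cvg_id|exact: cont_cst]|exact: cont_cst].
have c2 : {for r, continuous (fun t : R => 8 * (3 / 4 - t))}.
  by apply: contM; [exact: cont_cst|apply: contB; [exact: cont_cst|exact: cvg_id]].
have e1 : {for r, continuous (fun t : R => smoothstep ((t - d) / d))}.
  by apply: continuous_comp; [exact: c1|exact: der_continuous (der_smoothstep _)].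
have e2 : {for r, continuous (fun t : R => smoothstep (8 * (3 / 4 - t)))}.
  by apply: continuous_comp; [exact: c2|exact: der_continuous (der_smoothstep _)].
have f1 : {for r, continuous (fun t : R => smoothstep' ((t - d) / d))}.
  by apply: continuous_comp; [exact: c1|exact: cont_smoothstep'].
have f2 : {for r, continuous (fun t : R => smoothstep' (8 * (3 / 4 - t)))}.
  by apply: continuous_comp; [exact: c2|exact: cont_smoothstep'].
apply: contB; apply: contM => //; apply: contM => //; exact: cont_cst.
Qed.

Lemma cutoff_supp (r : R) : ~~ (d < r < 3 / 4) -> cutoff r = 0.
Proof.
rewrite negb_and -!leNgt /cutoff => /orP[h|h].
  by rewrite smoothstep_le0 ?mul0r// pmulr_lle0 ?invr_gt0//; lra.
by rewrite [X in _ * X]smoothstep_le0 ?mulr0//; lra.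
Qed.

Lemma cutoff_left (r : R) : d <= r <= d + d ->
  [/\ 0 <= cutoff r, cutoff r <= 1, 0 <= r * cutoff' r & r * cutoff' r <= 8].
Proof.
have [d0' d1'] := (d0, d1); move=> /andP[dr rd].
have [e e'] : smoothstep (8 * (3 / 4 - r)) = 1 /\ smoothstep' (8 * (3 / 4 - r)) = 0.
  by apply: smoothstep_ge1; lra.
rewrite /cutoff /cutoff' e e' !mulr1 mulr0 subr0.
have [s0 s1 s2 s3] := smoothstep_bounds ((r - d) / d).
have r0 : 0 <= r by exact: le_trans (ltW d0) dr.
split => //.
  by rewrite mulr_ge0// divr_ge0// ltW.
rewrite mulrCA mulrC (_ : 8 = 2 * 4)//; last by rewrite -natrM.
apply: ler_pM => //; first by rewrite divr_ge0// ltW.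
by rewrite ler_pdivrMr//; lra.
Qed.

Lemma cutoff_middle (r : R) : d + d <= r <= 5 / 8 -> cutoff r = 1 /\ cutoff' r = 0.
Proof.
have [d0' d1'] := (d0, d1); move=> /andP[dr rd]; rewrite /cutoff /cutoff'.
have [-> ->] : smoothstep (8 * (3 / 4 - r)) = 1 /\ smoothstep' (8 * (3 / 4 - r)) = 0.
  by apply: smoothstep_ge1; lra.
have [-> ->] : smoothstep ((r - d) / d) = 1 /\ smoothstep' ((r - d) / d) = 0.
  by apply: smoothstep_ge1; rewrite ler_pdivlMr//; lra.
by rewrite !mul0r !mulr0 subr0 mulr1.
Qed.

Lemma cutoff_right (r : R) : 5 / 8 <= r <= 3 / 4 ->
  [/\ 0 <= cutoff r, cutoff r <= 1 & - 32 <= r * cutoff' r <= 0].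
Proof.
have [d0' d1'] := (d0, d1); move=> /andP[dr rd]; rewrite /cutoff /cutoff'.
have [-> ->] : smoothstep ((r - d) / d) = 1 /\ smoothstep' ((r - d) / d) = 0.
  by apply: smoothstep_ge1; rewrite ler_pdivlMr//; lra.
have [s0 s1 s2 s3] := smoothstep_bounds (8 * (3 / 4 - r)).
rewrite !mul0r !mul1r mulr1 sub0r; split => //.
by apply/andP; split; nra.
Qed.

(** The test function, and its derivative. *)
Definition test_fun (r : R) : R := profile r * cutoff r.
Definition test_fun' (r : R) : R :=
  profile r * profile_slope r / r * cutoff r + profile r * cutoff' r.

(** The quadratic form of the Hardy-type inequality at [test_fun], divided by
    the energy density r^n u'^2. The three lemmas that follow bound it where
    the inner cutoff varies, where the cutoff is 1, and where the outer cutoff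
    varies. *)
Lemma test_fun_form (r : R) : 0 < r ->
  r `^ (- al) * (test_fun' r ^+ 2 -
    (al / 2 + 1) * (al / 2 + n%:R) * (test_fun r / r) ^+ 2) =
  ((profile_slope r * cutoff r + r * cutoff' r) ^+ 2 - b ^+ 2 * cutoff r ^+ 2)
    / (D + r `^ s) ^+ 2.
Proof.
move=> r0; rewrite -hardy_b_sqr.
have r0' : r != 0 by rewrite gt_eqF.
have den0' : D + r `^ s != 0 by rewrite gt_eqF// profile_den_gt0.
have E := powR_al_a r0.
pose k := ((profile_slope r * cutoff r + r * cutoff' r) ^+ 2 - b ^+ 2 * cutoff r ^+ 2)
    / (D + r `^ s) ^+ 2.
transitivity (r `^ (- al) * (r `^ a) ^+ 2 / r ^+ 2 * k).
  rewrite /test_fun' /test_fun /k /profile.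
  by field; rewrite r0' den0'.
by rewrite E mulfV ?mul1r// expf_neq0.
Qed.

Lemma form_left (r : R) : d <= r <= d + d ->
  ((profile_slope r * cutoff r + r * cutoff' r) ^+ 2 - b ^+ 2 * cutoff r ^+ 2)
    / (D + r `^ s) ^+ 2 <= (b + 8) ^+ 2 / D ^+ 2.
Proof.
move=> dr; have [c0 c1 e0 e1] := cutoff_left dr.
have /andP[g0 g1] := profile_slope_bounds r.
have b0 := ltW hardy_b_gt0; have X0 := powR_ge0 r s.
have den0 := profile_den_gt0 r.
have h : (profile_slope r * cutoff r + r * cutoff' r) ^+ 2 <= (b + 8) ^+ 2.
  have k0 : - b <= profile_slope r * cutoff r by nra.
  have k1 : profile_slope r * cutoff r <= b by nra.
  by apply: ler_sqr_bounds; lra.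
apply: (@le_trans _ _ ((b + 8) ^+ 2 / (D + r `^ s) ^+ 2)).
  rewrite ler_wpM2r ?invr_ge0 ?sqr_ge0// lerBlDr (le_trans h)// lerDl.
  by rewrite mulr_ge0 ?sqr_ge0.
rewrite ler_wpM2l ?sqr_ge0// lef_pV2 ?posrE ?exprn_gt0//.
by rewrite ler_pXn2r// ?nnegrE ?lerDl// ltW.
Qed.

Lemma form_middle (r : R) : d + d <= r <= 5 / 8 ->
  ((profile_slope r * cutoff r + r * cutoff' r) ^+ 2 - b ^+ 2 * cutoff r ^+ 2)
    / (D + r `^ s) ^+ 2 <= - (s ^+ 2 * (r `^ s * D) / (D + r `^ s) ^+ 4).
Proof.
move=> dr; have [-> ->] := cutoff_middle dr.
have den0 := profile_den_gt0 r.
have den0' : D + r `^ s != 0 by rewrite gt_eqF.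
rewrite mulr1 mulr0 addr0 expr1n mulr1.
have -> : - (s ^+ 2 * (r `^ s * D) / (D + r `^ s) ^+ 4) =
  - (s ^+ 2 * (r `^ s * D) / (D + r `^ s) ^+ 2) / (D + r `^ s) ^+ 2 by field.
rewrite ler_wpM2r ?invr_ge0 ?sqr_ge0//.
by rewrite lerNr opprB; exact: profile_slope_gap.
Qed.

Lemma form_right (r : R) : 5 / 8 <= r <= 3 / 4 ->
  ((profile_slope r * cutoff r + r * cutoff' r) ^+ 2 - b ^+ 2 * cutoff r ^+ 2)
    / (D + r `^ s) ^+ 2 <= (b + 32) ^+ 2 / ((5 / 8) `^ s) ^+ 2.
Proof.
move=> dr; have [c0 c1 /andP[e0 e1]] := cutoff_right dr.
have /andP[g0 g1] := profile_slope_bounds r.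
have b0 := ltW hardy_b_gt0; have X0 := powR_ge0 r s.
have den0 := profile_den_gt0 r.
have h : (profile_slope r * cutoff r + r * cutoff' r) ^+ 2 <= (b + 32) ^+ 2.
  have k0 : - b <= profile_slope r * cutoff r by nra.
  have k1 : profile_slope r * cutoff r <= b by nra.
  by apply: ler_sqr_bounds; lra.
apply: (@le_trans _ _ ((b + 32) ^+ 2 / (D + r `^ s) ^+ 2)).
  rewrite ler_wpM2r ?invr_ge0 ?sqr_ge0// lerBlDr (le_trans h)// lerDl.
  by rewrite mulr_ge0 ?sqr_ge0.
have Y0 : 0 < (5 / 8 : R) `^ s by apply: powR_gt0; lra.
have XY : (5 / 8 : R) `^ s <= r `^ s.
  move/andP: dr => [dr _].
  by apply: ge0_ler_powR => //; rewrite ?nnegrE ?(ltW hardy_s_gt0)//; lra.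
rewrite ler_wpM2l ?sqr_ge0// lef_pV2 ?posrE ?exprn_gt0//.
rewrite ler_pXn2r// ?nnegrE ?(ltW Y0) ?(ltW den0)//.
by rewrite (le_trans XY)// lerDr ltW.
Qed.

End profile.
End test_functions.

(** * Energy decay *)

(** The density r^(N - 1) u'(r)^2 of the Dirichlet energy. *)
Definition energy_density (R : realType) n (p : R -> R) (r : R) : R := r ^+ n * p r ^+ 2.

Lemma cont_energy_density (R : realType) n (p : R -> R) (c d : R) :
  (forall r : R, 0 < r < 1 -> {for r, continuous p}) ->
  0 < c -> d < 1 -> cont_on c d (energy_density n p).
Proof.
move=> cp c0 d1 r /andP[cr rd]; apply: contM; first exact: cont_exprn.
by apply: contX; apply: cp; rewrite (lt_le_trans c0)//= (le_lt_trans rd).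
Qed.

Lemma energy_density_ge0 (R : realType) n (p : R -> R) (r : R) :
  0 <= r -> 0 <= energy_density n p r.
Proof. by move=> r0; rewrite mulr_ge0 ?sqr_ge0 ?exprn_ge0. Qed.

(** The sum a + b of the two exponents of [profile]. *)
Definition hardy_s (R : realType) n (al : R) : R := hardy_a al + hardy_b n al.

(** Constants, depending only on n and al, of the energy estimate: the gain on
    [r, 2 r], and the cost of the outer cutoff. *)
Definition conc_cst (R : realType) n (al : R) : R :=
  hardy_s n al ^+ 2 / (1 + 2 `^ hardy_s n al) ^+ 4.
Definition outer_cst (R : realType) n (al : R) : R :=
  (hardy_b n al + 32) ^+ 2 / ((5 / 8) `^ hardy_s n al) ^+ 2.

Lemma conc_cst_gt0 (R : realType) n (al : R) : (1 <= n)%N -> -2 < al -> 0 < conc_cst n al.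
Proof.
move=> n1 al2; have s0 : 0 < hardy_s n al := hardy_s_gt0 n1 al2.
by rewrite divr_gt0 ?exprn_gt0// ltr_pwDl ?powR_ge0.
Qed.

Lemma outer_cst_ge0 (R : realType) n (al : R) : 0 <= outer_cst n al.
Proof. by rewrite divr_ge0 ?sqr_ge0. Qed.

(** The Hardy-type inequality at [test_fun] with D = r^(a + b): the energy on
    [r, 2 r] is controlled by the energies where the two cutoffs vary. *)
Lemma energy_concentration (R : realType) n (al : R) (p : R -> R) (r d : R) :
  (1 <= n)%N -> -2 < al ->
  (forall r : R, 0 < r < 1 -> {for r, continuous p}) -> hardy_stable n al p ->
  0 < d -> d + d <= r -> r + r <= 5 / 8 ->
  conc_cst n al * seg_int r (r + r) (energy_density n p) <=
  (hardy_b n al + 8) ^+ 2 * seg_int d (d + d) (energy_density n p) +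
  outer_cst n al * (r `^ hardy_s n al) ^+ 2 *
    seg_int (5 / 8) (3 / 4) (energy_density n p).
Proof.
move=> n1 al2 cp hardy d0 dr rr.
set a := hardy_a al; set b := hardy_b n al; set s := hardy_s n al.
set k := energy_density n p.
have r0 : 0 < r by lra.
have d1 : d + d <= 5 / 8 by lra.
pose D := r `^ s.
have D0 : 0 < D by exact: powR_gt0.
have s0 : 0 < s := hardy_s_gt0 n1 al2.
pose h := profile n al D; pose g := profile_slope n al D.
pose h1 x := h x * g x / x.
have dh (x : R) : 0 < x < 1 -> is_derive x 1 h (h1 x).
  by move=> /andP[x0 _]; exact: der_profile.
have cpw (c x : R) : 0 < x < 1 -> {for x, continuous (fun t : R => t `^ c)}.
  by move=> /andP[x0 _]; exact: cont_powR.
have den (x : R) : D + x `^ (a + b) != 0.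
  by rewrite gt_eqF// ltr_wpDr ?powR_ge0.
have cden (x : R) : 0 < x < 1 -> {for x, continuous (fun t => (D + t `^ (a + b))^-1)}.
  move=> x01; apply: contV; first exact: den.
  by apply: contD; [exact: cont_cst|exact: cpw].
have ch1 (x : R) : 0 < x < 1 -> {for x, continuous h1}.
  move=> x01; apply: contM; last first.
    by apply: contV; [case/andP: x01 => x0 _; rewrite gt_eqF|exact: cvg_id].
  apply: contM; first exact: der_continuous (dh x x01).
  apply: contB; first exact: cont_cst.
  apply: contM; first exact: cont_cst.
  by apply: contM; [exact: cpw|exact: cden].
have b1 : (3 / 4 : R) < 1 by lra.
have dz (x : R) : is_derive x 1 (test_fun n al D d) (test_fun' n al D d x).
  exact: (@der_supported R h h1 (cutoff d) (cutoff' d) d (3 / 4) x d0 b1 dh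
    (der_cutoff d) (cutoff_supp d0)).
have cz (x : R) : {for x, continuous (test_fun' n al D d)}.
  exact: (@cont_der_supported R h h1 (cutoff d) (cutoff' d) d (3 / 4) x d0 b1 dh ch1
    (der_cutoff d) (@cont_cutoff' R d) (cutoff_supp d0)).
have z0 (x : R) : ~~ (d < x < 3 / 4) -> test_fun n al D d x = 0.
  by move=> xd; rewrite /test_fun cutoff_supp// mulr0.
(* T is the quadratic form relative to the energy density k, K = k T is the
   integrand; T is estimated on each of the five pieces of [d, 3/4]. *)
pose T x := x `^ (- al) * (test_fun' n al D d x ^+ 2 -
    (al / 2 + 1) * (al / 2 + n%:R) * (test_fun n al D d x / x) ^+ 2).
pose K x := k x * T x.
have K0 : 0 <= seg_int d (3 / 4) K.
  have d34 : d <= 3 / 4 by lra.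
  have := hardy _ _ _ _ d0 d34 b1 dz cz z0.
  rewrite (_ : seg_int _ _ _ = seg_int d (3 / 4) K)//.
  by apply: eq_seg_int => x _; rewrite /K /k /energy_density /T; ring.
have cK : cont_on d (3 / 4) K.
  move=> x xd; apply: contM; first exact: (cont_energy_density cp d0 b1).
  have x01 : 0 < x < 1.
    by move: xd => /andP[x1 x2]; clear -d0 dr rr x1 x2; apply/andP; split; lra.
  apply: contM; first exact: cpw.
  apply: contB; first by apply: contX; exact: cz.
  apply: contM; first exact: cont_cst.
  apply: contX; apply: contM; first exact: der_continuous (dz x).
  by apply: contV; [case/andP: x01 => x0 _; rewrite gt_eqF|exact: cvg_id].
have le_piece (c e C : R) : d <= c -> e <= 3 / 4 ->
    (forall x, c <= x <= e -> T x <= C) -> seg_int c e K <= C * seg_int c e k.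
  move=> dc e34 TC.
  have c0 : 0 < c by exact: lt_le_trans dc.
  have e1 : e < 1 by lra.
  have ck : cont_on c e k by exact: (cont_energy_density cp c0 e1).
  rewrite -seg_intZ//; apply: le_seg_int.
  - exact: cont_onW dc e34 cK.
  - by move=> x xce; apply: contM; [exact: cont_cst|exact: ck].
  - move=> x xce; rewrite /K mulrC ler_wpM2r ?TC//.
    by apply: energy_density_ge0; move: xce => /andP[? _]; lra.
have TE x : 0 < x -> T x = ((profile_slope n al D x * cutoff d x + x * cutoff' d x) ^+ 2
    - b ^+ 2 * cutoff d x ^+ 2) / (D + x `^ (a + b)) ^+ 2.
  by move=> x0; exact: test_fun_form.
have P1 : seg_int d (d + d) K <= (b + 8) ^+ 2 / D ^+ 2 * seg_int d (d + d) k.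
  apply: le_piece => [||x xd] //; first (clear -d0 dr rr; lra).
  by rewrite TE; [exact: form_left|case/andP: xd => + _; clear -d0 dr rr; lra].
have TM x : d + d <= x <= 5 / 8 -> T x <= - (s ^+ 2 * (x `^ s * D) / (D + x `^ s) ^+ 4).
  move=> xd; rewrite TE; last by case/andP: xd => + _; clear -d0 dr rr; lra.
  exact: form_middle.
have TM0 x : d + d <= x <= 5 / 8 -> T x <= 0.
  move=> /TM/le_trans; apply; rewrite oppr_le0 divr_ge0//.
    by rewrite mulr_ge0 ?sqr_ge0// mulr_ge0 ?powR_ge0// ltW.
  by rewrite exprn_ge0// addr_ge0 ?powR_ge0 ?ltW.
have P2 : seg_int (d + d) r K <= 0.
  rewrite -[leRHS](mul0r (seg_int (d + d) r k)); apply: le_piece; [by clear -d0 dr rr; lra|by clear -d0 dr rr; lra|].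
  by move=> x /andP[x1 x2]; apply: TM0; clear -d0 dr rr x1 x2; apply/andP; split; lra.
have P4 : seg_int (r + r) (5 / 8) K <= 0.
  rewrite -[leRHS](mul0r (seg_int (r + r) (5 / 8) k)); apply: le_piece; [by clear -d0 dr rr; lra|by clear -d0 dr rr; lra|].
  by move=> x /andP[x1 x2]; apply: TM0; clear -d0 dr rr x1 x2; apply/andP; split; lra.
have P5 : seg_int (5 / 8) (3 / 4) K <= outer_cst n al * seg_int (5 / 8) (3 / 4) k.
  apply: le_piece => [||x xd] //; first (clear -d0 dr rr; lra).
  by rewrite TE; [exact: form_right|case/andP: xd => + _; clear -d0 dr rr; lra].
have P3 : seg_int r (r + r) K <= - (conc_cst n al / D ^+ 2) * seg_int r (r + r) k.
  apply: le_piece; [by clear -d0 dr rr; lra|by clear -d0 dr rr; lra|] => x /andP[x1 x2].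
  have xd : d + d <= x <= 5 / 8 by clear -d0 dr rr x1 x2; apply/andP; split; lra.
  apply: le_trans (TM x xd) _; rewrite lerN2.
  have XD : D <= x `^ s.
    by apply: ge0_ler_powR => //; rewrite ?nnegrE ?(ltW s0)//; clear -d0 dr rr x1 x2; lra.
  have XL : x `^ s <= 2 `^ s * D.
    rewrite -powRM//; last exact: ltW.
    by apply: ge0_ler_powR => //; rewrite ?nnegrE ?(ltW s0)//; clear -d0 dr rr x1 x2; lra.
  have L0 : 0 < 1 + (2 : R) `^ s by rewrite ltr_pwDl ?powR_ge0.
  have D0' : D != 0 by rewrite gt_eqF.
  have L0' : 1 + (2 : R) `^ s != 0 by rewrite gt_eqF.
  have -> : conc_cst n al / D ^+ 2 = s ^+ 2 * (D * D) / ((1 + 2 `^ s) * D) ^+ 4.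
    by rewrite /conc_cst -/s; field; rewrite L0' D0'.
  apply: ler_pM.
  - by rewrite mulr_ge0 ?sqr_ge0// mulr_ge0 ?ltW.
  - by rewrite invr_ge0 exprn_ge0// mulr_ge0 ?ltW.
  - by rewrite ler_wpM2l ?sqr_ge0// ler_wpM2r ?(ltW D0).
  - have den0 : 0 < D + x `^ s by rewrite ltr_wpDr ?powR_ge0.
    rewrite lef_pV2 ?posrE ?exprn_gt0// ?mulr_gt0//.
    rewrite ler_pXn2r// ?nnegrE ?(ltW den0) ?mulr_ge0 ?(ltW D0) ?(ltW L0)//.
    by rewrite mulrDl mul1r lerD2l.
(* Only the second and fourth pieces, where T <= 0, are discarded. *)
have split1 : seg_int d (3 / 4) K = seg_int d (d + d) K + (seg_int (d + d) r K +
    (seg_int r (r + r) K + (seg_int (r + r) (5 / 8) K + seg_int (5 / 8) (3 / 4) K))).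
  rewrite (@seg_int_split _ (d + d)); first congr (_ + _); last 2 first.
  - by clear -d0 dr rr; apply/andP; split; lra.
  - exact: cK.
  rewrite (@seg_int_split _ r); first congr (_ + _); last 2 first.
  - by clear -d0 dr rr; apply/andP; split; lra.
  - by apply: cont_onW cK => //; clear -d0 dr rr; lra.
  rewrite (@seg_int_split _ (r + r)); first congr (_ + _); last 2 first.
  - by clear -d0 dr rr; apply/andP; split; lra.
  - by apply: cont_onW cK => //; clear -d0 dr rr; lra.
  rewrite (@seg_int_split _ (5 / 8)) //.
  - by clear -d0 dr rr; apply/andP; split; lra.
  - by apply: cont_onW cK => //; clear -d0 dr rr; lra.
have D2 : 0 < D ^+ 2 by rewrite exprn_gt0.
have D0' : D != 0 by rewrite gt_eqF.
have : conc_cst n al / D ^+ 2 * seg_int r (r + r) k <=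
   (b + 8) ^+ 2 / D ^+ 2 * seg_int d (d + d) k + outer_cst n al * seg_int (5 / 8) (3 / 4) k.
  move: K0; rewrite split1; clear -P1 P2 P3 P4 P5; lra.
move/(ler_wpM2r (ltW D2)); rewrite -/D mulrDl.
have E1 (x y : R) : x / D ^+ 2 * y * D ^+ 2 = x * y by field.
by rewrite !E1 => H; apply: (le_trans H); rewrite lerD2l mulrAC.
Qed.

(** * Oscillation and pointwise bounds *)

(** If the integrals of k over segments of ]0, 1[ are bounded, then some dyadic
    interval [d, 2 d] carries an arbitrarily small part: otherwise the
    intervals [r / 2^(i + 1), r / 2^i] would add up to infinity. *)
Lemma seg_int_small_dyadic (R : realType) (k : R -> R) (r M e : R) :
  0 < r < 1 -> 0 < e ->
  (forall c d : R, 0 < c -> d < 1 -> cont_on c d k) ->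
  (forall c d : R, 0 < c -> c <= d -> d < 1 -> seg_int c d k <= M) ->
  exists2 d, 0 < d & d + d <= r /\ seg_int d (d + d) k <= e.
Proof.
move=> /andP[r0 r1] e0 ck kM; apply: contrapT => H.
have big d : 0 < d -> d + d <= r -> e < seg_int d (d + d) k.
  move=> d0 dr; rewrite ltNge; apply/negP => Hd; apply: H.
  by exists d.
have ind (i : nat) : i%:R * e <= seg_int (r / 2 ^+ i) r k.
  elim: i => [|i IH].
    by rewrite expr0 divr1 mul0r /seg_int set_itv1 Rintegral_set1.
  pose d := r / 2 ^+ i.+1.
  have p0 : 0 < (2 : R) ^+ i by rewrite exprn_gt0.
  have d0 : 0 < d by rewrite divr_gt0// exprn_gt0.
  have dd : d + d = r / 2 ^+ i by rewrite /d exprS; field; rewrite gt_eqF.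
  have ddr : d + d <= r by rewrite dd ler_pdivrMr// ler_peMr ?(ltW r0)// exprn_ege1// ler1n.
  rewrite (@seg_int_split _ (d + d)); last 2 first.
  - by apply/andP; split => //; rewrite lerDl ltW.
  - exact: ck.
  rewrite -natr1 mulrDl mul1r addrC lerD//.
    by apply/ltW; exact: big.
  by rewrite dd.
have [i Mi] : exists i : nat, M / e < i%:R.
  by exists (Num.truncn (M / e)).+1; exact: truncnS_gt.
have d0 : 0 < r / 2 ^+ i by rewrite divr_gt0// exprn_gt0.
have dr : r / 2 ^+ i <= r.
  by rewrite ler_pdivrMr ?exprn_gt0// ler_peMr ?(ltW r0)// exprn_ege1// ler1n.
have := le_trans (ind i) (kM _ _ d0 dr r1).
by apply/negP; rewrite -ltNge -ltr_pdivrMr.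
Qed.

(** Letting the inner cutoff tend to the origin in [energy_concentration]. *)
Lemma energy_decay (R : realType) n (al : R) (p : R -> R) (r M : R) :
  (1 <= n)%N -> -2 < al ->
  (forall r : R, 0 < r < 1 -> {for r, continuous p}) -> hardy_stable n al p ->
  (forall c d : R, 0 < c -> c <= d -> d < 1 -> seg_int c d (energy_density n p) <= M) ->
  0 < r -> r + r <= 5 / 8 ->
  conc_cst n al * seg_int r (r + r) (energy_density n p) <=
  outer_cst n al * (r `^ hardy_s n al) ^+ 2 *
    seg_int (5 / 8) (3 / 4) (energy_density n p).
Proof.
move=> n1 al2 cp hs kM r0 rr; apply/ler_addgt0Pl => e e0.
have b8 : 0 < (hardy_b n al + 8) ^+ 2.
  by rewrite exprn_gt0// addr_gt0// hardy_b_gt0.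
have r01 : 0 < r < 1 by apply/andP; split; lra.
have [d d0 [dr dE]] := seg_int_small_dyadic r01 (divr_gt0 e0 b8)
  (fun c d c0 d1 => cont_energy_density (n := n) cp c0 d1) kM.
apply: le_trans (energy_concentration n1 al2 cp hs d0 dr rr) _.
by rewrite lerD2r mulrC -ler_pdivlMr.
Qed.

(** Young's inequality turns an energy bound into an oscillation bound. *)
Lemma oscillation_le (R : realType) (u p : R -> R) (a b x y l E : R) :
  (forall r, a <= r <= b -> is_derive r 1 u (p r)) -> cont_on a b p ->
  0 < l -> seg_int a b (fun r => p r ^+ 2) <= E ->
  a <= x <= b -> a <= y <= b ->
  `|u x - u y| <= 2^-1 * (l * E + (b - a) / l).
Proof.
move=> du cp l0 pE.
wlog xy : x y / x <= y => [H xab yab|].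
  have [xy|/ltW yx] := leP x y; first exact: H.
  by rewrite distrC; exact: H.
move=> /andP[ax xb] /andP[ay yb].
have ab : a <= b by exact: le_trans yb.
have cpp : cont_on a b (fun r => p r ^+ 2).
  by move=> r rab; apply: contX; exact: cp.
pose G r := 2^-1 * (l * p r ^+ 2 + l^-1).
have cG : cont_on a b G.
  move=> r rab; apply: contM; first exact: cont_cst.
  apply: contD; last exact: cont_cst.
  by apply: contM; [exact: cont_cst|exact: cpp].
have G0 r : 0 <= G r.
  by rewrite /G mulr_ge0// addr_ge0 ?invr_ge0 ?(ltW l0)// mulr_ge0 ?sqr_ge0 ?ltW.
have young r : `|p r| <= G r.
  rewrite /G -[in X in _ <= X]real_normK ?num_real//.
  rewrite -subr_ge0 (_ : _ - _ = 2^-1 * l * (`|p r| - l^-1) ^+ 2).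
    by rewrite mulr_ge0 ?sqr_ge0// mulr_ge0// ltW.
  by field; rewrite gt_eqF.
have GE : seg_int a b G <= 2^-1 * (l * E + (b - a) / l).
  rewrite /G seg_intZ; last first.
    move=> r rab; apply: contD; last exact: cont_cst.
    by apply: contM; [exact: cont_cst|exact: cpp].
  rewrite ler_wpM2l// seg_intD; last 2 first.
  - by move=> r rab; apply: contM; [exact: cont_cst|exact: cpp].
  - by move=> r rab; exact: cont_cst.
  rewrite seg_intZ// seg_int_cst// [l^-1 * _]mulrC lerD2r.
  by rewrite ler_wpM2l// ltW.
have Gxy : seg_int x y G <= seg_int a b G.
  rewrite (@seg_int_split _ x a b)//; last by rewrite ax xb.
  rewrite (@seg_int_split _ y x b)//; first last.
  - by apply: cont_onW cG.
  - by rewrite xy yb.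
  by rewrite addrCA lerDl addr_ge0 ?seg_int_ge0.
have sub r : x <= r <= y -> a <= r <= b.
  by move=> /andP[xr ry]; rewrite (le_trans ax xr) (le_trans ry yb).
have cpxy : cont_on x y p by move=> r /sub; exact: cp.
have cGxy : cont_on x y G by move=> r /sub; exact: cG.
have uE : seg_int x y p = u y - u x.
  by apply: seg_int_derive => // r /sub; exact: du.
have H1 : u y - u x <= seg_int x y G.
  rewrite -uE; apply: le_seg_int => // r _.
  by apply: le_trans (young r); exact: ler_norm.
have H2 : u x - u y <= seg_int x y G.
  rewrite -opprB -uE -mulN1r -seg_intZ//; apply: le_seg_int => // r rxy.
    by apply: contM; [exact: cont_cst|exact: cpxy].
  by rewrite mulN1r; apply: le_trans (young r); rewrite -normrN ler_norm.
apply: le_trans GE; apply: le_trans Gxy.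
by rewrite ler_norml lerNl opprB H1 H2.
Qed.

(** Summation over dyadic intervals: G is a function whose dyadic increments
    dominate r^g, and B bounds v on the last dyadic interval. *)
Lemma dyadic_iteration (R : realType) (v G : R -> R) (g A B c : R) :
  0 < c -> 0 <= A -> (forall r, 0 < r -> r <= 5 / 8 -> 0 <= G r) ->
  (forall r, 0 < r -> r + r <= 5 / 8 -> c * r `^ g <= G r - G (r + r)) ->
  (forall r, 0 < r -> r + r <= 5 / 8 -> v r <= v (r + r) + A * r `^ g) ->
  (forall r, 5 / 16 <= r <= 5 / 8 -> v r <= B) ->
  forall r, 0 < r -> r <= 5 / 8 -> v r <= B + A / c * G r.
Proof.
move=> c0 A0 G0 Gc vA vB.
have base r : 5 / 16 <= r <= 5 / 8 -> v r <= B + A / c * G r.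
  move=> rr; apply: le_trans (vB r rr) _; rewrite lerDl mulr_ge0//.
    by rewrite divr_ge0// ltW.
  by move: rr => /andP[? ?]; apply: G0; lra.
have ind (i : nat) : forall r, 0 < r -> r <= 5 / 8 -> 5 / 16 <= r * 2 ^+ i ->
    v r <= B + A / c * G r.
  elim: i => [|i IH] r r0 r58 ri.
    by apply: base; rewrite r58 andbT; move: ri; rewrite expr0 mulr1.
  have [r516|r516] := leP (5 / 16) r; first by apply: base; rewrite r516.
  have rr : r + r <= 5 / 8 by lra.
  apply: le_trans (vA r r0 rr) _.
  have h1 : v (r + r) <= B + A / c * G (r + r).
    apply: IH; [lra|lra|].
    by apply: le_trans ri _; rewrite exprS; lra.
  have h2 : A * r `^ g <= A / c * (G r - G (r + r)).
    by rewrite -mulrA ler_wpM2l// mulrC ler_pdivlMr// mulrC Gc.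
  by rewrite mulrBr in h2; lra.
move=> r r0 r58; pose i := (Num.truncn (r^-1)).+1.
apply: (ind i) => //.
have h : r^-1 < i%:R by exact: truncnS_gt.
have h2 : i%:R <= (2 : R) ^+ i by rewrite -natrX ler_nat; apply/ltnW/ltn_expl.
have : 1 <= r * 2 ^+ i.
  by rewrite -ler_pdivrMl// mulr1; apply: le_trans (ltW h) h2.
lra.
Qed.

(** The exponent gamma in dimension n + 1; see [gamma_exponentE]. *)
Definition decay_exponent (R : realType) n (al : R) : R :=
  (al + 3 - n%:R) / 2 + hardy_b n al.

Lemma sgr_decay_exponent (R : realType) n (al : R) : (1 <= n)%N -> -2 < al ->
  [/\ n%:R < 9 + 4 * al -> 0 < decay_exponent n al,
      n%:R = 9 + 4 * al -> decay_exponent n al = 0 &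
      9 + 4 * al < n%:R -> decay_exponent n al < 0].
Proof.
move=> n1 al2; have b0 := hardy_b_gt0 n1 al2; have b2 := hardy_b_sqr n1 al2.
rewrite /decay_exponent; set b := hardy_b n al in b0 b2 *.
have n1' : 1 <= n%:R :> R by rewrite ler1n.
have E : b ^+ 2 - ((n%:R - 3 - al) / 2) ^+ 2 = (n%:R - 1) * (9 + 4 * al - n%:R) / 4.
  by rewrite b2; field.
split => h.
- have [h3|h3] := leP (n%:R - 3 - al) 0; first lra.
  suff : (n%:R - 3 - al) / 2 < b by lra.
  have h4 : 1 < n%:R :> R by lra.
  have h5 : 0 <= (n%:R - 3 - al) / 2 by lra.
  rewrite -(@ltr_pXn2r _ 2)// ?nnegrE ?(ltW b0)// -subr_gt0 E.
  by rewrite divr_gt0// mulr_gt0//; lra.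
- have h5 : 0 <= (n%:R - 3 - al) / 2 by lra.
  suff : b = (n%:R - 3 - al) / 2 by lra.
  apply/eqP; rewrite -(@eqrXn2 _ 2)// ?(ltW b0)// -subr_eq0 E h subrr mulr0 mul0r.
  by [].
- suff : b < (n%:R - 3 - al) / 2 by lra.
  have h5 : 0 <= (n%:R - 3 - al) / 2 by lra.
  rewrite -(@ltr_pXn2r _ 2)// ?nnegrE ?(ltW b0)// -subr_lt0 E.
  have k1 : 0 < n%:R - 1 :> R by lra.
  have k2 : 0 < n%:R - (9 + 4 * al) by lra.
  by have := mulr_gt0 k1 k2; lra.
Qed.

(** Oscillation of u on a dyadic interval. *)
Lemma dyadic_oscillation (R : realType) n (al : R) (u p : R -> R) (r M H x y : R) :
  (1 <= n)%N -> -2 < al ->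
  (forall r : R, 0 < r < 1 -> is_derive r 1 u (p r)) ->
  (forall r : R, 0 < r < 1 -> {for r, continuous p}) -> hardy_stable n al p ->
  (forall c d : R, 0 < c -> c <= d -> d < 1 -> seg_int c d (energy_density n p) <= M) ->
  0 < H -> seg_int (5 / 8) (3 / 4) (energy_density n p) <= H ^+ 2 ->
  0 < r -> r + r <= 5 / 8 -> r <= x <= r + r -> r <= y <= r + r ->
  `|u x - u y| <= 2^-1 * (outer_cst n al / conc_cst n al + 1) * H * r `^ decay_exponent n al.
Proof.
move=> n1 al2 du cp hs kM H0 EH r0 rr rx ry.
have c0 := conc_cst_gt0 n1 al2; have o0 := outer_cst_ge0 n al.
have in01 t : r <= t <= r + r -> 0 < t < 1.
  by move=> /andP[t1 t2]; apply/andP; split; lra.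
have ck := cont_energy_density (n := n) cp.
have decay := energy_decay n1 al2 cp hs kM r0 rr.
pose g := decay_exponent n al; pose Q := outer_cst n al / conc_cst n al.
have rn0 : 0 < r ^+ n by rewrite exprn_gt0.
have cpp : cont_on r (r + r) (fun t => p t ^+ 2).
  by move=> t /in01 t01; apply: contX; exact: cp.
have p2 : seg_int r (r + r) (fun t => p t ^+ 2) <= Q * (r `^ (2 * g - 1)) * H ^+ 2.
  have h1 : r ^+ n * seg_int r (r + r) (fun t => p t ^+ 2) <=
      seg_int r (r + r) (energy_density n p).
    rewrite -seg_intZ//; apply: le_seg_int.
    - by move=> t rt; apply: contM; [exact: cont_cst|exact: cpp].
    - by apply: ck; lra.
    - move=> t /andP[rt _]; rewrite /energy_density ler_wpM2r ?sqr_ge0//.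
      by rewrite ler_pXn2r// ?nnegrE ?ltW// (lt_le_trans r0).
  have h2 : seg_int r (r + r) (energy_density n p) <= Q * (r `^ hardy_s n al) ^+ 2 * H ^+ 2.
    rewrite /Q -(ler_pM2l c0); apply: le_trans decay _.
    rewrite (_ : conc_cst n al * _ = outer_cst n al * (r `^ hardy_s n al) ^+ 2 * H ^+ 2).
      by rewrite ler_wpM2l// mulr_ge0 ?sqr_ge0.
    by field; rewrite gt_eqF.
  rewrite -(ler_pM2l rn0); apply: le_trans h1 _; apply: le_trans h2 _.
  rewrite le_eqVlt; apply/orP; left; apply/eqP.
  rewrite (_ : (r `^ hardy_s n al) ^+ 2 = r ^+ n * r `^ (2 * g - 1)); first by ring.
  rewrite -!powR_mulrn ?powR_ge0 ?(ltW r0)// -powRrM -powRD; last first.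
    by rewrite (gt_eqF r0) implybT.
  by congr (_ `^ _); rewrite /g /decay_exponent /hardy_s /hardy_a; field.
have rg (c : R) : 0 < r `^ c by exact: powR_gt0.
(* this choice makes both terms of Young's inequality of order r^g H *)
pose l := r `^ (1 - g) / H.
have l0 : 0 < l by rewrite divr_gt0.
apply: le_trans (oscillation_le _ _ l0 p2 rx ry) _.
- by move=> t /in01; exact: du.
- by move=> t /in01; exact: cp.
have e1 : r `^ (1 - g) * r `^ (2 * g - 1) = r `^ g.
  rewrite -powRD; last by rewrite (gt_eqF r0) implybT.
  by congr (_ `^ _); ring.
have e2 : r = r `^ g * r `^ (1 - g).
  rewrite -powRD; last by rewrite (gt_eqF r0) implybT.
  by rewrite (_ : g + (1 - g) = 1) ?powRr1 ?ltW//; ring.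
rewrite -/Q -/g /l.
have -> : r + r - r = r by ring.
rewrite {3}e2 -e1.
rewrite le_eqVlt; apply/orP; left; apply/eqP.
have rg1 : r `^ (1 - g) != 0 by rewrite gt_eqF.
have H0' : H != 0 by rewrite gt_eqF.
by field; rewrite rg1 H0'.
Qed.

(** One-dimensional Sobolev inequality near the boundary. *)
Lemma outer_bound (R : realType) n (u p : R -> R) (H x : R) :
  (forall r : R, 0 < r < 1 -> is_derive r 1 u (p r)) ->
  (forall r : R, 0 < r < 1 -> {for r, continuous p}) ->
  0 < H ->
  (forall d : R, 5 / 8 <= d -> d < 1 ->
    seg_int (5 / 8) d (fun r => (u r ^+ 2 + p r ^+ 2) * r ^+ n) <= H ^+ 2) ->
  5 / 8 <= x < 1 -> `|u x| <= 10 * (8 / 5) ^+ n * H.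
Proof.
move=> du cp H0 EH /andP[x0 x1].
pose d := Num.max x (3 / 4).
have xd : x <= d by rewrite le_max lexx.
have d34 : 3 / 4 <= d by rewrite le_max lexx orbT.
have d1 : d < 1 by rewrite gt_max x1/=; lra.
have d58 : 5 / 8 <= d by lra.
have in01 (t : R) : 5 / 8 <= t <= d -> 0 < t < 1.
  by move=> /andP[? ?]; apply/andP; split; lra.
have cu (t : R) : 0 < t < 1 -> {for t, continuous u}.
  by move=> t01; exact: der_continuous (du t t01).
have cu2 : cont_on (5 / 8) d (fun t => u t ^+ 2).
  by move=> t /in01 t01; apply: contX; exact: cu.
have cp2 : cont_on (5 / 8) d (fun t => p t ^+ 2).
  by move=> t /in01 t01; apply: contX; exact: cp.
have cw : cont_on (5 / 8) d (fun r => (u r ^+ 2 + p r ^+ 2) * r ^+ n).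
  move=> t td; apply: contM; last exact: cont_exprn.
  by apply: contD; [exact: cu2|exact: cp2].
pose q : R := (5 / 8) ^+ n.
have q0 : 0 < q by rewrite exprn_gt0//; lra.
have qV : (8 / 5) ^+ n = q^-1 :> R by rewrite /q -exprVn invf_div.
have q1 : 1 <= q^-1 by rewrite -qV exprn_ege1//; lra.
have tq (t : R) : 5 / 8 <= t -> q <= t ^+ n.
  by move=> t58; apply: lerXn2r; rewrite ?nnegrE//; lra.
have p2 : seg_int (5 / 8) d (fun t => p t ^+ 2) <= q^-1 * H ^+ 2.
  rewrite -(ler_pM2l q0) mulrA mulfV ?gt_eqF// mul1r.
  apply: le_trans (EH d d58 d1); rewrite -seg_intZ//; apply: le_seg_int => //.
    by move=> t td; apply: contM; [exact: cont_cst|exact: cp2].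
  move=> t /andP[td _]; rewrite mulrC; apply: ler_pM; rewrite ?sqr_ge0 ?(ltW q0) ?tq//.
  by rewrite lerDr sqr_ge0.
(* A point where u is small: if |u| > 8 q^-1 H on all of [5/8, d], whose length
   is at least 1/8, the integral of u^2 r^n would be at least 8 H^2. *)
have [y yd uy] : exists2 y, 5 / 8 <= y <= d & `|u y| <= 8 * q^-1 * H.
  apply: contrapT => N.
  have big (t : R) : 5 / 8 <= t <= d -> 64 * q^-1 * H ^+ 2 <= (u t ^+ 2 + p t ^+ 2) * t ^+ n.
    move=> td; have ut : 8 * q^-1 * H < `|u t|.
      by rewrite ltNge; apply/negP => ?; apply: N; exists t.
    have ut2 : (8 * q^-1 * H) ^+ 2 <= u t ^+ 2.
      rewrite -[leRHS]real_normK ?num_real// ler_pXn2r// ?nnegrE ?(ltW ut)//.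
      by rewrite !mulr_ge0 ?invr_ge0 ?ltW.
    apply: (@le_trans _ _ ((8 * q^-1 * H) ^+ 2 * q)).
      rewrite (_ : _ * q = 64 * q^-1 * H ^+ 2)//.
      by field; rewrite gt_eqF.
    apply: ler_pM; rewrite ?sqr_ge0 ?(ltW q0)//.
      by rewrite (le_trans ut2)// lerDl sqr_ge0.
    by case/andP: td => td _; exact: tq.
  have : seg_int (5 / 8) d (fun=> 64 * q^-1 * H ^+ 2) <= H ^+ 2.
    apply: le_trans (EH d d58 d1); apply: le_seg_int => //.
    by move=> t td; exact: cont_cst.
  rewrite seg_int_cst//; apply/negP; rewrite -ltNge.
  have H2 : 0 < H ^+ 2 by rewrite exprn_gt0.
  have a1 : 64 * H ^+ 2 <= 64 * q^-1 * H ^+ 2.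
    by rewrite ler_wpM2r ?(ltW H2)// ler_peMr.
  have a2 : 64 * H ^+ 2 * 8^-1 <= 64 * q^-1 * H ^+ 2 * (d - 5 / 8).
    apply: ler_pM => //; [by rewrite mulr_ge0// ltW|lra].
  lra.
have l0 : 0 < H^-1 by rewrite invr_gt0.
have osc := @oscillation_le R u p (5 / 8) d x y H^-1 _
   (fun t td => du t (in01 t td)) (fun t td => cp t (in01 t td)) l0 p2 _ yd.
have {}osc : `|u x - u y| <= 2^-1 * (H^-1 * (q^-1 * H ^+ 2) + (d - 5 / 8) / H^-1).
  by apply: osc; rewrite x0.
have e : H^-1 * (q^-1 * H ^+ 2) = q^-1 * H by field; rewrite ?gt_eqF.
rewrite e invrK in osc.
have h1 : (d - 5 / 8) * H <= q^-1 * H by rewrite ler_wpM2r ?ltW//; lra.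
have h2 : `|u x| <= `|u x - u y| + `|u y|.
  by apply: le_trans (ler_normD _ _); rewrite subrK.
have h3 : 0 < q^-1 * H by rewrite mulr_gt0 ?invr_gt0.
by rewrite qV; lra.
Qed.

(** The estimates on the half-line, for a solution with finite energy (bounded by
    some M, on which the constant does not depend) whose Sobolev norm on
    [5/8, 1[ is at most H. *)
Theorem radial_bound (R : realType) n (al : R) : (1 <= n)%N -> -2 < al ->
  exists2 C : R, 0 < C &
  forall (f f1 u p p1 : R -> R) (M H : R),
    (forall t : R, is_derive t 1 f (f1 t)) ->
    (forall t : R, {for t, continuous f1}) ->
    radial_equation n al f u p p1 -> radially_stable n al f1 u ->
    (forall c d : R, 0 < c -> c <= d -> d < 1 ->
       seg_int c d (energy_density n p) <= M) ->
    0 < H ->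
    (forall d : R, 5 / 8 <= d -> d < 1 ->
      seg_int (5 / 8) d (fun r => (u r ^+ 2 + p r ^+ 2) * r ^+ n) <= H ^+ 2) ->
    forall r : R, 0 < r < 1 ->
    [/\ 0 < decay_exponent n al -> `|u r| <= C * H,
        decay_exponent n al = 0 -> `|u r| <= C * H * (`|ln r| + 1),
        decay_exponent n al < 0 -> `|u r| <= C * H * r `^ decay_exponent n al &
        5 / 8 <= r -> `|u r| <= C * H].
Proof.
move=> n1 al2; set g := decay_exponent n al.
pose Q := 2^-1 * (outer_cst n al / conc_cst n al + 1).
have Q0 : 0 <= Q.
  by rewrite mulr_ge0// addr_ge0// divr_ge0 ?outer_cst_ge0 ?ltW ?conc_cst_gt0.
pose B0 : R := 10 * (8 / 5) ^+ n.
have B00 : 0 < B0 by rewrite mulr_gt0// exprn_gt0//; lra.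
pose B := B0 + Q * (5 / 16) `^ g.
have BB : B0 <= B by rewrite lerDl mulr_ge0 ?powR_ge0.
have B0' : 0 < B by exact: lt_le_trans BB.
(* c r^g is at most G(r) - G(2 r) for G(r) = 1 - r^g, - ln r, r^g,
   according to the sign of g *)
pose c : R := if 0 < g then 2 `^ g - 1 else if g == 0 then ln 2 else 1 - 2 `^ g.
have two_gt1 (e : R) : 0 < e -> 1 < (2 : R) `^ e.
  move=> e0; have h : (1 : R) `^ e < 2 `^ e.
    by apply: gt0_ltr_powR => //; rewrite ?nnegrE; lra.
  by rewrite powR1 in h.
have c0 : 0 < c.
  rewrite /c; have [g0|g0|g0] := ltgtP 0 g.
  - by rewrite subr_gt0 two_gt1.
  - rewrite subr_gt0 -[g]opprK powRN invf_lt1 ?powR_gt0//.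
    by rewrite two_gt1// oppr_gt0.
  - by rewrite ln_gt0 // ltr1n.
have Qc : 0 <= Q / c by rewrite divr_ge0// ltW.
exists (B + Q / c); first by rewrite ltr_pwDl.
move=> f f1 u p p1 M H df cf1 eq_u st kM H0 EH.
have du (t : R) : 0 < t < 1 -> is_derive t 1 u (p t) by move=> /eq_u[].
have cp (t : R) : 0 < t < 1 -> {for t, continuous p}.
  by move=> /eq_u[_ dp _ _]; exact: der_continuous dp.
have hs : hardy_stable n al p.
  exact: stability_hardy df cf1 eq_u st.
have cu (t : R) : 0 < t < 1 -> {for t, continuous u}.
  by move=> t01; exact: der_continuous (du t t01).
have EH' : seg_int (5 / 8) (3 / 4) (energy_density n p) <= H ^+ 2.
  apply: le_trans (EH (3 / 4) _ _); [|lra|lra].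
  have in01 (t : R) : 5 / 8 <= t <= 3 / 4 -> 0 < t < 1.
    by move=> /andP[? ?]; apply/andP; split; lra.
  apply: le_seg_int.
  - by apply: (cont_energy_density cp); lra.
  - move=> t /in01 t01; apply: contM; last exact: cont_exprn.
    by apply: contD; apply: contX; [exact: cu|exact: cp].
  - move=> t /in01/andP[t0 _]; rewrite /energy_density mulrC.
    by rewrite ler_wpM2r ?exprn_ge0 ?(ltW t0)// lerDr sqr_ge0.
have outer (t : R) : 5 / 8 <= t < 1 -> `|u t| <= B0 * H.
  exact: outer_bound du cp H0 EH.
have osc (r x y : R) : 0 < r -> r + r <= 5 / 8 -> r <= x <= r + r -> r <= y <= r + r ->
    `|u x - u y| <= Q * H * r `^ g.
  by move=> *; exact: (dyadic_oscillation n1 al2 du cp hs kM).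
have vA (r : R) : 0 < r -> r + r <= 5 / 8 -> `|u r| <= `|u (r + r)| + Q * H * r `^ g.
  move=> r0 rr; rewrite addrC -lerBlDr; apply: le_trans (lerB_dist _ _) _.
  by apply: osc => //; apply/andP; split; lra.
have vB (r : R) : 5 / 16 <= r <= 5 / 8 -> `|u r| <= B * H.
  move=> /andP[r1 r2].
  have h1 : `|u r - u (5 / 8)| <= Q * H * (5 / 16) `^ g.
    by apply: osc; [lra|lra|apply/andP; split; lra|apply/andP; split; lra].
  have h2 : `|u (5 / 8)| <= B0 * H by apply: outer; apply/andP; split; lra.
  have h3 : `|u r| <= `|u r - u (5 / 8)| + `|u (5 / 8)|.
    by apply: le_trans (ler_normD _ _); rewrite subrK.
  by rewrite /B mulrDl [Q * _ * H]mulrAC; lra.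
have QH : 0 <= Q * H by rewrite mulr_ge0// ltW.
have iter G := @dyadic_iteration R (fun r => `|u r|) G g (Q * H) (B * H) c c0 QH.
have key (G : R -> R) : (forall r, 0 < r -> r < 1 -> 0 <= G r) ->
    (forall r, 0 < r -> r + r <= 5 / 8 -> c * r `^ g <= G r - G (r + r)) ->
    forall r, 0 < r < 1 -> `|u r| <= B * H + Q / c * H * G r.
  move=> G0 Gc r /andP[r0 r1].
  have [r58|r58] := leP r (5 / 8).
    rewrite (_ : Q / c * H = Q * H / c); last by rewrite mulrAC.
    apply: (iter G) => // t t0 t58; apply: G0 => //; lra.
  have := outer r; rewrite r1 (ltW r58) => /(_ erefl) h.
  apply: le_trans h _; apply: (@le_trans _ _ (B * H)).
    by rewrite ler_wpM2r// ltW.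
  by rewrite lerDl mulr_ge0 ?G0// mulr_ge0// ltW.
have twor (r : R) : 0 <= r -> (r + r) `^ g = 2 `^ g * r `^ g.
  by move=> r0; rewrite -powRM//; congr (_ `^ _); ring.
move=> r r01; have /andP[r0 r1] := r01; split => hg.
- have lt1 (t : R) : 0 < t -> t < 1 -> t `^ g <= 1.
    move=> t0 t1; have -> : 1 = (1 : R) `^ g by rewrite powR1.
    by apply: ge0_ler_powR; rewrite ?nnegrE ?(ltW hg) ?(ltW t0) ?(ltW t1).
  apply: le_trans (key (fun t => 1 - t `^ g) _ _ r r01) _.
  + by move=> t t0 t1; rewrite subr_ge0 lt1.
  + by move=> t t0 _; rewrite /c hg /= (twor t (ltW t0)); lra.
  + rewrite [leRHS]mulrDl lerD2l ler_piMr//; first by rewrite mulr_ge0// ltW.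
    by rewrite gerBl powR_ge0.
- have lnr (t : R) : 0 < t -> t < 1 -> 0 <= - ln t.
    by move=> t0 t1; rewrite oppr_ge0 ln_le0// ltW.
  apply: le_trans (key (fun t => - ln t) _ _ r r01) _.
  + exact: lnr.
  + move=> t t0 _; have cE : c = ln 2 by rewrite /c hg ltxx eqxx.
    have -> : t `^ g = 1 by rewrite hg powRr0.
    rewrite cE mulr1.
    rewrite (_ : t + t = 2 * t); last by ring.
    by rewrite lnM ?posrE//; lra.
  + rewrite ler0_norm; last by rewrite -oppr_ge0 lnr.
    have h1 := mulr_ge0 (ltW (mulr_gt0 B0' H0)) (lnr _ r0 r1).
    have h2 : 0 <= Q / c * H by rewrite mulr_ge0// ltW.
    by lra.
- have rg1 : 1 <= r `^ g.
    rewrite -[g]opprK powRN invf_ge1 ?powR_gt0//.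
    have h : r `^ (- g) <= 1 `^ (- g).
      by apply: ge0_ler_powR; rewrite ?nnegrE ?oppr_ge0 ?(ltW hg) ?(ltW r0) ?(ltW r1).
    by rewrite powR1 in h.
  apply: le_trans (key (fun t => t `^ g) _ _ r r01) _.
  + by move=> t _ _; exact: powR_ge0.
  + have cE : c = 1 - 2 `^ g by rewrite /c ltNge (ltW hg) (lt_eqF hg).
    by move=> t t0 _; rewrite cE (twor t (ltW t0)); lra.
  + have h1 : B * H <= B * H * r `^ g by rewrite ler_peMr// mulr_ge0// ltW.
    by clear -h1; lra.
- have h : `|u r| <= B0 * H by apply: outer; rewrite hg.
  apply: le_trans h _; rewrite ler_wpM2r ?(ltW H0)//.
  by apply: le_trans BB _; rewrite lerDl.
Qed.

(** * Radial functions on R^N *)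

Section line_derivatives.
Variables (R : realType) (n : nat).
Implicit Types (F : 'rV[R]_n -> R) (x v : 'rV[R]_n) (d : R).

(** A directional derivative is the derivative at 0 of the restriction to a
    line. *)
Lemma is_derive_line F x v d :
  is_derive x v F d <-> is_derive (0 : R) 1 (fun h : R => F (h *: v + x)) d.
Proof.
have E : (fun h : R => h^-1 *: ((F \o shift x) (h *: v) - F x)) =
    (fun h : R => h^-1 *: (((fun k : R => F (k *: v + x)) \o shift 0) (h *: 1)
      - F (0 *: v + x))).
  by apply/funext => h /=; rewrite addr0 [h *: 1]mulr1 scale0r add0r.
split=> -[]; rewrite /derivable /derive => [cF dF]; apply: DeriveDef;
  rewrite /derivable /derive.
- by move: cF; rewrite E.
- by move: dF; rewrite E.
- by rewrite E.
- by rewrite E.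
Qed.

Lemma cont_coord (i : 'I_n) x : {for x, continuous (fun y : 'rV[R]_n => y ord0 i : R)}.
Proof. exact: coord_continuous. Qed.

Lemma cont_enorm x : {for x, continuous (@enorm R n)}.
Proof.
apply: continuous_comp; last exact: sqrt_continuous.
apply: (@cvg_big _ _ +%R 0 _ _ _ _ _ _ _) => [||i _].
- exact: add_continuous.
- exact: nbhs_filter.
rewrite (_ : (fun y : 'rV[R]_n => y ord0 i ^+ 2) = (fun y : 'rV[R]_n => y ord0 i * y ord0 i)).
  by rewrite expr2; exact: (cvgM (@coord_continuous R 1 n ord0 i x) (@coord_continuous R 1 n ord0 i x)).
by apply/funext => y; rewrite expr2.
Qed.

Lemma enorm_line x (i : 'I_n) (h : R) :
  enorm (h *: delta_mx ord0 i + x) =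
  Num.sqrt (enorm x ^+ 2 + 2 * h * x ord0 i + h ^+ 2).
Proof.
rewrite enorm_sqr /enorm; congr Num.sqrt.
rewrite (bigD1 i)//= [in RHS](bigD1 i)//= !mxE !eqxx/= mulr1.
rewrite (eq_bigr (fun j => x ord0 j ^+ 2)); last first.
  by move=> j ji; rewrite !mxE (negbTE ji) andbF mulr0 add0r.
by ring.
Qed.

Lemma der_enorm x (i : 'I_n) : x != 0 ->
  is_derive (0 : R) 1 (fun h : R => enorm (h *: delta_mx ord0 i + x)) (x ord0 i / enorm x).
Proof.
move=> x0; have e0 : 0 < enorm x by rewrite lt_def enorm_eq0 x0 enorm_ge0.
have e0' : enorm x != 0 by rewrite gt_eqF.
rewrite (funext (enorm_line x i)).
pose q (h : R) := enorm x ^+ 2 + 2 * h * x ord0 i + h ^+ 2.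
have dq : is_derive (0 : R) 1 q (2 * x ord0 i).
  have h1 := derM (derZ 2 (der_id (0 : R))) (der_cst 0 (x ord0 i)).
  have := derD (derD (der_cst (0 : R) (enorm x ^+ 2)) h1) (derX 2 (der_id (0 : R))).
  rewrite [X in is_derive _ _ _ X](_ : _ = 2 * x ord0 i)//.
  by rewrite /=; ring.
have q0 : q 0 = enorm x ^+ 2 by rewrite /q; ring.
have dsq : is_derive (q 0) 1 Num.sqrt (2 * enorm x)^-1.
  have := @is_derive1_sqrt R (q 0); rewrite q0 exprn_gt0// => /(_ erefl).
  by rewrite sqrtr_sqr ger0_norm// ltW.
have := der_comp (f := Num.sqrt) (g := q) dsq dq.
rewrite [X in is_derive _ _ _ X](_ : _ = x ord0 i / enorm x)//.
by field.
Qed.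

(** Partial derivatives of g(|x|) away from the origin. *)
Lemma der_radial (g : R -> R) x (i : 'I_n) d : x != 0 ->
  is_derive (enorm x) 1 g d ->
  is_derive x (delta_mx ord0 i : 'rV[R]_n) (fun y : 'rV[R]_n => g (enorm y))
    (d / enorm x * x ord0 i).
Proof.
move=> x0 dg; apply/is_derive_line.
have E : enorm (0 *: delta_mx ord0 i + x) = enorm x by rewrite scale0r add0r.
rewrite -E in dg.
have := der_comp (f := g) (g := fun h => enorm (h *: delta_mx ord0 i + x))
  dg (der_enorm i x0).
by rewrite [in X in X -> _]mulrA mulrAC.
Qed.

Lemma der_coord x (i j : 'I_n) :
  is_derive x (delta_mx ord0 j : 'rV[R]_n) (fun y : 'rV[R]_n => y ord0 i)
    (i == j)%:R.
Proof.
apply/is_derive_line.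
have := derD (derM (der_id (0 : R)) (der_cst 0 ((i == j)%:R : R))) (der_cst 0 (x ord0 i)).
rewrite mul1r mulr0 !addr0 => h.
rewrite (_ : (fun h => _) = (fun t : R => t * (i == j)%:R + x ord0 i))//.
by apply/funext => t; rewrite !mxE eqxx/= eq_sym.
Qed.

Lemma der_mulF (F G : 'rV[R]_n -> R) x v (a b : R) :
  is_derive x v F a -> is_derive x v G b ->
  is_derive x v (fun y => F y * G y) (a * G x + F x * b).
Proof.
move=> /is_derive_line dF /is_derive_line dG; apply/is_derive_line.
by have := derM dF dG; rewrite scale0r add0r.
Qed.

End line_derivatives.

(** The point at distance |r| from the origin on the first axis. *)
Definition axis (R : realType) n (r : R) : 'rV[R]_n.+1 := r *: delta_mx ord0 ord0.

Lemma axisE (R : realType) n (r : R) (i : 'I_n.+1) :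
  axis n r ord0 i = r * (i == ord0)%:R.
Proof. by rewrite !mxE eqxx. Qed.

Lemma enorm_axis (R : realType) n (r : R) : enorm (axis n r) = `|r|.
Proof.
rewrite enormZ (_ : enorm _ = 1) ?mulr1// /enorm -[RHS]sqrtr1; congr Num.sqrt.
rewrite big_ord_recl mxE !eqxx expr1n big1 ?addr0// => i _.
by rewrite mxE eqxx/= expr0n.
Qed.

Lemma cont_axis (R : realType) n (r : R) : {for r, continuous (@axis R n)}.
Proof. exact: scalel_continuous. Qed.

Lemma axis_punctured_ball (R : realType) n (r : R) :
  0 < r < 1 -> punctured_ball R n.+1 (axis n r).
Proof.
move=> /andP[r0 r1]; split; rewrite /oball /= ?enorm_axis ?gtr0_norm//.
by move=> /eqP; rewrite -enorm_eq0 enorm_axis normr_eq0 gt_eqF.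
Qed.

Lemma punctured_ball_near (R : realType) n (x : 'rV[R]_n) :
  punctured_ball R n x -> \near x, punctured_ball R n x.
Proof.
move=> [x1 /eqP x0].
have xe : 0 < enorm x by rewrite lt_def enorm_eq0 x0 enorm_ge0.
have c := @cont_enorm R n x.
have h1 : \near x, enorm x < 1 by exact: (cvgr_lt (enorm x) c).
have h2 : \near x, 0 < enorm x by exact: (cvgr_gt (enorm x) c).
near=> y; split; first by rewrite /oball /=; near: y; exact: h1.
move=> /eqP; rewrite -enorm_eq0; apply/negP; rewrite gt_eqF//.
by near: y; exact: h2.
Unshelve. all: by end_near. Qed.

Lemma der_shift (R : realType) (r : R) (F : R -> R) (d : R) :
  is_derive (0 : R) 1 (fun h => F (h + r)) d -> is_derive r 1 F d.
Proof.
move=> dF; have e : is_derive r 1 (fun t : R => t - r) 1.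
  by have := derB (der_id r) (der_cst r r); rewrite subr0.
have dF' : is_derive (r - r) 1 (fun h => F (h + r)) d by rewrite subrr.
have := der_comp (f := fun h => F (h + r)) (g := fun t => t - r) dF' e.
rewrite mulr1 (_ : (fun t => _) = F)//.
by apply/funext => t; rewrite subrK.
Qed.

(** The radial form of the equation is read off on the first axis, where the
    second derivative in a transversal direction is u'(r) / r. *)
Lemma radial_equation_of_solution (R : realType) n (al : R) (f u : R -> R) :
  classical_solution al f (punctured_ball R n.+1) (radial n.+1 u) ->
  exists p p1 : R -> R, radial_equation n al f u p p1.
Proof.
set U := radial n.+1 u => -[[C1 C2] eqU].
pose p r := partial ord0 U (axis n r).
pose p1 r := partial ord0 (partial ord0 U) (axis n r).
have line (r h : R) : h *: delta_mx ord0 ord0 + axis n r = axis n (h + r).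
  by rewrite /axis scalerDl.
have du (r : R) : 0 < r < 1 -> is_derive r 1 u (p r).
  move=> r01; have [dU _] := C1 ord0 _ (axis_punctured_ball n r01).
  have D : is_derive (axis n r) (delta_mx ord0 ord0 : 'rV[R]_n.+1) U (p r).
    exact: DeriveDef dU erefl.
  have H := (is_derive_line U (axis n r) (delta_mx ord0 ord0) (p r)).1 D.
  apply: der_shift.
  apply: (@der_near _ _ _ _ _ _ H).
  near=> h; rewrite line /U /radial enorm_axis ger0_norm//.
  rewrite -lerBlDr sub0r ltW//; near: h; apply: lt_nbhsr.
  by rewrite oppr_lt0; case/andP: r01.
have dp (r : R) : 0 < r < 1 -> is_derive r 1 p (p1 r).
  move=> r01; have [dU _] := C2 ord0 ord0 _ (axis_punctured_ball n r01).
  have H : is_derive (0 : R) 1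
      (fun h => partial ord0 U (h *: delta_mx ord0 ord0 + axis n r)) (p1 r).
    have D : is_derive (axis n r) (delta_mx ord0 ord0 : 'rV[R]_n.+1) (partial ord0 U) (p1 r).
      exact: DeriveDef dU erefl.
    exact: (is_derive_line (partial ord0 U) (axis n r) (delta_mx ord0 ord0) (p1 r)).1 D.
  apply: der_shift.
  by apply: (@der_near _ _ _ _ _ _ H); near=> h; rewrite line.
have cp1 (r : R) : 0 < r < 1 -> {for r, continuous p1}.
  move=> r01; have [_ cU] := C2 ord0 ord0 _ (axis_punctured_ball n r01).
  by apply: continuous_comp; [exact: cont_axis|exact: cU].
exists p, p1 => r r01; have /andP[r0 r1] := r01; split; [exact: du|exact: dp|exact: cp1|].
have := eqU _ (axis_punctured_ball n r01).
rewrite enorm_axis gtr0_norm// {2}/U /radial enorm_axis gtr0_norm// => <-.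
congr (- _); rewrite /laplacian big_ord_recl -/(p1 r); congr (_ + _).
rewrite (eq_bigr (fun=> p r / r)); last first.
  move=> i _; pose j := lift ord0 i.
  have jE : (j == ord0) = false by rewrite eq_sym (negbTE (neq_lift _ _)).
  pose P t := p t / t.
  have r0' : r != 0 by rewrite gt_eqF.
  have dP : is_derive (enorm (axis n r)) 1 P (p1 r * r^-1 + p r * (- 1 / r ^+ 2)).
    rewrite enorm_axis gtr0_norm//; apply: derM (dp r r01) _.
    by apply: derV (der_id r).
  have x0 : axis n r != 0 by rewrite -enorm_eq0 enorm_axis normr_eq0.
  have := der_mulF (der_radial j x0 dP) (der_coord (axis n r) j j).
  rewrite (_ : _ + _ = p r / r); last first.
    by rewrite axisE jE !mulr0 add0r eqxx mulr1 /P enorm_axis gtr0_norm.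
  move=> H; rewrite /partial -[RHS](@derive_val _ _ _ _ _ _ _ H).
  (* the first derivative in direction j is P(|y|) y_j for y near the axis point *)
  apply: near_eq_derive; near=> y.
  have yP : punctured_ball R n.+1 y.
    by near: y; apply: punctured_ball_near; exact: axis_punctured_ball.
  have y0 : y != 0 by case: yP => _ /eqP.
  have ey : 0 < enorm y < 1.
    by case: yP => y1 _; rewrite lt_def enorm_eq0 y0 enorm_ge0.
  by have [_ ->] := der_radial j y0 (du _ ey); rewrite /P.
by rewrite sumr_const card_ord mulr_natl mulrnAl.
Unshelve. all: by end_near. Qed.

(** * Test functions built from radial profiles *)

Lemma contF_M (R : realType) n (F G : 'rV[R]_n -> R) x :
  {for x, continuous F} -> {for x, continuous G} ->
  {for x, continuous (fun y => F y * G y)}.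
Proof. by move=> cF cG; apply: cvgM; [exact: nbhs_filter|exact: cF|exact: cG]. Qed.

Lemma contF_D (R : realType) n (F G : 'rV[R]_n -> R) x :
  {for x, continuous F} -> {for x, continuous G} ->
  {for x, continuous (fun y => F y + G y)}.
Proof. by move=> cF cG; apply: cvgD; [exact: nbhs_filter|exact: cF|exact: cG]. Qed.

(** A C^1 function with derivative psi1, vanishing outside ]a, b[. *)
Definition C1_supp (R : realType) (a b : R) (psi psi1 : R -> R) : Prop :=
  [/\ forall x : R, is_derive x 1 psi (psi1 x),
      forall x : R, {for x, continuous psi1} &
      forall x : R, ~~ (a < x < b) -> psi x = 0].

(** The closed annulus a <= |x| <= b. *)
Definition annulus (R : realType) n (a b : R) : set 'rV[R]_n :=
  [set x | a <= enorm x <= b].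
Arguments annulus {R} n a b.

Lemma closed_annulus (R : realType) n (a b : R) : closed (@annulus R n a b).
Proof.
rewrite (_ : annulus n a b = @enorm R n @^-1` `[a, b]%classic).
  by apply: preimage_closed; [move=> x _; exact: cont_enorm|exact: interval_closed].
by apply/seteqP; split => x; rewrite /annulus /= in_itv.
Qed.

Lemma compact_annulus (R : realType) n (a b : R) : compact (@annulus R n a b).
Proof.
apply: bounded_closed_compact; last exact: closed_annulus.
exists b; split; first exact: num_real.
move=> M bM x /andP[_ xb].
have xM : enorm x <= M by exact: le_trans xb (ltW bM).
rewrite /= [leLHS]/Num.norm /= mx_normrE; apply/bigmax_leP; split => /=.
  exact: le_trans (enorm_ge0 x) xM.
move=> [i j] _ /=; rewrite (ord1 i).
exact: le_trans (normr_coord_le_enorm x j) xM.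
Qed.

Lemma supp_annulus (R : realType) n (a b : R) (Omega : set 'rV[R]_n)
    (phi : 'rV[R]_n -> R) :
  (forall x, ~~ (a < enorm x < b) -> phi x = 0) -> annulus n a b `<=` Omega ->
  let supp := closure [set x | phi x != 0] in compact supp /\ supp `<=` Omega.
Proof.
move=> phi0 sub /=.
have sup : closure [set x | phi x != 0] `<=` annulus n a b.
  have e : annulus n a b = closure (annulus n a b) by apply/closure_id; exact: closed_annulus.
  rewrite [X in _ `<=` X]e.
  apply: closure_subset => x /= px; rewrite /annulus /=.
  have : a < enorm x < b by apply: contraNT px => /phi0 ->.
  by move=> /andP[/ltW -> /ltW ->].
split; last by move=> x /sup/sub.
apply: (subclosed_compact _ (@compact_annulus R n a b)) => //.
exact: closed_closure.
Qed.

Section radial_test_functions.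
Variables (R : realType) (n : nat) (a b : R) (psi psi1 : R -> R).
Hypotheses (a0 : 0 < a) (hpsi : C1_supp a b psi psi1).

Lemma C1_supp_cont (x : R) : {for x, continuous psi}.
Proof. by case: hpsi => d _ _; exact: der_continuous (d x). Qed.

Lemma C1_supp_near0 (x : R) : x < a -> \near x, psi x = 0.
Proof.
case: hpsi => _ _ z xa; near=> y; apply: z.
rewrite negb_and -!leNgt; apply/orP; left.
by apply/ltW; near: y; exact: lt_nbhsl.
Unshelve. all: by end_near. Qed.

Lemma C1_supp_der0 (x : R) : ~~ (a <= x <= b) -> psi1 x = 0.
Proof.
case: hpsi => d _ z; rewrite negb_and -!ltNge => xab.
have zx : \near x, psi x = 0.
  move: xab => /orP[xa|bx]; first exact: C1_supp_near0.
  near=> y; apply: z; rewrite negb_and -!leNgt; apply/orP; right.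
  by apply/ltW; near: y; exact: lt_nbhsr.
have [_ <-] := d x.
have [_] : is_derive x 1 psi 0.
  apply: (@der_near _ (fun=> 0)) (der_cst _ _).
  by near=> w; rewrite (near zx w).
by [].
Unshelve. all: by end_near. Qed.

Lemma cont_C1_supp_div (x : R) : {for x, continuous (fun r => psi1 r / r)}.
Proof.
case: hpsi => _ c _.
have [xa|ax] := ltP x a.
  apply: (@near_cont _ (fun=> 0)); last exact: cont_cst.
  near=> y; rewrite C1_supp_der0 ?mul0r// negb_and -!ltNge; apply/orP; left.
  by near: y; exact: lt_nbhsl.
apply: contM => //; apply: contV; last exact: cvg_id.
by rewrite gt_eqF// (lt_le_trans a0).
Unshelve. all: by end_near. Qed.

Lemma der_radial_supp (x : 'rV[R]_n) (i : 'I_n) :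
  is_derive x (delta_mx ord0 i : 'rV[R]_n) (fun y : 'rV[R]_n => psi (enorm y))
    (psi1 (enorm x) / enorm x * x ord0 i).
Proof.
have [x0|x0] := eqVneq x 0; last by apply: der_radial => //; case: hpsi.
have -> : x ord0 i = 0 by rewrite x0 mxE.
have e0 : enorm x = 0 by apply/eqP; rewrite enorm_eq0 x0.
rewrite mulr0.
have near0 : \near x, 0 = psi (enorm x).
  have c := @cont_enorm R n x.
  have h : \near x, enorm x < a by apply: (cvgr_lt (enorm x) c); rewrite e0.
  near=> y; case: hpsi => _ _ ->//.
  rewrite negb_and -!leNgt; apply/orP; left; apply/ltW.
  by near: y; exact: h.
apply: (near_eq_is_derive near0).
Unshelve. all: by end_near. Qed.

Lemma cont_radial_fun (g : R -> R) (x : 'rV[R]_n) :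
  {for enorm x, continuous g} -> {for x, continuous (fun y : 'rV[R]_n => g (enorm y))}.
Proof. by move=> cg; apply: continuous_comp; [exact: cont_enorm|exact: cg]. Qed.

Lemma partial_radial (i : 'I_n) :
  partial i (radial n psi) = (fun x => psi1 (enorm x) / enorm x * x ord0 i).
Proof. by apply/funext => x; have [_] := der_radial_supp x i. Qed.

Lemma radial_test_function (Omega : set 'rV[R]_n) : annulus n a b `<=` Omega ->
  test_function Omega (radial n psi).
Proof.
move=> sub; have [h1 h2] : compact (closure [set x : 'rV[R]_n | radial n psi x != 0]) /\
    closure [set x : 'rV[R]_n | radial n psi x != 0] `<=` Omega.
  by apply: (supp_annulus _ sub) => x; case: hpsi => _ _ z /z.
split => // i x _; split.
  by have [] := der_radial_supp x i.
rewrite partial_radial.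
have k : {for x, continuous (fun y : 'rV[R]_n => psi1 (enorm y) / enorm y)}.
  by apply: (cont_radial_fun (g := fun r => psi1 r / r)); exact: cont_C1_supp_div.
apply: contF_M; [exact: k|exact: cont_coord].
Qed.

(** The components of the radial vector field psi(|x|) x. *)
Definition radial_field (i : 'I_n) (x : 'rV[R]_n) : R := psi (enorm x) * x ord0 i.

Lemma der_radial_field (i j : 'I_n) (x : 'rV[R]_n) :
  is_derive x (delta_mx ord0 j : 'rV[R]_n) (radial_field i)
    (psi1 (enorm x) / enorm x * x ord0 j * x ord0 i + psi (enorm x) * (i == j)%:R).
Proof. exact: der_mulF (der_radial_supp x j) (der_coord x i j). Qed.

Lemma partial_radial_field (i j : 'I_n) :
  partial j (radial_field i) = (fun x =>
    psi1 (enorm x) / enorm x * x ord0 j * x ord0 i + psi (enorm x) * (i == j)%:R).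
Proof. by apply/funext => x; have [_] := der_radial_field i j x. Qed.

Lemma radial_field_test_function (Omega : set 'rV[R]_n) (i : 'I_n) :
  annulus n a b `<=` Omega -> test_function Omega (radial_field i).
Proof.
move=> sub; have [h1 h2] : compact (closure [set x : 'rV[R]_n | radial_field i x != 0]) /\
    closure [set x : 'rV[R]_n | radial_field i x != 0] `<=` Omega.
  apply: (supp_annulus _ sub) => x; case: hpsi => _ _ z /z.
  by rewrite /radial_field => ->; rewrite mul0r.
split => // j x _; split.
  by have [] := der_radial_field i j x.
rewrite partial_radial_field.
have k : {for x, continuous (fun y : 'rV[R]_n => psi1 (enorm y) / enorm y)}.
  by apply: (cont_radial_fun (g := fun r => psi1 r / r)); exact: cont_C1_supp_div.
have k' : {for x, continuous (fun y : 'rV[R]_n => psi (enorm y))}.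
  by apply: cont_radial_fun; exact: C1_supp_cont.
apply: contF_D; apply: contF_M => //; last exact: cst_continuous.
  by apply: contF_M; [exact: k|exact: cont_coord].
exact: cont_coord.
Qed.

End radial_test_functions.

(** * From integrals over R^N to integrals over segments *)

(** The integral of a function vanishing on D outside A. No measurability is
    involved. *)
Lemma integral_supp d (T : measurableType d) (R : realType)
    (m : {measure set T -> \bar R}) (A D : set T) (F : T -> \bar R) :
  A `<=` D -> (forall x, D x -> ~ A x -> F x = 0%E) ->
  (\int[m]_(x in D) F x = \int[m]_(x in A) F x)%E.
Proof.
move=> AD F0; rewrite integral_mkcond [RHS]integral_mkcond.
apply: eq_integral => x _; rewrite !patchE.
have [xA|/negP xA] := boolP (x \in A).
  by rewrite mem_set//; apply: AD; exact: set_mem.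
have [/set_mem xD|//] := boolP (x \in D).
by apply: F0 => // /mem_set.
Qed.

Lemma measurable_annulus (R : realType) n (a b : R) : measurable (@annulus R n a b).
Proof.
rewrite (_ : annulus n a b = @enorm R n @^-1` `[a, b]%classic).
  rewrite -[X in measurable X]setTI.
  exact: (measurable_enorm measurableT (measurable_itv `[a, b]%R)).
by apply/seteqP; split => x; rewrite /annulus /= in_itv.
Qed.

(** The area of the unit sphere. *)
Definition sphere_area (R : realType) n : R := n.+1%:R * ball_volume R n.+1.

Lemma sphere_area_gt0 (R : realType) n : 0 < sphere_area R n.
Proof. by rewrite mulr_gt0 ?ball_volume_gt0// ltr0n. Qed.

Lemma annulus_sub_oball (R : realType) n (a b : R) : b < 1 ->
  annulus n a b `<=` oball n 1.
Proof. by move=> b1 x /andP[_ xb]; rewrite /oball /= (le_lt_trans xb). Qed.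

Lemma annulus_sub_punctured (R : realType) n (a b : R) : 0 < a -> b < 1 ->
  annulus n a b `<=` punctured_ball R n.
Proof.
move=> a0 b1 x xab; split; first exact: annulus_sub_oball b1 x xab.
move=> /eqP; rewrite -enorm_eq0; apply/negP.
by rewrite gt_eqF// (lt_le_trans a0)//; case/andP: xab.
Qed.

Lemma annulusP (R : realType) n (a b : R) (x : 'rV[R]_n) :
  ~ annulus n a b x -> ~~ (a <= enorm x <= b).
Proof. by move=> h; apply/negP. Qed.

Lemma annulusPN (R : realType) n (a b : R) (x : 'rV[R]_n) :
  ~ annulus n a b x -> ~~ (a < enorm x < b).
Proof.
move=> /annulusP; apply: contra => /andP[/ltW -> /ltW ->]; by [].
Qed.

Lemma radially_stable_of_semi_stable (R : realType) n (al : R) (f u p p1 : R -> R) :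
  C1_real f -> radial_equation n al f u p p1 ->
  semi_stable al f (radial n.+1 u) -> radially_stable n al (derive1 f) u.
Proof.
move=> [df cf] eq_u st psi psi1 a b a0 ab b1 dpsi cpsi psi0.
have hpsi : C1_supp a b psi psi1 by [].
have sub := @annulus_sub_punctured R n.+1 a b a0 b1.
have := st _ (radial_test_function a0 hpsi sub).
pose F r := psi1 r ^+ 2 - r `^ al * derive1 f (u r) * psi r ^+ 2.
have FE (x : 'rV[R]_n.+1) : annulus n.+1 a b x ->
    enorm (gradient (radial n.+1 psi) x) ^+ 2 - enorm x `^ al *
      derive1 f (radial n.+1 u x) * radial n.+1 psi x ^+ 2 = F (enorm x).
  move=> /andP[ax _]; have e0 : enorm x != 0 by rewrite gt_eqF// (lt_le_trans a0).
  rewrite /F /radial; congr (_ - _).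
  rewrite enorm_sqr (eq_bigr (fun i => (psi1 (enorm x) / enorm x) ^+ 2 * x ord0 i ^+ 2)).
    by rewrite -mulr_sumr -enorm_sqr -exprMn divfK.
  by move=> i _; rewrite mxE (partial_radial a0 hpsi) exprMn.
rewrite (@integral_supp _ _ _ _ (annulus n.+1 a b)); last 2 first.
- exact: annulus_sub_oball.
- move=> x _ xA; have p0 := psi0 _ (annulusPN xA).
  rewrite /radial p0 expr0n/= mulr0 subr0 enorm_sqr big1// => i _.
  rewrite mxE (partial_radial a0 hpsi) (C1_supp_der0 hpsi) ?(annulusP xA)//.
  by rewrite !mul0r expr0n.
rewrite (eq_integral (fun x => (F (enorm x))%:E)); last first.
  by move=> x /set_mem xA; rewrite FE.
have cF : cont_on a b F.
  move=> r /andP[ar rb].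
  have r0 : 0 < r by exact: lt_le_trans ar.
  have r01 : 0 < r < 1 by rewrite r0 (le_lt_trans rb).
  have [du _ _ _] := eq_u r r01.
  apply: contB; first exact: contX.
  apply: contM; last by apply: contX; exact: der_continuous (dpsi r).
  apply: contM; first exact: cont_powR.
  by apply: continuous_comp; [exact: der_continuous du|exact: cf].
have a0b : 0 < a <= b by rewrite a0 ab.
have [_ ->] := @polar_integral R n a b F a0b cF.
by rewrite lee_fin -/(sphere_area R n) pmulr_rge0 ?sphere_area_gt0.
Qed.

(** The radial part of a weak gradient dominates u'. This is seen by testing
    against the vector field chi(|x|) u'(|x|) x / |x|, whose divergence is
    radial. *)
Lemma weak_gradient_energy (R : realType) n (Omega : set 'rV[R]_n.+1)
    (u p p1 chi chi1 : R -> R) (g : 'rV[R]_n.+1 -> 'rV[R]_n.+1) (a b : R) :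
  measurable Omega -> 0 < a -> a <= b -> b < 1 -> annulus n.+1 a b `<=` Omega ->
  (forall r : R, 0 < r < 1 ->
    [/\ is_derive r 1 u (p r), is_derive r 1 p (p1 r) & {for r, continuous p1}]) ->
  C1_supp a b chi chi1 -> (forall r, 0 <= chi r <= 1) ->
  weak_gradients Omega (radial n.+1 u) g ->
  ((sphere_area R n * seg_int a b (fun r => chi r * p r ^+ 2 * r ^+ n))%:E <=
    \int[lebesgue_rV R n.+1]_(x in Omega) (enorm (g x) ^+ 2)%:E)%E.
Proof.
move=> mO a0 ab b1 sub hu hchi chi01 hg.
have mA : measurable (annulus n.+1 a b) by exact: measurable_annulus.
set A := annulus n.+1 a b in sub mA *.
set mu := lebesgue_rV R n.+1.
have a0b : 0 < a <= b by rewrite a0 ab.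
have in01 r : a <= r <= b -> 0 < r < 1.
  by move=> /andP[ar rb]; rewrite (lt_le_trans a0)//= (le_lt_trans rb).
have [dchi cchi chi0] := hchi.
pose q r := p r * r^-1.
pose q1 r := p1 r * r^-1 + p r * (- 1 / r ^+ 2).
have dq (r : R) : 0 < r < 1 -> is_derive r 1 q (q1 r).
  move=> r01; have [_ dp _] := hu r r01; apply: derM dp _.
  by apply: derV (der_id r); case/andP: r01 => r0 _; rewrite gt_eqF.
have cp (r : R) : 0 < r < 1 -> {for r, continuous p}.
  by move=> /hu[_ dp _]; exact: der_continuous dp.
have cu (r : R) : 0 < r < 1 -> {for r, continuous u}.
  by move=> /hu[du _ _]; exact: der_continuous du.
have cVX (r : R) k : 0 < r -> {for r, continuous (fun t : R => (t ^+ k)^-1)}.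
  by move=> r0; apply: contV; [rewrite expf_neq0// gt_eqF|exact: cont_exprn].
have cV (r : R) : 0 < r -> {for r, continuous (fun t : R => t^-1)}.
  by move=> r0; apply: contV; [rewrite gt_eqF|exact: cvg_id].
have cq1 (r : R) : 0 < r < 1 -> {for r, continuous q1}.
  move=> r01; have /andP[r0 _] := r01; have [_ dp cp1] := hu r r01.
  apply: contD; apply: contM => //; first exact: cV.
    exact: cp.
  by apply: contM; [exact: cont_cst|exact: cVX].
pose Psi r := q r * chi r.
pose Psi1 r := q1 r * chi r + q r * chi1 r.
have hPsi : C1_supp a b Psi Psi1.
  split.
  - by move=> x; exact: (@der_supported R q q1 chi chi1 a b x a0 b1 dq dchi chi0).
  - by move=> x; exact: (@cont_der_supported R q q1 chi chi1 a b x a0 b1 dq cq1 dchi cchi chi0).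
  - by move=> x /chi0; rewrite /Psi => ->; rewrite mulr0.
have [dPsi cPsi1 Psi0] := hPsi.
have cPsi : cont_on a b Psi by move=> r _; exact: der_continuous (dPsi r).
have cu' : cont_on a b u by move=> r /in01; exact: cu.
have cPsid : cont_on a b (fun r => Psi1 r / r).
  by move=> r _; exact: (cont_C1_supp_div a0 hPsi).
(* radial functions are measurable and integrable on the annulus *)
have radI (h : R -> R) : cont_on a b h -> mu.-integrable A (fun x => (h (enorm x))%:E).
  by move=> ch; have [] := @polar_integral R n a b h a0b ch.
have radE (h : R -> R) : cont_on a b h -> (\int[mu]_(x in A) (h (enorm x))%:E =
    (sphere_area R n * seg_int a b (fun r => h r * r ^+ n))%:E)%E.
  by move=> ch; have [_] := @polar_integral R n a b h a0b ch.
have radM (h : R -> R) : cont_on a b h -> measurable_fun A (fun x : 'rV[R]_n.+1 => h (enorm x)).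
  by move=> /radI/measurable_int/measurable_EFinP.
have mcoord (i : 'I_n.+1) : measurable_fun A (fun x : 'rV[R]_n.+1 => x ord0 i).
  by apply: measurable_funTS; exact: measurable_coord.
(* F i is u times the i-th term of the divergence of the field Psi(|x|) x *)
pose F (i : 'I_n.+1) (x : 'rV[R]_n.+1) := u (enorm x) *
  (Psi1 (enorm x) / enorm x * x ord0 i * x ord0 i + Psi (enorm x)).
have mF i : measurable_fun A (F i).
  apply: measurable_funM; first exact: radM.
  apply: measurable_funD; last exact: radM.
  by apply: measurable_funM => //; apply: measurable_funM => //; exact: (radM (fun r => Psi1 r / r)).
pose B r := `|u r| * (`|Psi1 r / r| * r ^+ 2 + `|Psi r|).
have cB : cont_on a b B.
  have cn (h : R -> R) : cont_on a b h -> cont_on a b (fun r => `|h r|).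
    by move=> ch r rab; apply: continuous_comp; [exact: ch|exact: norm_continuous].
  move=> r rab; apply: contM; first exact: (cn u).
  apply: contD; last exact: (cn Psi).
  by apply: contM; [exact: (cn (fun r => Psi1 r / r))|exact: cont_exprn].
have FB i x : A x -> `|F i x| <= B (enorm x).
  move=> _; rewrite /F /B normrM ler_wpM2l//.
  apply: le_trans (ler_normD _ _) _; rewrite lerD2r -mulrA normrM ler_wpM2l//.
  rewrite -expr2 normrX lerXn2r ?nnegrE ?enorm_ge0//.
  exact: normr_coord_le_enorm.
have iF i : mu.-integrable A (fun x => (F i x)%:E).
  apply: (le_integrable mA _ _ (radI B cB)); first exact/measurable_EFinP.
  move=> x Ax /=; rewrite lee_fin (le_trans (FB i x Ax))//.
  exact: ler_norm.
have dF i x : u (enorm x) * partial i (radial_field Psi i) x = F i x.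
  by rewrite (partial_radial_field a0 hPsi) eqxx mulr1.
pose W r := u r * (Psi1 r * r + n.+1%:R * Psi r).
have sumF x : A x -> \sum_i F i x = W (enorm x).
  move=> /andP[ax _]; have e0 : enorm x != 0 by rewrite gt_eqF// (lt_le_trans a0).
  rewrite /F -mulr_sumr big_split/= sumr_const card_ord -mulr_natl /W.
  congr (_ * (_ + _)).
  rewrite (eq_bigr (fun i => Psi1 (enorm x) / enorm x * x ord0 i ^+ 2)).
    by rewrite -mulr_sumr -enorm_sqr expr2 mulrA divfK.
  by move=> i _; rewrite expr2 mulrA.
pose S := seg_int a b (fun r => chi r * p r ^+ 2 * r ^+ n).
have cS : cont_on a b (fun r => chi r * p r ^+ 2 * r ^+ n).
  move=> r /in01 r01; apply: contM; last exact: cont_exprn.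
  by apply: contM; [exact: der_continuous (dchi r)|apply: contX; exact: cp].
have cW : cont_on a b W.
  move=> r rab; apply: contM; first exact: cu'.
  apply: contD; apply: contM; [exact: cPsi1|exact: cvg_id|exact: cont_cst|exact: cPsi].
(* integration by parts on the segment: (u r^(n+1) Psi)' has zero integral *)
have WS : seg_int a b (fun r => W r * r ^+ n) = - S.
  have cWn : cont_on a b (fun r => W r * r ^+ n).
    by move=> r rab; apply: contM; [exact: cW|exact: cont_exprn].
  have dP (r : R) : a <= r <= b -> is_derive r 1 (fun r => u r * (r ^+ n.+1 * Psi r))
      (W r * r ^+ n + chi r * p r ^+ 2 * r ^+ n).
    move=> /in01 r01; have [du _ _] := hu r r01.
    have r0 : r != 0 by case/andP: r01 => r0 _; rewrite gt_eqF.
    have := derM du (derM (derX n.+1 (der_id r)) (dPsi r)).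
    rewrite [X in is_derive _ _ _ X](_ : _ = W r * r ^+ n + chi r * p r ^+ 2 * r ^+ n)//.
    by rewrite /W /Psi /q /= !exprS; field.
  apply/eqP; rewrite -subr_eq0 opprK -seg_intD// (seg_int_derive ab _ dP).
    by rewrite !Psi0 ?ltxx ?andbF// !mulr0 subrr.
  by move=> r rab; apply: contD; [exact: cWn|exact: cS].
have hgi (i : 'I_n.+1) : measurable_fun Omega (fun x => g x ord0 i) /\
    mu.-integrable A (fun x => (g x ord0 i ^+ 2)%:E).
  have [[mg ig] _] := hg i; split => //.
  apply: (@integrableS _ _ _ _ Omega) => //; apply/integrableP; split.
    by apply/measurable_EFinP; exact: measurable_funX.
  rewrite (eq_integral (fun x => (g x ord0 i ^+ 2)%:E))// => x _.
  by rewrite /= ger0_norm ?sqr_ge0.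
pose phi (i : 'I_n.+1) (x : 'rV[R]_n.+1) := radial_field Psi i x.
have mgphi i : measurable_fun A (fun x => g x ord0 i * phi i x).
  apply: measurable_funM; first by apply: measurable_funS (hgi i).1.
  by apply: measurable_funM => //; exact: radM.
pose V r := (Psi r * r) ^+ 2.
have cV' : cont_on a b V.
  by move=> r rab; apply: contX; apply: contM; [exact: cPsi|exact: cvg_id].
have phiV i x : phi i x ^+ 2 <= V (enorm x).
  rewrite /phi /radial_field /V [leLHS]exprMn [leRHS]exprMn ler_wpM2l ?sqr_ge0//.
  rewrite -[x ord0 i ^+ 2]real_normK ?num_real//.
  apply: lerXn2r; rewrite ?nnegrE ?normr_ge0 ?enorm_ge0//.
  exact: normr_coord_le_enorm.
have young (s t : R) : `|s * t| <= 2^-1 * (s ^+ 2 + t ^+ 2).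
  rewrite normrM -[s ^+ 2]real_normK ?num_real// -[t ^+ 2]real_normK ?num_real//.
  rewrite -subr_ge0 (_ : _ - _ = 2^-1 * (`|s| - `|t|) ^+ 2); last by field.
  by rewrite mulr_ge0// sqr_ge0.
have igphi i : mu.-integrable A (fun x => (g x ord0 i * phi i x)%:E).
  have h : mu.-integrable A (fun x => (g x ord0 i ^+ 2)%:E + (V (enorm x))%:E)%E.
    by apply: integrableD => //; [exact: (hgi i).2|exact: radI].
  apply: (le_integrable mA _ _ h); first exact/measurable_EFinP.
  move=> x Ax /=; rewrite lee_fin; apply: le_trans (young _ _) _.
  rewrite [leRHS]ger0_norm; last by rewrite addr_ge0 ?sqr_ge0.
  have := phiV i x; have := sqr_ge0 (g x ord0 i); have := sqr_ge0 (phi i x).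
  lra.
have weak i : (\int[mu]_(x in A) (F i x)%:E = - \int[mu]_(x in A) (g x ord0 i * phi i x)%:E)%E.
  have tf : test_function Omega (radial_field Psi i).
    exact: (radial_field_test_function a0 hPsi i sub).
  have [_] := hg i; move=> /(_ _ tf).
  rewrite (@integral_supp _ _ _ _ A) => [||x _ xA] //; last first.
    rewrite (partial_radial_field a0 hPsi) (C1_supp_der0 hPsi) ?(annulusP xA)//.
    by rewrite (Psi0 _ (annulusPN xA)) !mul0r addr0 mulr0.
  rewrite [X in (- X)%E](@integral_supp _ _ _ _ A) => [||x _ xA] //; last first.
    by rewrite /radial_field (Psi0 _ (annulusPN xA)) mul0r mulr0.
  by under eq_integral do rewrite dF.
pose G := (\int[mu]_(x in A) (enorm (g x) ^+ 2)%:E)%E.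
have iG : mu.-integrable A (fun x => (enorm (g x) ^+ 2)%:E).
  rewrite (_ : (fun x => _) = (fun x => \sum_i (g x ord0 i ^+ 2)%:E)%E); last first.
    by apply/funext => x; rewrite enorm_sqr sumEFin.
  by apply: integrable_sum => // i _; exact: (hgi i).2.
have E1 : (\int[mu]_(x in A) (\sum_i (g x ord0 i * phi i x))%:E =
    (sphere_area R n * S)%:E)%E.
  under eq_integral do rewrite -sumEFin.
  rewrite (integral_sum mA igphi).
  rewrite (eq_bigr (fun i => - \int[mu]_(x in A) (F i x)%:E)%E); last first.
    by move=> i _; rewrite weak oppeK.
  have := radE W cW; rewrite WS mulrN EFinN => WE.
  have : (\sum_i \int[mu]_(x in A) (F i x)%:E = - (sphere_area R n * S)%:E)%E.
    rewrite -WE -(integral_sum mA iF); apply: eq_integral => x /set_mem Ax.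
    by rewrite sumEFin sumF.
  move=> sE; rewrite -[RHS]oppeK -sE fin_num_sumeN// => i _.
  exact: integrable_fin_num (iF i).
have iSum : mu.-integrable A (fun x => (\sum_i (g x ord0 i * phi i x))%:E).
  rewrite (_ : (fun x => _) = (fun x => \sum_i (g x ord0 i * phi i x)%:E)%E); last first.
    by apply/funext => x; rewrite sumEFin.
  by apply: integrable_sum => // i _; exact: igphi.
have E2 : ((sphere_area R n * S)%:E <= \int[mu]_(x in A)
    (2^-1%:E * ((enorm (g x) ^+ 2)%:E + (V (enorm x))%:E)))%E.
  rewrite -E1; apply: le_integral => //.
    by apply: integrableZl => //; apply: integrableD => //; exact: radI.
  move=> x /set_mem Ax; rewrite -EFinD -EFinM lee_fin.
  apply: (@le_trans _ _ (\sum_i 2^-1 * (g x ord0 i ^+ 2 + phi i x ^+ 2))).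
    by apply: ler_sum => i _; apply: le_trans (young _ _); exact: ler_norm.
  rewrite -mulr_sumr ler_wpM2l// big_split/= -enorm_sqr lerD2l.
  rewrite /phi /radial_field /V (eq_bigr (fun i => Psi (enorm x) ^+ 2 * x ord0 i ^+ 2)).
    by rewrite -mulr_sumr -enorm_sqr -exprMn.
  by move=> i _; rewrite -exprMn.
(* since 0 <= chi <= 1, V = chi^2 u'^2 <= chi u'^2; half of S is absorbed *)
have VS : seg_int a b (fun r => V r * r ^+ n) <= S.
  apply: le_seg_int => //.
    by move=> r rab; apply: contM; [exact: cV'|exact: cont_exprn].
  move=> r /in01/andP[r0 _]; rewrite ler_wpM2r ?exprn_ge0 ?(ltW r0)//.
  have -> : V r = chi r * (chi r * p r ^+ 2) by rewrite /V /Psi /q; field; rewrite gt_eqF.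
  have /andP[c0 c1] := chi01 r.
  by rewrite ler_piMl// mulr_ge0 ?sqr_ge0.
have Gfin : (G \is a fin_num)%E by exact: integrable_fin_num iG.
have E3 : ((sphere_area R n * S)%:E <= G)%E.
  move: E2; rewrite integralZl//; last by apply: integrableD => //; exact: radI.
  rewrite integralD//; last exact: radI.
  rewrite radE// -/G -(fineK Gfin) -EFinD -EFinM !lee_fin => E2.
  have := ler_wpM2l (ltW (sphere_area_gt0 R n)) VS.
  by move: E2; lra.
apply: le_trans E3 _.
apply: ge0_subset_integral => //.
- apply/measurable_EFinP; rewrite (_ : (fun x => _) = (fun x => \sum_i (g x ord0 i ^+ 2))).
    by apply: measurable_sum => i; apply: measurable_funX; exact: (hgi i).1.
  by apply/funext => x; rewrite enorm_sqr.
- by move=> x _; rewrite lee_fin sqr_ge0.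
Qed.

(** * Sobolev norms of radial functions *)

(** A C^1 cutoff equal to 1 on [a', b'] and supported in [a, b]. *)
Lemma cutoff_between (R : realType) (a a' b' b : R) : a < a' -> b' < b ->
  exists chi chi1 : R -> R, [/\ C1_supp a b chi chi1,
    forall r, 0 <= chi r <= 1 & forall r, a' <= r <= b' -> chi r = 1].
Proof.
move=> aa bb.
have da : 0 < a' - a by rewrite subr_gt0.
have db : 0 < b - b' by rewrite subr_gt0.
pose A r := (r - a) / (a' - a); pose B r := (b - r) / (b - b').
have dA (r : R) : is_derive r 1 A (a' - a)^-1.
  have := derM (derB (der_id r) (der_cst r a)) (der_cst r (a' - a)^-1).
  by rewrite subr0 mul1r mulr0 addr0.
have dB (r : R) : is_derive r 1 B (- (b - b')^-1).
  have := derM (derB (der_cst r b) (der_id r)) (der_cst r (b - b')^-1).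
  by rewrite sub0r mulN1r mulr0 addr0.
have cA (r : R) : {for r, continuous A} by exact: der_continuous (dA r).
have cB (r : R) : {for r, continuous B} by exact: der_continuous (dB r).
exists (fun r => smoothstep (A r) * smoothstep (B r)).
exists (fun r => smoothstep' (A r) * (a' - a)^-1 * smoothstep (B r) +
  smoothstep (A r) * (smoothstep' (B r) * - (b - b')^-1)).
split; first split.
- move=> r.
  have k1 := der_comp (f := smoothstep (R := R)) (g := A) (der_smoothstep _) (dA r).
  have k2 := der_comp (f := smoothstep (R := R)) (g := B) (der_smoothstep _) (dB r).
  exact: derM k1 k2.
- move=> r.
  have e1 : {for r, continuous (fun t => smoothstep (A t))}.
    by apply: continuous_comp; [exact: cA|exact: der_continuous (der_smoothstep _)].
  have e2 : {for r, continuous (fun t => smoothstep (B t))}.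
    by apply: continuous_comp; [exact: cB|exact: der_continuous (der_smoothstep _)].
  have f1 : {for r, continuous (fun t => smoothstep' (A t))}.
    by apply: continuous_comp; [exact: cA|exact: cont_smoothstep'].
  have f2 : {for r, continuous (fun t => smoothstep' (B t))}.
    by apply: continuous_comp; [exact: cB|exact: cont_smoothstep'].
  by apply: contD; apply: contM => //; apply: contM => //; exact: cont_cst.
- move=> r; rewrite negb_and -!leNgt => /orP[h|h].
    by rewrite smoothstep_le0 ?mul0r// pmulr_lle0 ?invr_gt0// subr_le0.
  by rewrite [X in _ * X]smoothstep_le0 ?mulr0// pmulr_lle0 ?invr_gt0// subr_le0.
- move=> r; have [s0 s1 _ _] := smoothstep_bounds (A r).
  have [t0 t1 _ _] := smoothstep_bounds (B r).
  by rewrite mulr_ge0//= mulr_ile1.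
- move=> r /andP[ar rb].
  have [-> _] : smoothstep (A r) = 1 /\ smoothstep' (A r) = 0.
    by apply: smoothstep_ge1; rewrite ler_pdivlMr// mul1r lerD2r.
  have [-> _] : smoothstep (B r) = 1 /\ smoothstep' (B r) = 0.
    by apply: smoothstep_ge1; rewrite ler_pdivlMr// mul1r lerD2l lerN2.
  by rewrite mulr1.
Qed.

(** The slightly larger annulus [a, b] leaves room for a cutoff. *)
Lemma energy_le_weak_gradient (R : realType) n (Omega : set 'rV[R]_n.+1)
    (u p p1 : R -> R) (g : 'rV[R]_n.+1 -> 'rV[R]_n.+1) (a a' b' b : R) :
  measurable Omega -> 0 < a -> a < a' -> a' <= b' -> b' < b -> b < 1 ->
  annulus n.+1 a b `<=` Omega ->
  (forall r : R, 0 < r < 1 ->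
    [/\ is_derive r 1 u (p r), is_derive r 1 p (p1 r) & {for r, continuous p1}]) ->
  weak_gradients Omega (radial n.+1 u) g ->
  ((sphere_area R n * seg_int a' b' (energy_density n p))%:E <=
    \int[lebesgue_rV R n.+1]_(x in Omega) (enorm (g x) ^+ 2)%:E)%E.
Proof.
move=> mO a0 aa ab bb b1 sub hu hg.
have ab' : a <= b by rewrite (le_trans (ltW aa))// (le_trans ab)// ltW.
have [chi [chi1 [hchi chi01 chiE]]] := cutoff_between aa bb.
apply: le_trans (weak_gradient_energy mO a0 ab' b1 sub hu hchi chi01 hg).
rewrite lee_fin ler_wpM2l ?(ltW (sphere_area_gt0 R n))//.
have in01 r : a <= r <= b -> 0 < r < 1.
  by move=> /andP[ar rb]; rewrite (lt_le_trans a0)//= (le_lt_trans rb).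
pose K r := chi r * p r ^+ 2 * r ^+ n.
have K0 r : a <= r -> 0 <= K r.
  move=> ar; have r0 : 0 <= r by rewrite (le_trans (ltW a0)).
  by rewrite mulr_ge0 ?exprn_ge0// mulr_ge0 ?sqr_ge0//; case/andP: (chi01 r).
have cK : cont_on a b K.
  move=> r /in01 r01; apply: contM; last exact: cont_exprn.
  apply: contM; first by case: hchi => d _ _; exact: der_continuous (d r).
  by apply: contX; have [_ dp _] := hu r r01; exact: der_continuous dp.
rewrite (_ : seg_int a' b' _ = seg_int a' b' K); last first.
  apply: eq_seg_int => r rr; rewrite /K /energy_density chiE// mul1r.
  by rewrite mulrC.
rewrite -/K (@seg_int_split _ a' a b)//; last first.
  by rewrite (ltW aa) (le_trans ab)// ltW.
rewrite (@seg_int_split _ b' a' b); last 2 first.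
- by rewrite ab ltW.
- by apply: cont_onW cK => //; exact: ltW.
rewrite addrCA lerDl addr_ge0//; apply: seg_int_ge0 => r /andP[r1 _]; apply: K0 => //.
by rewrite (le_trans (ltW aa))// (le_trans ab).
Qed.

Lemma partial_out_supp (R : realType) n (phi : 'rV[R]_n -> R) (i : 'I_n) x :
  ~ closure [set y | phi y != 0] x -> partial i phi x = 0.
Proof.
move=> xS.
have near0 : \near x, 0 = phi x.
  have : nbhs x (~` closure [set y | phi y != 0]).
    apply: open_nbhs_nbhs; split => //.
    by apply: closed_openC; exact: closed_closure.
  apply: filterS => y yS; apply/esym/eqP/negPn/negP => py; apply: yS.
  exact: subset_closure.
rewrite /partial -(near_eq_derive _ near0).
exact: derive_cst.
Qed.

(** Weak gradients restrict to smaller sets; in particular the chosen weak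
    gradient on a smaller set is a genuine one. *)
Lemma weak_gradients_sub (R : realType) n (Omega Omega' : set 'rV[R]_n)
    (u : 'rV[R]_n -> R) (g : 'rV[R]_n -> 'rV[R]_n) :
  measurable Omega -> measurable Omega' -> Omega' `<=` Omega ->
  weak_gradients Omega u g -> weak_gradients Omega' u g.
Proof.
move=> mO mO' sub hg i; have [[mg ig] wg] := hg i.
have mg' : measurable_fun Omega' (fun x => g x ord0 i) by apply: measurable_funS mg.
split.
  split => //; apply: le_lt_trans ig; apply: ge0_subset_integral => //.
    by apply/measurable_EFinP; exact: measurable_funX.
  by move=> x _; rewrite lee_fin sqr_ge0.
move=> phi [C1 cpt supp].
have tf : test_function Omega phi by split => // x /supp/sub.
have := wg _ tf.
have phi0 x : ~ Omega' x -> phi x = 0.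
  move=> xO; apply/eqP/negPn/negP => px; apply: xO; apply: supp.
  exact: subset_closure.
rewrite (@integral_supp _ _ _ _ Omega') => [||x _ xO]//; last first.
  by rewrite partial_out_supp ?mulr0// => /supp.
rewrite [X in (- X)%E](@integral_supp _ _ _ _ Omega') => [||x _ xO]//.
by rewrite phi0// mulr0.
Qed.

Lemma measurable_oball (R : realType) n (r : R) : measurable (@oball R n r).
Proof.
rewrite (_ : oball n r = @enorm R n @^-1` `]-oo, r[%classic).
  rewrite -[X in measurable X]setTI.
  exact: (measurable_enorm measurableT (measurable_itv `]-oo, r[%R)).
by apply/seteqP; split => x; rewrite /oball /= in_itv.
Qed.

Lemma measurable_outer_annulus (R : realType) n : measurable (outer_annulus R n).
Proof. by apply: measurableD; [exact: measurable_oball|exact: measurable_cball]. Qed.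

Lemma annulus_sub_outer (R : realType) n (a b : R) : 2^-1 < a -> b < 1 ->
  annulus n a b `<=` outer_annulus R n.
Proof.
move=> a2 b1 x /andP[ax xb]; split; first by rewrite /oball /= (le_lt_trans xb).
by rewrite /cball /=; apply/negP; rewrite -ltNge (lt_le_trans a2).
Qed.

Lemma bounded_energy (R : realType) n (u p p1 : R -> R) :
  H1 (oball n.+1 1) (radial n.+1 u) ->
  (forall r : R, 0 < r < 1 ->
    [/\ is_derive r 1 u (p r), is_derive r 1 p (p1 r) & {for r, continuous p1}]) ->
  exists M : R, forall c d : R, 0 < c -> c <= d -> d < 1 ->
    seg_int c d (energy_density n p) <= M.
Proof.
move=> [_ [g hg]] hu.
have mO := @measurable_oball R n.+1 1.
have s0 := sphere_area_gt0 R n.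
pose I := (\int[lebesgue_rV R n.+1]_(x in oball n.+1 1) (enorm (g x) ^+ 2)%:E)%E.
have Ifin : (I < +oo)%E.
  rewrite /I; under eq_integral do rewrite enorm_sqr -sumEFin.
  rewrite ge0_integral_sum//; first last.
  - by move=> i x _; rewrite lee_fin sqr_ge0.
  - move=> i; have [[mg _] _] := hg i.
    by apply/measurable_EFinP; exact: measurable_funX.
  by apply: lte_sum_pinfty => i _; have [[_ ig] _] := hg i.
have I0 : (0 <= I)%E by apply: integral_ge0 => x _; rewrite lee_fin sqr_ge0.
exists (fine I / sphere_area R n) => c d c0 cd d1.
rewrite ler_pdivlMr// mulrC -lee_fin fineK ?ge0_fin_numE//.
have c2 : 0 < c / 2 by rewrite divr_gt0.
have cc : c / 2 < c by lra.
have dd : d < (1 + d) / 2 by lra.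
have d1' : (1 + d) / 2 < 1 by lra.
exact: (energy_le_weak_gradient mO c2 cc cd dd d1' (annulus_sub_oball d1') hu hg).
Qed.

Lemma H1_norm_sqr (R : realType) n (Omega : set 'rV[R]_n) (u : 'rV[R]_n -> R) (h : R) :
  H1_norm Omega u = h%:E ->
  (\int[lebesgue_rV R n]_(x in Omega)
      (u x ^+ 2 + enorm (weak_gradient Omega u x) ^+ 2)%:E = (h ^+ 2)%:E)%E.
Proof.
move=> H; set I := (LHS).
have : (I `^ 2^-1)%E = h%:E by exact: H.
have : (0 <= I)%E.
  by apply: integral_ge0 => x _; rewrite lee_fin addr_ge0 ?sqr_ge0.
case: I => [r| |]//.
- rewrite lee_fin => r0; rewrite poweR_EFin powR12_sqrt// => -[<-].
  by rewrite sqr_sqrtr.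
- by move=> _; rewrite poweRyr// invr_eq0 pnatr_eq0.
Qed.

Lemma H1_norm_outer_control (R : realType) n (u p p1 : R -> R) (h : R) :
  H1 (oball n.+1 1) (radial n.+1 u) ->
  (forall r : R, 0 < r < 1 ->
    [/\ is_derive r 1 u (p r), is_derive r 1 p (p1 r) & {for r, continuous p1}]) ->
  H1_norm (outer_annulus R n.+1) (radial n.+1 u) = h%:E ->
  forall d : R, 5 / 8 <= d -> d < 1 ->
  sphere_area R n * seg_int (5 / 8) d (fun r => (u r ^+ 2 + p r ^+ 2) * r ^+ n)
    <= h ^+ 2.
Proof.
move=> [[mU _] [g0 hg0]] hu /H1_norm_sqr E d d58 d1.
have mB := @measurable_oball R n.+1 1.
have mO := @measurable_outer_annulus R n.+1.
have subB : outer_annulus R n.+1 `<=` oball n.+1 1 by move=> x [].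
have hg : weak_gradients (outer_annulus R n.+1) (radial n.+1 u)
    (weak_gradient (outer_annulus R n.+1) (radial n.+1 u)).
  apply: xgetPex; exists g0.
  exact: weak_gradients_sub mB mO subB hg0.
set g := weak_gradient _ _ in E hg.
have mU' : measurable_fun (outer_annulus R n.+1) (radial n.+1 u).
  exact: measurable_funS mU.
have in01 (r : R) : 5 / 8 <= r <= d -> 0 < r < 1.
  by move=> /andP[? ?]; apply/andP; split; lra.
have cu2 : cont_on (5 / 8) d (fun r => u r ^+ 2).
  by move=> r /in01 r01; apply: contX; have [du _ _] := hu r r01; exact: der_continuous du.
have cp2 : cont_on (5 / 8) d (fun r => p r ^+ 2).
  by move=> r /in01 r01; apply: contX; have [_ dp _] := hu r r01; exact: der_continuous dp.
have cn (f : R -> R) : cont_on (5 / 8) d f -> cont_on (5 / 8) d (fun r => f r * r ^+ n).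
  by move=> cf r rr; apply: contM; [exact: cf|exact: cont_exprn].
have -> : seg_int (5 / 8) d (fun r => (u r ^+ 2 + p r ^+ 2) * r ^+ n) =
    seg_int (5 / 8) d (fun r => u r ^+ 2 * r ^+ n) +
    seg_int (5 / 8) d (energy_density n p).
  rewrite (@eq_seg_int _ _ _ (energy_density n p) (fun r => p r ^+ 2 * r ^+ n)).
    rewrite -seg_intD; [|exact: cn|exact: cn].
    by apply: eq_seg_int => r _; rewrite mulrDl.
  by move=> r _; rewrite /energy_density mulrC.
have h1 : ((sphere_area R n * seg_int (5 / 8) d (energy_density n p))%:E <=
    \int[lebesgue_rV R n.+1]_(x in outer_annulus R n.+1) (enorm (g x) ^+ 2)%:E)%E.
  have a0 : 0 < 9 / 16 :> R by lra.
  have a1 : 9 / 16 < 5 / 8 :> R by lra.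
  have b1 : d < (1 + d) / 2 by lra.
  have b2 : (1 + d) / 2 < 1 by lra.
  have a2 : 2^-1 < 9 / 16 :> R by lra.
  exact: (energy_le_weak_gradient mO a0 a1 d58 b1 b2 (annulus_sub_outer a2 b2) hu hg).
have h2 : ((sphere_area R n * seg_int (5 / 8) d (fun r => u r ^+ 2 * r ^+ n))%:E <=
    \int[lebesgue_rV R n.+1]_(x in outer_annulus R n.+1) (radial n.+1 u x ^+ 2)%:E)%E.
  have a0 : (0 : R) < 5 / 8 <= d by rewrite d58 andbT; lra.
  have [_ <-] := @polar_integral R n (5 / 8) d (fun r => u r ^+ 2) a0 cu2.
  apply: ge0_subset_integral => //.
  - exact: measurable_annulus.
  - by apply/measurable_EFinP; exact: measurable_funX.
  - by move=> x _; rewrite lee_fin sqr_ge0.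
  - by apply: annulus_sub_outer => //; lra.
have mg2 : measurable_fun (outer_annulus R n.+1) (fun x => enorm (g x) ^+ 2).
  rewrite (_ : (fun x => _) = (fun x => \sum_i (g x ord0 i ^+ 2))).
    apply: measurable_sum => i; apply: measurable_funX.
    by have [[]] := hg i.
  by apply/funext => x; rewrite enorm_sqr.
rewrite -lee_fin -E mulrDr EFinD.
under [leRHS]eq_integral do rewrite EFinD.
rewrite ge0_integralD//.
- exact: leeD.
- by move=> x _; rewrite lee_fin sqr_ge0.
- by apply/measurable_EFinP; exact: measurable_funX.
- by move=> x _; rewrite lee_fin sqr_ge0.
- exact/measurable_EFinP.
Qed.

(** The origin, where u is unconstrained, is a null set. *)
Lemma Linfty_norm_le (R : realType) n (u : R -> R) (K : R) : 0 <= K ->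
  (forall r : R, 0 < r < 1 -> `|u r| <= K) ->
  (Linfty_norm (oball n.+1 1) (radial n.+1 u) <= K%:E)%E.
Proof.
move=> K0 uK; rewrite /Linfty_norm unlock /Lnorm; case: ifPn => // _.
apply/ess_supP.
exists [set 0]; split.
- rewrite -[X in measurable X]setTI.
  rewrite (_ : [set 0] = (@enorm R n.+1) @^-1` `]-oo, 0]%classic).
    exact: (measurable_enorm measurableT (measurable_itv `]-oo, 0]%R)).
  apply/seteqP; split => x /=; rewrite in_itv/=.
    by move=> ->; rewrite le_eqVlt enorm_eq0 eqxx.
  by rewrite le_eqVlt ltNge enorm_ge0 orbF enorm_eq0 => /eqP.
- exact: lebesgue_rV_set0.
- move=> x /= xK; apply: contrapT => /eqP x0; apply: xK.
  rewrite patchE; case: ifPn => [/set_mem xB|_]; last by rewrite normr0 lee_fin.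
  rewrite /= lee_fin; apply: uK; rewrite lt_def enorm_eq0 x0 enorm_ge0/=.
  exact: xB.
Qed.

Lemma le_of_forall_gt0 (R : realType) (x K h : R) : 0 <= K ->
  (forall e, 0 < e -> x <= K * (h + e)) -> x <= K * h.
Proof.
move=> K0 H; apply/ler_addgt0Pr => e e0.
have K1 : 0 < K + 1 by rewrite ltr_wpDl.
apply: le_trans (H (e / (K + 1)) (divr_gt0 e0 K1)) _.
rewrite mulrDr lerD2l mulrCA ler_piMr ?(ltW e0)//.
by rewrite ler_pdivrMr// mul1r lerDl.
Qed.

(** A bound on [5/8, 1[ extends to the boundary point 1 by continuity. *)
Lemma bound_at_1 (R : realType) (u : R -> R) (K : R) :
  {within [set r : R | 0 < r <= 1], continuous u} ->
  (forall r, 5 / 8 <= r < 1 -> `|u r| <= K) -> `|u 1| <= K.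
Proof.
move=> /subspace_continuousP cu uK.
have c1 : u r @[r --> within [set r : R | 0 < r <= 1] (nbhs (1 : R))] --> u 1.
  by apply: cu; rewrite /= ltr01 lexx.
have c2 : u r @[r --> 1^'-] --> u 1.
  apply: cvg_trans c1; apply: cvg_app => A.
  move=> wA; have h0 : \forall r \near (1 : R), 0 < r by exact: lt_nbhsr.
  suff : nbhs (1 : R) (fun r => r < 1 -> A r) by [].
  have : nbhs (1 : R) (fun r => 0 < r <= 1 -> A r) by exact: wA.
  move=> /(filterI h0); apply: filterS => r [r0 wr] r1; apply: wr.
  by rewrite r0 ltW.
have c3 : `|u r| @[r --> 1^'-] --> `|u 1| by exact: (cvg_norm c2).
apply: (cvgr_to_le c3).
have h0 : \forall r \near (1 : R), 5 / 8 < r by apply: lt_nbhsr; lra.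
suff : nbhs (1 : R) (fun r => r < 1 -> `|u r| <= K) by [].
apply: filterS h0 => r r0 r1; apply: uK.
by rewrite r1 ltW.
Qed.

(** * Estimates for semi-stable radial solutions *)

Lemma gamma_exponentE (R : realType) n (al : R) : (1 <= n)%N -> -2 < al ->
  gamma_exponent n.+1 al = decay_exponent n al.
Proof.
move=> n1 al2; rewrite /gamma_exponent /decay_exponent /hardy_b.
have -> : (al + 2) * (al + 2 * n.+1%:R - 2) =
    2 ^+ 2 * ((al / 2 + 1) * (al / 2 + n%:R)).
  by rewrite -natr1; field.
rewrite sqrtrM ?sqr_ge0// sqrtr_sqr ger0_norm// -natr1.
by field.
Qed.

Theorem theorem2p1 (R : realType) (N : nat) (alpha : R) (hN : (2 <= N)%N)
    (halpha : - 2 < alpha) :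
  exists C : R, forall (f : R -> R) (u : R -> R),
    C1_real f ->
    {within [set r : R | 0 < r <= 1], continuous u} ->
    H1 (oball N 1) (radial N u) ->
    classical_solution alpha f (punctured_ball R N) (radial N u) ->
    semi_stable alpha f (radial N u) ->
    [/\ N%:R < 10 + 4 * alpha ->
          (Linfty_norm (oball N 1) (radial N u)
           <= C%:E * H1_norm (outer_annulus R N) (radial N u))%E,
        N%:R = 10 + 4 * alpha ->
          forall r : R, 0 < r <= 1 ->
          (`|u r|%:E <= C%:E * H1_norm (outer_annulus R N) (radial N u)
                        * (`|ln r| + 1)%:E)%E
      & 10 + 4 * alpha < N%:R ->
          forall r : R, 0 < r <= 1 ->
          (`|u r|%:E <= C%:E * H1_norm (outer_annulus R N) (radial N u)
                        * (r `^ gamma_exponent N alpha)%:E)%E].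
Proof.
case: N hN => [//|n] n1.
have [C0 C00 bound] := radial_bound n1 halpha.
have s0 := sphere_area_gt0 R n.
pose q := Num.sqrt (sphere_area R n).
have q0 : 0 < q by rewrite sqrtr_gt0.
pose C := C0 / q.
have C1 : 0 < C by rewrite divr_gt0.
exists C => f u [df cf] cu hH1 sol st.
have dfs (t : R) : is_derive t 1 f (derive1 f t).
  by rewrite derive1E; apply: derivableP; exact: df.
have cfs (t : R) : {for t, continuous (derive1 f)} by exact: cf.
have [p [p1 eq_u]] := radial_equation_of_solution sol.
have hu (r : R) : 0 < r < 1 ->
    [/\ is_derive r 1 u (p r), is_derive r 1 p (p1 r) & {for r, continuous p1}].
  by move=> /eq_u[].
have rst := radially_stable_of_semi_stable (conj df cf) eq_u st.
have [M kM] := bounded_energy hH1 hu.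
set nrm := H1_norm _ _.
rewrite gamma_exponentE//; set g := decay_exponent n alpha.
have [g_pos g_0 g_neg] := sgr_decay_exponent n1 halpha.
have nE : n.+1%:R = n%:R + 1 :> R by rewrite natr1.
have nrm0 : (0 <= nrm)%E by exact: poweR_ge0.
(* if the norm is infinite there is nothing to prove, since C > 0 *)
move Enrm : nrm nrm0 => [h| |] nrm0; last 2 first.
  have Coo (x : R) : 0 < x -> (C%:E * +oo * x%:E = +oo)%E.
    by move=> x0; rewrite gt0_muley ?lte_fin// gt0_mulye ?lte_fin.
  split.
  - by move=> _; rewrite gt0_muley ?lte_fin// leey.
  - by move=> _ r _; rewrite Coo ?leey// ltr_wpDl.
  - by move=> _ r /andP[r0 _]; rewrite Coo ?leey// powR_gt0.
- by [].
have h0 : 0 <= h by move: nrm0; rewrite lee_fin.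
have outer := H1_norm_outer_control hH1 hu Enrm.
(* [radial_bound] needs a positive H; the norm h may vanish, hence h + e *)
have key (r e : R) : 0 < r < 1 -> 0 < e ->
    [/\ 0 < g -> `|u r| <= C * (h + e),
        g = 0 -> `|u r| <= C * (h + e) * (`|ln r| + 1),
        g < 0 -> `|u r| <= C * (h + e) * r `^ g &
        5 / 8 <= r -> `|u r| <= C * (h + e)].
  move=> r01 e0; have he : 0 < h + e by rewrite ltr_wpDl.
  have H0 : 0 < (h + e) / q by rewrite divr_gt0.
  have EH (d : R) : 5 / 8 <= d -> d < 1 ->
      seg_int (5 / 8) d (fun r => (u r ^+ 2 + p r ^+ 2) * r ^+ n) <= ((h + e) / q) ^+ 2.
    move=> d58 d1; rewrite expr_div_n sqr_sqrtr ?(ltW s0)//.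
    rewrite ler_pdivlMr// mulrC; apply: le_trans (outer d d58 d1) _.
    by rewrite ler_pXn2r// ?nnegrE ?(ltW he)// lerDl ltW.
  have := bound f (derive1 f) u p p1 M _ dfs cfs eq_u rst kM H0 EH r r01.
  by rewrite mulrA mulrAC -/C.
have at1 : `|u 1| <= C * h.
  apply: le_of_forall_gt0; first exact: ltW.
  move=> e e0; apply: (bound_at_1 cu) => r /andP[r58 r1].
  have r01 : 0 < r < 1 by rewrite r1 andbT; lra.
  by have [_ _ _] := key r e r01 e0; apply.
have Ch0 : 0 <= C * h by rewrite mulr_ge0// ltW.
split.
- move=> hN; rewrite -EFinM; apply: Linfty_norm_le => // r r01.
  apply: le_of_forall_gt0; first exact: ltW.
  by move=> e e0; have [+ _ _ _] := key r e r01 e0; apply; apply: g_pos; lra.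
- move=> hN r /andP[r0]; rewrite le_eqVlt => /predU1P[->|r1].
    by rewrite ln1 normr0 add0r mule1 -EFinM lee_fin.
  have r01 : 0 < r < 1 by rewrite r0.
  rewrite -!EFinM lee_fin mulrAC; apply: le_of_forall_gt0.
    by rewrite mulr_ge0// ?(ltW C1)// addr_ge0.
  move=> e e0; rewrite mulrAC.
  by have [_ + _ _] := key r e r01 e0; apply; apply: g_0; lra.
- move=> hN r /andP[r0]; rewrite le_eqVlt => /predU1P[->|r1].
    by rewrite powR1 mule1 -EFinM lee_fin.
  have r01 : 0 < r < 1 by rewrite r0.
  rewrite -!EFinM lee_fin mulrAC; apply: le_of_forall_gt0.
    by rewrite mulr_ge0 ?powR_ge0// ltW.
  move=> e e0; rewrite mulrAC.
  by have [_ _ + _] := key r e r01 e0; apply; apply: g_neg; lra.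
Qed.
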